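(* Let $(N,h)$ be a closed Riemannian manifold and let $H$ be a torus with Lie algebra $\mathfrak h=T_eH$, equipped with an invariant metric. Let $\lambda,\lambda'$ be two $\mathfrak h$-valued $1$-forms on $N$ such that for each $Z\in\mathfrak h$ we have $\lambda'_Z\in\mathrm{Isom}(N,h)^*(\lambda_Z)$, i.e. there exists an isometry $f_Z$ of $(N,h)$ with $\lambda'_Z=f_Z^*\lambda_Z$. Then the Riemannian manifolds $(N\times H,g_\lambda)$ and $(N\times H,g_{\lambda'})$ are isospectral.
   Context: A torus is a compact connected abelian Lie group; an invariant metric on it is a left invariant (equivalently bi-invariant) Riemannian metric, inducing the scalar product $\langle\,,\rangle$ on $\mathfrak h$. For an $\mathfrak h$-valued $1$-form $\lambda$ on $N$ and $Z\in\mathfrak h$ put $\lambda_Z:=\langle\lambda(\,.\,),Z\rangle$. The metric $g_\lambda$ on $N\times H$ is the $H$-invariant metric for which the fibers $\{p\}\times H$ carry the given metric of $H$, the projection to $(N,h)$ is a Riemannian submersion, and the vectors $(X,-\lambda(X))$, $X\in TN$, are orthogonal to the fibers. Explicitly, identifying $T_{(p,z)}(N\times H)\cong T_pN\times\mathfrak h$, $g_\lambda((X,Z),(Y,W))=h(X,Y)+\langle\lambda(X)+Z,\lambda(Y)+W\rangle$. Two closed Riemannian manifolds are isospectral if the eigenvalue spectra (with multiplicities) of their Laplace operators acting on functions coincide. *)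

(* Defs.v *)
From HB Require Import structures.
From mathcomp Require Import all_boot all_order all_algebra.
From mathcomp Require Import all_classical all_reals.
From mathcomp Require Import ereal topology normedtype derive.

Set Implicit Arguments.
Unset Strict Implicit.
Unset Printing Implicit Defensive.

Import Order.TTheory GRing.Theory Num.Theory.
Import numFieldNormedType.Exports.

Local Open Scope classical_set_scope.
Local Open Scope ring_scope.

(* [cont_diff k U f]: f is of class C^k on the open set U.  Neither the
   predicate nor the derivatives at points of U depend on f outside U. *)
Fixpoint cont_diff (R : realType) (n : nat) (V : normedModType R) (k : nat)
    (U : set 'rV[R]_n) (f : 'rV[R]_n -> V) : Prop :=
  (forall x, U x -> {for x, continuous f}) /\
  (if k is j.+1 then
     forall v, (forall x, U x -> derivable f x v) /\ cont_diff j U ('D_v f)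
   else True).

Definition smooth_on (R : realType) (n : nat) (V : normedModType R)
    (U : set 'rV[R]_n) (f : 'rV[R]_n -> V) : Prop :=
  forall k, cont_diff k U f.

(* [chart_fun] and [chart_inv] are only meaningful on [chart_dom] and on
   [chart_img] respectively. *)
Record chart (R : realType) (T : topologicalType) (n : nat) := Chart {
  chart_dom : set T ;
  chart_fun : T -> 'rV[R]_n ;
  chart_inv : 'rV[R]_n -> T }.

Definition chart_img (R : realType) (T : topologicalType) (n : nat)
  (c : chart R T n) : set 'rV[R]_n := chart_fun c @` chart_dom c.

Definition is_chart (R : realType) (T : topologicalType) (n : nat)
    (c : chart R T n) : Prop :=
  [/\ open (chart_dom c),
      open (chart_img c),
      forall x, chart_dom c x -> chart_inv c (chart_fun c x) = x,
      forall x, chart_dom c x -> {for x, continuous (chart_fun c)} &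
      forall y, chart_img c y -> {for y, continuous (chart_inv c)}].

(* A smooth structure is given by an atlas that selects a chart [A p] around
   each point p; every maximal smooth atlas contains such an atlas, which in
   turn generates it.  The selected chart identifies the tangent space T_pM
   with 'rV[R]_n: the row v stands for the velocity at 0 of the curve with
   coordinates chart_fun (A p) p + t v in the chart A p.  All tensors below
   are expressed through this identification. *)
Definition atlas (R : realType) (T : topologicalType) (n : nat) : Type :=
  T -> chart R T n.

Definition is_manifold (R : realType) (T : topologicalType) (n : nat)
    (A : atlas R T n) : Prop :=
  [/\ hausdorff_space T,
      @second_countable T,
      forall p, is_chart (A p) /\ chart_dom (A p) p &
      forall p q, smooth_on
        (chart_fun (A p) @` (chart_dom (A p) `&` chart_dom (A q)))
        (chart_fun (A q) \o chart_inv (A p))].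

Definition is_closed_manifold (R : realType) (T : topologicalType) (n : nat)
  (A : atlas R T n) : Prop := is_manifold A /\ compact [set: T].

Definition prod_atlas (R : realType) (T S : topologicalType) (n m : nat)
    (A : atlas R T n) (B : atlas R S m) : atlas R (T * S)%type (n + m) :=
  fun p => Chart
    (chart_dom (A p.1) `*` chart_dom (B p.2))
    (fun x => row_mx (chart_fun (A p.1) x.1) (chart_fun (B p.2) x.2))
    (fun y => (chart_inv (A p.1) (lsubmx y), chart_inv (B p.2) (rsubmx y))).

Definition smooth_fun (R : realType) (T : topologicalType) (n : nat)
    (A : atlas R T n) (f : T -> R) : Prop :=
  forall p, smooth_on (chart_img (A p)) (f \o chart_inv (A p)).

Definition smooth_map (R : realType) (T S : topologicalType) (n m : nat)
    (A : atlas R T n) (B : atlas R S m) (f : T -> S) : Prop :=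
  continuous f /\
  forall p q, smooth_on
    (chart_fun (A p) @` (chart_dom (A p) `&` f @^-1` chart_dom (B q)))
    (chart_fun (B q) \o f \o chart_inv (A p)).

(* The differential T_pM -> T_(f p)M' of a smooth map. *)
Definition mdiff (R : realType) (T S : topologicalType) (n m : nat)
    (A : atlas R T n) (B : atlas R S m) (f : T -> S) (p : T)
    (v : 'rV[R]_n) : 'rV[R]_m :=
  'D_v (chart_fun (B (f p)) \o f \o chart_inv (A p)) (chart_fun (A p) p).

Definition is_diffeo (R : realType) (T S : topologicalType) (n m : nat)
    (A : atlas R T n) (B : atlas R S m) (f : T -> S) : Prop :=
  smooth_map A B f /\
  exists g : S -> T, [/\ smooth_map B A g, cancel f g & cancel g f].

(* [coord_vec A p x v], for x in the image of the chart A p, is the tangent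
   vector at q := chart_inv (A p) x whose components in the chart A p are v,
   i.e. its representative in the chart A q selected at q. *)
Definition coord_vec (R : realType) (T : topologicalType) (n : nat)
    (A : atlas R T n) (p : T) (x v : 'rV[R]_n) : 'rV[R]_n :=
  'D_v (chart_fun (A (chart_inv (A p) x)) \o chart_inv (A p)) x.

(* Covariant 2-tensors; [g p] is a form on T_pM. *)
Definition form2 (R : realType) (T : topologicalType) (n : nat) : Type :=
  T -> 'rV[R]_n -> 'rV[R]_n -> R.

Definition local_form2 (R : realType) (T : topologicalType) (n : nat)
    (A : atlas R T n) (g : form2 R T n) (p : T) (v w x : 'rV[R]_n) : R :=
  g (chart_inv (A p) x) (coord_vec A p x v) (coord_vec A p x w).

Definition is_metric (R : realType) (T : topologicalType) (n : nat)
    (A : atlas R T n) (g : form2 R T n) : Prop :=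
  [/\ forall p u (a : R) v w, g p u (a *: v + w) = a * g p u v + g p u w,
      forall p v w, g p v w = g p w v,
      forall p v, v != 0 -> 0 < g p v v &
      forall p v w, smooth_on (chart_img (A p)) (local_form2 A g p v w)].

Definition is_isometry (R : realType) (T : topologicalType) (n : nat)
    (A : atlas R T n) (g : form2 R T n) (f : T -> T) : Prop :=
  is_diffeo A A f /\
  forall p v w, g (f p) (mdiff A A f p v) (mdiff A A f p w) = g p v w.

(* The Gram matrix (g_ij) of g in the chart A p, at the point of
   coordinates x. *)
Definition gram (R : realType) (T : topologicalType) (n : nat)
    (A : atlas R T n) (g : form2 R T n) (p : T) (x : 'rV[R]_n) : 'M[R]_n :=
  \matrix_(i, j) local_form2 A g p (delta_mx 0 i) (delta_mx 0 j) x.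

(* The Laplace operator - div grad, evaluated at p in the chart A p:
   - |g|^(-1/2) sum_i d_i (|g|^(1/2) sum_j g^ij d_j f). *)
Definition laplacian (R : realType) (T : topologicalType) (n : nat)
    (A : atlas R T n) (g : form2 R T n) (f : T -> R) (p : T) : R :=
  let vol x := Num.sqrt (\det (gram A g p x)) in
  let grad i x :=
    \sum_j invmx (gram A g p x) i j *
           'D_(delta_mx 0 j) (f \o chart_inv (A p)) x in
  let x0 := chart_fun (A p) p in
  - ((vol x0)^-1 *
     \sum_(i < n) 'D_(delta_mx 0 i) (fun x => vol x * grad i x : R) x0).

Definition eigenfunction (R : realType) (T : topologicalType) (n : nat)
    (A : atlas R T n) (g : form2 R T n) (mu : R) (f : T -> R) : Prop :=
  smooth_fun A f /\ forall p, laplacian A g f p = mu * f p.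

Definition lin_indep (R : realType) (T : Type) (m : nat)
    (e : 'I_m -> T -> R) : Prop :=
  forall c : 'I_m -> R,
    (forall x, \sum_(i < m) c i * e i x = 0) -> forall i, c i = 0.

(* The dimension, possibly +oo, of the mu-eigenspace; it is 0 when mu is not
   an eigenvalue. *)
Definition multiplicity (R : realType) (T : topologicalType) (n : nat)
    (A : atlas R T n) (g : form2 R T n) (mu : R) : \bar R :=
  ereal_sup [set (m%:R)%:E | m in [set m : nat |
    exists e : 'I_m -> T -> R,
      (forall i, eigenfunction A g mu (e i)) /\ lin_indep e]].

Definition isospectral (R : realType) (T S : topologicalType) (n m : nat)
    (A : atlas R T n) (g : form2 R T n)
    (B : atlas R S m) (g' : form2 R S m) : Prop :=
  forall mu : R, multiplicity A g mu = multiplicity B g' mu.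

(* The group law is written additively. *)
Definition is_torus (R : realType) (H : topologicalZmodType) (k : nat)
    (B : atlas R H k) : Prop :=
  [/\ is_manifold B,
      smooth_map (prod_atlas B B) B (fun z : H * H => z.1 + z.2),
      smooth_map B B (fun z : H => - z),
      compact [set: H] &
      connected [set: H]].

Definition left_invariant (R : realType) (H : topologicalZmodType) (k : nat)
    (B : atlas R H k) (g : form2 R H k) : Prop :=
  forall (a z : H) v w,
    g (a + z) (mdiff B B (fun y => a + y) z v) (mdiff B B (fun y => a + y) z w)
    = g z v w.

(* The identification of T_zH with the Lie algebra T_0H by translation. *)
Definition to_lie (R : realType) (H : topologicalZmodType) (k : nat)
    (B : atlas R H k) (z : H) (v : 'rV[R]_k) : 'rV[R]_k :=
  mdiff B B (fun y => - z + y) z v.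

(* 1-forms with values in a k-dimensional space, here the Lie algebra
   T_0H = 'rV[R]_k of H. *)
Definition form1 (R : realType) (T : topologicalType) (n k : nat) : Type :=
  T -> 'rV[R]_n -> 'rV[R]_k.

Definition is_form1 (R : realType) (T : topologicalType) (n k : nat)
    (A : atlas R T n) (lam : form1 R T n k) : Prop :=
  (forall p (a : R) v w, lam p (a *: v + w) = a *: lam p v + lam p w) /\
  forall p v, smooth_on (chart_img (A p))
    (fun x => lam (chart_inv (A p) x) (coord_vec A p x v)).

(* lambda_Z = < lambda(.), Z > *)
Definition component (R : realType) (T : topologicalType)
    (H : topologicalZmodType) (n k : nat) (gH : form2 R H k)
    (lam : form1 R T n k) (Z : 'rV[R]_k) (p : T) (v : 'rV[R]_n) : R :=
  gH 0 (lam p v) Z.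

Definition pullback (R : realType) (T : topologicalType) (n : nat)
    (A : atlas R T n) (f : T -> T) (alpha : T -> 'rV[R]_n -> R)
    (p : T) (v : 'rV[R]_n) : R :=
  alpha (f p) (mdiff A A f p v).

(* A vector of T_(p,z)(N x H) is a row (X Z), with Z in T_zH. *)
Definition g_lambda (R : realType) (N : topologicalType)
    (H : topologicalZmodType) (n k : nat) (h : form2 R N n)
    (B : atlas R H k) (gH : form2 R H k) (lam : form1 R N n k) :
    form2 R (N * H)%type (n + k) :=
  fun q u v =>
    h q.1 (lsubmx u) (lsubmx v) +
    gH 0 (lam q.1 (lsubmx u) + to_lie B q.2 (rsubmx u))
         (lam q.1 (lsubmx v) + to_lie B q.2 (rsubmx v)).

(* Main.v *)
Require Import Defs.
From HB Require Import structures.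
From mathcomp Require Import all_boot all_order all_algebra.
From mathcomp Require Import all_classical all_reals.
From mathcomp Require Import ereal topology normedtype landau derive realfun.
From mathcomp Require Import complex ring lra.

(* The translations of H act on the finite-dimensional mu-eigenspace of g_lambda
   by a bounded commutative group of operators, which is simultaneously
   diagonalizable over the complex numbers: the eigenspace has a basis of functions
   F with F(p, z + a) = chi(a) F(p, z) for characters chi of H.  If the differential
   of chi at 0 is i <., Z>, the Laplacian of g_lambda' sees lambda' on F only through
   lambda'_Z = f_Z^* lambda_Z, so that F o (f_Z x id) is a mu-eigenfunction of
   g_lambda'.  These functions are again linearly independent, so the multiplicity
   of mu does not decrease; exchanging lambda and lambda' gives equality.

   Finite-dimensionality of the eigenspaces comes from Bernstein's gradient estimate:
   an eigenfunction that vanishes on a fine enough finite set is zero. *)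

Set Implicit Arguments.
Unset Strict Implicit.
Unset Printing Implicit Defensive.

Import Order.TTheory GRing.Theory Num.Theory.
Import numFieldNormedType.Exports.

Local Open Scope classical_set_scope.
Local Open Scope ring_scope.

(** * Functions of class C^k *)

(** Everything is pointwise and real: no integral over N x H is available to make the translations
    unitary. Compactness replaces the L^2 product: eigenfunctions are bounded, and bounded orbits
    exclude Jordan blocks and force |chi| = 1. The complex function F = u + i v is carried as a pair
    of real functions.

    Why only the Z-component counts: let two forms agree on it. Their metrics have the same volume
    density. The fibre derivatives of F are multiples of F by i <., Z>, so the horizontal part of
    its gradient is the same for both. The two gradients differ by a vertical field, the contraction
    of the horizontal gradient with the difference of the forms. Left-invariant fields being
    divergence free, only the coefficients of this field contribute to its divergence, and their
    derivatives add up to a pairing of the difference of the forms with Z, which is zero.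

    Independence after the transfer is not automatic, since f_Z changes with the character. It rests
    on f_Z being the same for equal characters and on f_Z x id commuting with the translations of
    H. *)

Notation base j := (delta_mx 0 j : 'rV_ _).

Lemma continuous_at_mx (R : realType) (T : topologicalType) m1 m2
    (g : T -> 'M[R]_(m1, m2)) x : {for x, continuous g} <->
  forall i j, {for x, continuous (fun x => g x i j)}.
Proof.
split=> [cg i j|cg].
  by apply: (@continuous_comp _ _ _ g (fun M : 'M[R]_(m1, m2) => M i j)) => //;
    exact: coord_continuous.
apply/cvgrPdist_le => e e0; near=> y.
rewrite /Num.norm/= mx_normrE (bigmax_le _ (ltW e0))//= => i _.
rewrite !mxE /=; move: i; near: y; apply: filter_forall => i.
exact: ((cvgrPdist_le _ _).1 (cg i.1 i.2)).
Unshelve. all: by end_near. Qed.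

Section ContDiff.
Context {R : realType} {n : nat}.
Implicit Types (U : set 'rV[R]_n).

Lemma open_near U x : open U -> U x -> \forall y \near x, U y.
Proof. by move=> oU Ux; exact: open_nbhs_nbhs. Qed.

Section Gen.
Context {V : normedModType R}.
Implicit Types (f g : 'rV[R]_n -> V).

Lemma cont_diffW k U f : cont_diff k.+1 U f -> cont_diff k U f.
Proof.
elim: k f => [|k IH] f [cf df]; first by split.
by split=> // v; have [dv cv] := df v; split=> //; apply: IH.
Qed.

Lemma cont_diff_le j k U f : (j <= k)%N -> cont_diff k U f -> cont_diff j U f.
Proof.
move=> /subnK <-; elim: (k - j)%N => [//|m IH].
by rewrite addSn => /cont_diffW.
Qed.

Lemma cont_diff_sub k U U' f : U `<=` U' -> cont_diff k U' f -> cont_diff k U f.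
Proof.
move=> sUU'; elim: k f => [|k IH] f [cf df]; split=> //.
- by move=> x /sUU'/cf.
- by move=> x /sUU'/cf.
- by move=> v; have [dv cv] := df v; split; [move=> x /sUU'/dv|exact: IH].
Qed.

Lemma near_eq_continuous_at (T : topologicalType) (W : topologicalType)
    (f g : T -> W) x :
  (\near x, f x = g x) -> {for x, continuous f} -> {for x, continuous g}.
Proof.
move=> fg cf; have := nbhs_singleton fg => /= fgx.
suff : g @ x --> f x by rewrite fgx.
exact: cvg_trans (near_eq_cvg fg) cf.
Qed.

Lemma cont_diff_eq k U f g : open U -> (forall x, U x -> f x = g x) ->
  cont_diff k U f -> cont_diff k U g.
Proof.
move=> oU; elim: k f g => [|k IH] f g fg [cf df];
  have nfg x : U x -> \near x, f x = g x
    by (move=> Ux; near=> y; apply: fg; near: y; exact: open_near).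
- by split=> // x Ux; apply: near_eq_continuous_at (nfg x Ux) (cf x Ux).
- split=> [x Ux|v]; first exact: near_eq_continuous_at (nfg x Ux) (cf x Ux).
  have [dv cv] := df v; split=> [x Ux|].
    exact: near_eq_derivable (nfg x Ux) (dv x Ux).
  by apply: IH cv => x Ux; apply: near_eq_derive; apply: nfg.
Unshelve. all: by end_near. Qed.

Lemma cont_diff_cst k U (a : V) : cont_diff k U (cst a : 'rV[R]_n -> V).
Proof.
elim: k a => [|k IH] a; split=> //; try by move=> x _; exact: cst_continuous.
move=> v; split=> [x _|]; first exact: derivable_cst.
rewrite (_ : 'D_v (cst a) = cst 0) //.
by apply/funext => x; rewrite derive_cst.
Qed.

Lemma cont_diffD k U f g : open U ->
  cont_diff k U f -> cont_diff k U g -> cont_diff k U (fun x => f x + g x).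
Proof.
move=> oU; elim: k f g => [|k IH] f g [cf df] [cg dg].
  by split=> // x Ux; apply: continuousD; [exact: cf|exact: cg].
split=> [x Ux|v]; first by apply: continuousD; [exact: cf|exact: cg].
have [dfv cfv] := df v; have [dgv cgv] := dg v; split=> [x Ux|].
  by apply: derivableD; [exact: dfv|exact: dgv].
apply: cont_diff_eq (IH _ _ cfv cgv) => // x Ux.
by rewrite [RHS](@deriveD _ _ _ f g) //; [exact: dfv|exact: dgv].
Qed.

Lemma cont_diffZ k U (a : R) f : open U ->
  cont_diff k U f -> cont_diff k U (fun x => a *: f x).
Proof.
move=> oU; elim: k f => [|k IH] f [cf df].
  by split=> // x Ux; apply: continuousZl_tmp; exact: cf.
split=> [x Ux|v]; first by apply: continuousZl_tmp; exact: cf.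
have [dfv cfv] := df v; split=> [x Ux|].
  by apply: derivableZ; exact: dfv.
apply: cont_diff_eq (IH _ cfv) => // x Ux.
by rewrite [RHS](@deriveZ _ _ _ f) //; exact: dfv.
Qed.

Lemma cont_diffN k U f : open U ->
  cont_diff k U f -> cont_diff k U (fun x => - f x).
Proof.
move=> oU cf; apply: cont_diff_eq (cont_diffZ (-1) oU cf) => // x _.
by rewrite scaleN1r.
Qed.

Lemma cont_diff_sum k U (I : Type) (r : seq I) (P : pred I)
    (F : I -> 'rV[R]_n -> V) : open U ->
  (forall i, P i -> cont_diff k U (F i)) ->
  cont_diff k U (fun x => \sum_(i <- r | P i) F i x).
Proof.
move=> oU cF; elim: r => [|i r IH].
  by apply: cont_diff_eq (cont_diff_cst k U 0) => // x _; rewrite big_nil.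
case Pi: (P i).
  apply: cont_diff_eq (cont_diffD oU (cF i Pi) IH) => // x _.
  by rewrite big_cons Pi.
by apply: cont_diff_eq IH => // x _; rewrite big_cons Pi.
Qed.

End Gen.

Lemma cont_diffM k U (f g : 'rV[R]_n -> R) : open U ->
  cont_diff k U f -> cont_diff k U g -> cont_diff k U (fun x => f x * g x).
Proof.
move=> oU; elim: k f g => [|k IH] f g cdf cdg.
  by split=> // x Ux; apply: continuousM; [exact: cdf.1|exact: cdg.1].
have [cf df] := cdf; have [cg dg] := cdg.
split=> [x Ux|v]; first by apply: continuousM; [exact: cf|exact: cg].
have [dfv cfv] := df v; have [dgv cgv] := dg v; split=> [x Ux|].
  by apply: derivableM; [exact: dfv|exact: dgv].
have := cont_diffD oU (IH _ _ (cont_diffW cdf) cgv) (IH _ _ (cont_diffW cdg) cfv).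
apply: cont_diff_eq => // x Ux.
by rewrite [RHS](@deriveM _ _ f g) //; [exact: dfv|exact: dgv].
Qed.

Lemma cont_diff_mx k U m1 m2 (f : 'rV[R]_n -> 'M[R]_(m1, m2)) : open U ->
  cont_diff k U f <-> forall i j, cont_diff k U (fun x => f x i j).
Proof.
move=> oU.
have cmx := @continuous_at_mx.
elim: k f => [|k IH] f.
  split=> [[cf _] i j|cf].
    by split=> // x Ux; apply/((cmx _ _ _ _ _ _).1 (cf x Ux)).
  by split=> // x Ux; apply/cmx => i j; apply: (cf i j).1.
have DE v x i j : derivable f x v -> 'D_v f x i j = 'D_v (fun x => f x i j) x.
  by move=> df; rewrite derive_mx// mxE.
split=> [[cf df] i j|cf].
  split=> [x Ux|v]; first by apply/((cmx _ _ _ _ _ _).1 (cf x Ux)).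
  have [dv cv] := df v; split=> [x Ux|].
    exact: ((derivable_mxP _ _ _).1 (dv x Ux)).
  by apply: cont_diff_eq ((IH _).1 cv i j) => // x Ux; exact/DE/dv.
split=> [x Ux|v]; first by apply/cmx => i j; apply: (cf i j).1.
have dv x : U x -> derivable f x v.
  by move=> Ux; apply/derivable_mxP => i j; apply: ((cf i j).2 v).1.
split=> //; apply/IH => i j.
by apply: cont_diff_eq ((cf i j).2 v).2 => // x Ux; exact/esym/DE/dv.
Qed.

End ContDiff.

Lemma near_forall (T : topologicalType) (I : finType) (x : T)
    (P : I -> T -> Prop) :
  (forall i, \forall y \near x, P i y) -> \forall y \near x, forall i, P i y.
Proof. exact: filter_forall. Qed.

Lemma near_and (T : topologicalType) (x : T) (P Q : T -> Prop) :
  (\forall y \near x, P y) -> (\forall y \near x, Q y) ->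
  \forall y \near x, P y /\ Q y.
Proof. exact: filterI. Qed.

Lemma near_impl (T : topologicalType) (x : T) (P Q : T -> Prop) :
  (forall y, P y -> Q y) -> (\forall y \near x, P y) -> \forall y \near x, Q y.
Proof. exact: filterS. Qed.

Lemma near_all (T : topologicalType) (x : T) (P : T -> Prop) :
  (forall y, P y) -> \forall y \near x, P y.
Proof. exact: nearW. Qed.

Lemma near_setI (T : topologicalType) (x : T) (P Q : set T) :
  nbhs x P -> nbhs x Q -> nbhs x (P `&` Q).
Proof. exact: filterI. Qed.

Lemma near_open (T : topologicalType) (x : T) (P : T -> Prop) :
  (\forall y \near x, P y) ->
  exists W : set T, [/\ open W, W x & forall y, W y -> P y].
Proof.
move=> nP; have : nbhs x [set y | P y] by [].
by rewrite nbhsE => -[W [oW Wx] sW]; exists W.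
Qed.

Lemma row_norm_le (R : realType) n (v : 'rV[R]_n) (e : R) :
  0 <= e -> (forall j, `|v 0 j| <= e) -> `|v| <= e.
Proof.
move=> e0 H; rewrite /Num.norm/= mx_normrE (bigmax_le _ e0)//= => -[i j] _ /=.
by rewrite ord1.
Qed.

Lemma le_row_norm (R : realType) n (v : 'rV[R]_n) j : `|v 0 j| <= `|v|.
Proof.
rewrite [leRHS]/Num.norm/= mx_normrE.
exact: (@le_bigmax _ _ _ 0 (fun ij : 'I_1 * 'I_n => `|v ij.1 ij.2|) (0, j)).
Qed.

Lemma is_derive_line (R : realType) (V W : normedModType R) (f : V -> W)
    (x v : V) (t : R) :
  derivable f (t *: v + x) v ->
  is_derive t 1 (fun s => f (s *: v + x)) ('D_v f (t *: v + x)).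
Proof.
have E : (fun h : R => h^-1 *: ((fun s => f (s *: v + x)) \o shift t) (h *: 1)
        - h^-1 *: f (t *: v + x)) =
    (fun h => h^-1 *: ((f \o shift (t *: v + x)) (h *: v) - f (t *: v + x))).
  apply/funext => h /=.
  by rewrite -scalerBr [h *: 1]mulr1 scalerDl addrA.
by move=> df; split; rewrite /derivable /derive /=; under eq_fun do rewrite scalerBr;
  rewrite E.
Qed.

Lemma mvt_line (R : realType) (V : normedModType R) (f : V -> R) (x v : V) :
  (forall t, 0 <= t <= 1 -> derivable f (t *: v + x) v) ->
  exists2 t : R, 0 <= t <= 1 & f (v + x) - f x = 'D_v f (t *: v + x).
Proof.
move=> df.
have [||t] := @MVT_segment _ (fun s => f (s *: v + x))
  (fun s => 'D_v f (s *: v + x)) 0 1 ler01.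
- move=> t; rewrite in_itv/= => /andP[/ltW t0 /ltW t1].
  by apply: is_derive_line; apply: df; rewrite t0 t1.
- apply: derivable_within_continuous => t; rewrite in_itv/= => /df dt.
  by have [] := is_derive_line dt.
rewrite in_itv/= => t01; rewrite scale1r scale0r add0r subr0 mulr1 => E.
by exists t.
Qed.

(** * Functions of class C^1 are differentiable *)

Section C1.
Context {R : realType} {n : nat}.

Lemma derivableZdir (V W : normedModType R) (f : V -> W) (x v : V) (a : R) :
  derivable f x v -> derivable f x (a *: v) /\ 'D_(a *: v) f x = a *: 'D_v f x.
Proof.
have [->|a0] := eqVneq a 0.
  by rewrite !scale0r derive0; split=> //; exact: derivable0.
move=> df.
have E : (fun h : R => h^-1 *: ((f \o shift x) (h *: (a *: v)) - f x)) =
   (fun h => a *: ((h * a)^-1 *: ((f \o shift x) ((h * a) *: v) - f x))).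
  apply/funext => h; rewrite /= scalerA [a *: _ in RHS]scalerA.
  by rewrite invfM [h^-1 * _]mulrC mulrA mulfV// mul1r.
have C : (fun h => a *: ((h * a)^-1 *: ((f \o shift x) ((h * a) *: v) - f x)))
    @ 0^' --> a *: 'D_v f x.
  apply: cvgZl_tmp.
  apply: (@cvg_comp _ _ _ (fun h : R => h * a)
    (fun h => h^-1 *: ((f \o shift x) (h *: v) - f x)) _ 0^') => //.
  move=> A; rewrite /dnbhs /within /= => nA.
  have : (fun h : R => h * a) @ 0 --> (0 : R).
    rewrite -[X in _ --> X](mul0r a).
    exact: (@cvgMr_tmp R R (nbhs (0 : R)) _ id 0 a (@cvg_id _ (nbhs (0 : R)))).
  move=> /(_ _ nA) H0; apply: (@filterS _ (nbhs (0 : R)) _ _ _ _ H0).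
  by move=> h /= H h0; apply: H; rewrite mulf_neq0.
split; first by rewrite /derivable E; apply/cvg_ex; exists (a *: 'D_v f x).
by rewrite /derive E; apply/cvg_lim.
Qed.

Lemma differentiable_linear_approx (V W : normedModType R) (f : V -> W)
    (L : {linear V -> W}) x : continuous L ->
  (forall e : R, 0 < e ->
     \forall h \near (0 : V), `|f (h + x) - (f x + L h)| <= e * `|h|) ->
  differentiable f x.
Proof.
move=> Lc H.
suff D : f \o shift x = cst (f x) + L +o_ 0 id.
  by apply/diff_locallyP; rewrite (diff_unique Lc D).
by apply/eqaddoP => e e0; exact: H.
Qed.

(** Go from [x] to [h + x] one coordinate at a time. On each edge the mean value theorem turns the
    increment into a partial derivative at a nearby point, which continuity keeps within [e'] of its
    value at [x]. *)
Lemma C1_differentiable (U : set 'rV[R]_n) (f : 'rV[R]_n -> R) x :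
  open U -> U x -> cont_diff 1 U f ->
  differentiable f x.
Proof.
move=> oU Ux [_ df].
pose L (h : 'rV[R]_n) : R := \sum_j h 0 j * 'D_(base j) f x.
have Llin : linear L.
  move=> a u v; rewrite /L scaler_sumr -big_split; apply: eq_bigr => j _.
  by rewrite !mxE mulrDl scalerAl.
pose Lm := GRing.isLinear.Build _ _ _ _ _ Llin.
pose LL : {linear 'rV[R]_n -> R} := HB.pack L Lm.
have Lc : continuous LL.
  apply: continuous_big => [|j _]; first exact: add_continuous.
  move=> h; apply: (@continuousM _ _ _ (cst _)); last exact: cst_continuous.
  exact: coord_continuous.
apply: (differentiable_linear_approx Lc) => _/posnumP[e].
(* Each of the [n] edges costs at most [e' * |h|]; the denominator [n.+1] also covers [n = 0]. *)
pose e' := e%:num / n.+1%:R.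
have e'0 : 0 < e' by rewrite /e' divr_gt0.
have [d d0 Hd] : exists2 d : R, 0 < d & forall y, `|y - x| < d ->
    forall j, U y /\ `|'D_(base j) f y - 'D_(base j) f x| <= e'.
  have : \forall y \near x, forall j, U y /\ `|'D_(base j) f y - 'D_(base j) f x| <= e'.
    apply: near_forall => j; apply: near_and; first exact: open_near.
    have := (df (base j)).2.1 x Ux => /cvgrPdist_le /(_ _ e'0).
    by apply: near_impl => y; rewrite distrC.
  move=> /nbhs_normP[d /= d0 Hd]; exists d => // y yd.
  by apply: Hd; rewrite /= distrC.
have hn := @nbhs0_lt R 'rV[R]_n d d0.
apply: near_impl hn => h hd.
rewrite -[LL h]/(L h).
(* [p m] keeps the first [m] coordinates of [h]: the points [p m + x] are the corners of the
   path. *)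
pose p (m : nat) : 'rV[R]_n := \row_j (if (j < m)%N then h 0 j else 0).
have p0 : p 0%N = 0 by apply/rowP => j; rewrite !mxE.
have pn : p n = h by apply/rowP => j; rewrite !mxE ltn_ord.
have pS (m : 'I_n) : p m.+1 = h 0 m *: base m + p m.
  apply/rowP => j; rewrite !mxE eqxx /= ltnS leq_eqVlt.
  have [->|jm] := eqVneq j m; first by rewrite eqxx /= ltnn mulr1 addr0.
  by rewrite (negbTE (_ : (j : nat) != m)) //= mulr0 add0r.
have step (m : 'I_n) : `|f (p m.+1 + x) - f (p m + x) - h 0 m * 'D_(base m) f x|
    <= e' * `|h|.
  have near_seg (t : R) : 0 <= t <= 1 ->
      `|t *: (h 0 m *: base m) + (p m + x) - x| < d.
    move=> /andP[t0 t1]; apply: le_lt_trans hd; rewrite addrA addrK.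
    apply: row_norm_le => // j; rewrite !mxE eqxx /=.
    have [->|jm] := eqVneq j m.
      rewrite ltnn addr0 mulr1 normrM ger0_norm//.
      by rewrite (le_trans _ (le_row_norm h m))// ler_piMl.
    by rewrite !mulr0 add0r; case: ifP => _; rewrite ?normr0// le_row_norm.
  have dseg (t : R) : 0 <= t <= 1 ->
      derivable f (t *: (h 0 m *: base m) + (p m + x)) (base m).
    by move=> /near_seg/Hd/(_ m)[Uy _]; exact: (df _).1.
  have [|t t01] := @mvt_line R _ f (p m + x) (h 0 m *: base m).
    by move=> t /dseg ?; apply: (derivableZdir _ _).1.
  rewrite addrA -pS => ->; rewrite (derivableZdir _ (dseg t t01)).2.
  rewrite -mulrBr normrM mulrC ler_pM//; last exact: le_row_norm.
  exact: (Hd _ (near_seg t t01) m).2.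
have -> : f (h + x) - (f x + L h) =
    \sum_(m < n) (f (p m.+1 + x) - f (p m + x) - h 0 m * 'D_(base m) f x).
  rewrite sumrB opprD addrA; congr (_ - _).
  rewrite -(big_mkord xpredT (fun m => f (p m.+1 + x) - f (p m + x))).
  by rewrite (telescope_sumr (fun m => f (p m + x)))// p0 pn add0r.
apply: le_trans (ler_norm_sum _ _ _) _.
apply: (@le_trans _ _ (\sum_(m < n) e' * `|h|)); first exact: ler_sum.
rewrite sumr_const card_ord -mulr_natl mulrA ler_wpM2r//.
by rewrite /e' mulrCA ler_piMr// ler_pdivrMr// mul1r ler_nat.
Qed.

End C1.

(** Restricted to the line through [x], [g] is a curve in one real variable, for which derivable and
    differentiable agree; the chain rule for differentiable maps then applies at [0]. *)
Lemma is_derive_chain (R : realType) (V W X : normedModType R) (g : V -> W)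
    (f : W -> X) (x v : V) :
  derivable g x v -> differentiable f (g x) ->
  is_derive x v (f \o g) ('D_('D_v g x) f (g x)).
Proof.
move=> dg df.
pose c := fun h : R => g (h *: v + x).
have c0 : c 0 = g x by rewrite /c scale0r add0r.
have dc : differentiable c 0 by apply/derivable1_diffP; apply/(derivable1P g x v).
have dfc : differentiable (f \o c) 0 by apply: differentiable_comp; rewrite ?c0.
have DE (Y : normedModType R) (h : V -> Y) :
    'D_v h x = 'D_1 (fun t : R => h (t *: v + x)) 0.
  rewrite /derive; set g1 := fun t => t^-1 *: _; set g2 := fun t => t^-1 *: _.
  suff -> : g1 = g2 by []; apply/funext => t; rewrite /g1 /g2 /=.
  by rewrite scale0r add0r [t *: 1]mulr1 addr0.
split; first by apply/derivable1P; exact: (@diff_derivable _ _ _ (f \o c)).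
rewrite DE -/c [LHS](deriveE _ dfc) diff_comp ?c0//= (deriveE _ df).
by rewrite DE -/c (deriveE _ dc).
Qed.

(** * Mixed second derivatives *)

Section Deriv.
Context {R : realType}.

Lemma derive_coord n (W : normedModType R) (f : 'rV[R]_n -> W) x v :
  differentiable f x -> 'D_v f x = \sum_j v 0 j *: 'D_(base j) f x.
Proof.
move=> df; rewrite !deriveE// {1}(row_sum_delta v) linear_sum.
by apply: eq_bigr => j _; rewrite linearZ deriveE.
Qed.

(** The mean value theorem is applied twice: along [v] to the increment [f (w + y) - f y], then
    along [w] to ['D_v f]. *)
Lemma second_difference n (U : set 'rV[R]_n) (f : 'rV[R]_n -> R) x v w :
  cont_diff 2 U f ->
  (forall a b : R, 0 <= a <= 1 -> 0 <= b <= 1 -> U (b *: w + (a *: v + x))) ->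
  exists y, (exists a b : R, [/\ 0 <= a <= 1, 0 <= b <= 1 &
     y = b *: w + (a *: v + x)]) /\
    f (w + (v + x)) - f (v + x) - (f (w + x) - f x) = 'D_w ('D_v f) y.
Proof.
move=> [_ df] HU.
pose phi y := f (w + y) - f y.
have i1 : 0 <= (1 : R) <= 1 by rewrite ler01 lexx.
have i0 : 0 <= (0 : R) <= 1 by rewrite ler01 lexx.
have dshift y : derivable f (w + y) v ->
    is_derive y v (fun z => f (w + z)) ('D_v f (w + y)).
  move=> d; have E : (fun h : R => h^-1 *: (((fun z => f (w + z)) \o shift y) (h *: v)
      - f (w + y))) =
    (fun h : R => h^-1 *: ((f \o shift (w + y)) (h *: v) - f (w + y))).
    by apply/funext => h /=; rewrite addrCA.
  by split; rewrite /derivable /derive E.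
have dphi a : 0 <= a <= 1 -> is_derive (a *: v + x) v phi
     ('D_v f (w + (a *: v + x)) - 'D_v f (a *: v + x)).
  move=> a01; apply: is_deriveB.
    by apply: dshift; apply: (df v).1; rewrite -[w]scale1r; exact: HU.
  apply: derivableP; apply: (df v).1.
  by have := HU a 0 a01 i0; rewrite scale0r add0r.
have [a a01 Ea] := @mvt_line R _ phi x v (fun t t01 => @ex_derive _ _ _ _ _ _ _ (dphi t t01)).
have [b b01 Eb] : exists2 b : R, 0 <= b <= 1 &
    'D_v f (w + (a *: v + x)) - 'D_v f (a *: v + x) =
    'D_w ('D_v f) (b *: w + (a *: v + x)).
  apply: (@mvt_line R _ ('D_v f) (a *: v + x) w) => t t01.
  by apply: ((df v).2.2 w).1; exact: HU.
exists (b *: w + (a *: v + x)); split; first by exists a, b.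
by rewrite -Eb -[RHS](@derive_val _ _ _ _ _ _ _ (dphi a a01)) -Ea.
Qed.

Lemma near_lines n (x v w : 'rV[R]_n) (P : 'rV[R]_n -> Prop) :
  (\forall y \near x, P y) ->
  exists2 s : R, 0 < s & forall a b : R, 0 <= a <= 1 -> 0 <= b <= 1 ->
     P (b *: (s *: w) + (a *: (s *: v) + x)).
Proof.
move=> /nbhs_normP[d /= d0 Hd].
pose s := d / (`|v| + `|w| + 1).
have D0 : 0 < `|v| + `|w| + 1 by rewrite ltr_wpDl// addr_ge0.
have s0 : 0 < s by rewrite divr_gt0.
exists s => // a b /andP[a0 a1] /andP[b0 b1]; apply: Hd => /=.
rewrite -normrN opprB addrA addrK (le_lt_trans (ler_normD _ _))//.
rewrite !normrZ !ger0_norm//; last exact: ltW.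
apply: (@le_lt_trans _ _ (s * (`|v| + `|w|))).
  by rewrite mulrDr addrC lerD// ler_piMl// mulr_ge0// ltW.
by rewrite /s mulrAC ltr_pdivrMr// ltr_pM2l// ltrDl.
Qed.

Lemma derive2Z n (U : set 'rV[R]_n) (f : 'rV[R]_n -> R) y v w (s : R) :
  open U -> U y -> cont_diff 2 U f ->
  'D_(s *: w) ('D_(s *: v) f) y = s * s * 'D_w ('D_v f) y.
Proof.
move=> oU Uy [_ df].
have E : \near y, 'D_(s *: v) f y = (s \*: 'D_v f) y.
  apply: (near_impl _ (open_near oU Uy)) => z Uz.
  by rewrite (derivableZdir _ ((df v).1 z Uz)).2.
rewrite (near_eq_derive _ E).
have d1 := ((df v).2.2 w).1 y Uy.
have d2 : derivable (s \*: 'D_v f) y w by exact: derivableZ.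
apply: etrans (derivableZdir s d2).2 _; rewrite -mulrA.
by congr (s *: _); exact: (@deriveZ _ _ _ ('D_v f) s y w d1).
Qed.

Lemma dist_le_half (e p q r : R) :
  `|p - r| <= e / 2 -> `|q - r| <= e / 2 -> `|p - q| <= e.
Proof.
move=> H3 H4; rewrite -(subrKA r) (le_trans (ler_normD _ _))// (splitr e).
by rewrite lerD// distrC.
Qed.

(** The second difference over a small parallelogram is symmetric in [v] and [w], so
    [second_difference] equates the two mixed derivatives at two points of it. Continuity moves both
    points to [x]. *)
Lemma Clairaut n (U : set 'rV[R]_n) (f : 'rV[R]_n -> R) x v w :
  open U -> U x -> cont_diff 2 U f ->
  'D_w ('D_v f) x = 'D_v ('D_w f) x.
Proof.
move=> oU Ux cf; have [_ df] := cf.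
apply/eqP; rewrite -subr_eq0 -normr_le0; apply/ler_addgt0Pl => e e0.
rewrite addr0.
have e20 : 0 < e / 2 by rewrite divr_gt0.
have cvw := ((df v).2.2 w).2.1 x Ux.
have cwv := ((df w).2.2 v).2.1 x Ux.
have : \forall y \near x, U y /\ (`|'D_w ('D_v f) x - 'D_w ('D_v f) y| <= e / 2 /\
    `|'D_v ('D_w f) x - 'D_v ('D_w f) y| <= e / 2).
  apply: near_and; first exact: open_near.
  by apply: near_and; [move/cvgrPdist_le : cvw|move/cvgrPdist_le : cwv]; exact.
move=> /(near_lines v w)[s s0 Hs].
have [||y1 [[a1 [b1 [a1i b1i Ey1]]] E1]] :=
   @second_difference n U f x (s *: v) (s *: w) => //.
  by move=> a b ai bi; exact: (Hs a b ai bi).1.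
have [||y2 [[a2 [b2 [a2i b2i Ey2]]] E2]] :=
   @second_difference n U f x (s *: w) (s *: v) => //.
  by move=> a b ai bi; rewrite addrCA; exact: (Hs b a bi ai).1.
have [U1 [H1 _]] := Hs a1 b1 a1i b1i.
have [U2 [_ H2]] := Hs b2 a2 b2i a2i.
rewrite -Ey1 in U1 H1; rewrite addrCA -Ey2 in U2 H2.
have E12 : 'D_w ('D_v f) y1 = 'D_v ('D_w f) y2.
  have A1 := etrans E1 (derive2Z v w s oU U1 cf).
  have A2 := etrans E2 (derive2Z w v s oU U2 cf).
  have s20 : s * s != 0 by rewrite mulf_neq0// gt_eqF.
  apply: (mulfI s20); apply: etrans (esym A1) _; apply: etrans _ A2.
  rewrite (addrCA (s *: v)); set A := f (_ + (_ + _)).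
  by ring.
by apply: (dist_le_half H1); rewrite E12.
Qed.

End Deriv.

(** * Germs of smooth functions *)

Section SmoothAt.
Context {R : realType}.

Lemma cont_diff_local n (V : normedModType R) k (U : set 'rV[R]_n)
    (f : 'rV[R]_n -> V) :
  (forall x, U x -> exists2 W, W x & cont_diff k W f) -> cont_diff k U f.
Proof.
elim: k f => [|k IH] f H; split=> //.
- by move=> x /H[W Wx [cf _]]; exact: cf.
- by move=> x /H[W Wx [cf _]]; exact: cf.
- move=> v; split=> [x /H[W Wx [_ df]]|]; first exact: (df v).1.
  by apply: IH => x /H[W Wx [_ df]]; exists W => //; exact: (df v).2.
Qed.

(** Induction on [k]: by the chain rule the derivative along [v] is a sum of products of a
    coordinate of ['D_v g] with a partial derivative of [f] composed with [g], and each factor has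
    one class less. *)
Lemma cont_diff_comp n m k (U : set 'rV[R]_n) (V : set 'rV[R]_m)
    (g : 'rV[R]_n -> 'rV[R]_m) (f : 'rV[R]_m -> R) :
  open U -> open V -> (forall x, U x -> V (g x)) ->
  cont_diff k U g -> cont_diff k V f -> cont_diff k U (f \o g).
Proof.
move=> oU oV gUV; elim: k f => [|k IH] f cg cf.
  split=> // x Ux; apply: continuous_comp; first exact: cg.1.
  exact/cf.1/gUV.
have [gc dg] := cg; have [fc df] := cf.
have dff y : V y -> differentiable f y.
  by move=> Vy; apply: (C1_differentiable oV Vy); exact: cont_diff_le cf.
have chain x v : U x -> is_derive x v (f \o g) ('D_('D_v g x) f (g x)).
  by move=> Ux; apply: is_derive_chain; [exact: (dg v).1|exact/dff/gUV].
split=> [x Ux|v].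
  by apply: continuous_comp; [exact: gc|exact/fc/gUV].
split=> [x Ux|]; first by have [] := chain x v Ux.
have cfj j : cont_diff k U ('D_(base j) f \o g).
  by apply: IH (cont_diffW cg) _; exact: (df _).2.
have cgj j : cont_diff k U (fun x => 'D_v g x 0 j).
  by have := (cont_diff_mx k ('D_v g) oU).1 (dg v).2; apply.
apply: (cont_diff_eq oU _ (cont_diff_sum (index_enum 'I_m) (P := xpredT) oU
  (fun j _ => cont_diffM oU (cgj j) (cfj j)))).
move=> x Ux /=; rewrite (@derive_val _ _ _ _ _ _ _ (chain x v Ux)).
by rewrite (derive_coord _ (dff _ (gUV _ Ux))).
Qed.

Lemma cont_diffV n k (U : set 'rV[R]_n) (f : 'rV[R]_n -> R) :
  open U -> (forall x, U x -> f x != 0) ->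
  cont_diff k U f -> cont_diff k U (fun x => (f x)^-1).
Proof.
move=> oU f0; elim: k => [|k IH] cf.
  split=> // x Ux; apply: (@continuous_comp _ _ _ f GRing.inv).
    exact: cf.1.
  exact/inv_continuous/f0.
have [fc df] := cf; split=> [x Ux|v].
  apply: (@continuous_comp _ _ _ f GRing.inv); first exact: fc.
  exact/inv_continuous/f0.
split=> [x Ux|]; first by apply: derivableV; [exact: f0|exact: (df v).1].
have cV := IH (cont_diffW cf).
apply: (cont_diff_eq oU _ (cont_diffN oU (cont_diffM oU (cont_diffM oU cV cV)
  (df v).2))) => x Ux /=.
rewrite [RHS](@deriveV _ _ f) //; last exact: (df v).1.
  by rewrite expr2 invfM scaleNr.
exact: f0.
Qed.

(** Smoothness of a germ. The open set is hidden, so that computations do not carry the domains of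
    charts and compositions along; [smooth_at_on] returns to [smooth_on]. *)
Definition smooth_at n (V : normedModType R) (f : 'rV[R]_n -> V) (x : 'rV[R]_n) :=
  exists2 U : set 'rV[R]_n, open U /\ U x & smooth_on U f.

Lemma smooth_on_at n (V : normedModType R) (U : set 'rV[R]_n)
    (f : 'rV[R]_n -> V) x :
  open U -> U x -> smooth_on U f -> smooth_at f x.
Proof. by exists U. Qed.

Lemma smooth_at_on n (V : normedModType R) (U : set 'rV[R]_n)
    (f : 'rV[R]_n -> V) :
  (forall x, U x -> smooth_at f x) -> smooth_on U f.
Proof.
move=> H k; apply: cont_diff_local => x /H[W [oW Wx] sf].
by exists W => //; exact: sf.
Qed.

Lemma smooth_at_nbhs n (V : normedModType R) (f : 'rV[R]_n -> V) x :
  smooth_at f x -> \forall y \near x, smooth_at f y.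
Proof.
move=> [W [oW Wx] sf]; apply: (near_impl _ (open_near oW Wx)) => y Wy.
by exists W.
Qed.

Lemma smooth_at_eq n (V : normedModType R) (f g : 'rV[R]_n -> V) x :
  (\forall y \near x, f y = g y) -> smooth_at f x -> smooth_at g x.
Proof.
move=> fg [W [oW Wx] sf].
have : nbhs x (W `&` [set y | f y = g y]) by apply: near_setI => //; exact: open_near.
rewrite nbhsE => -[W' [oW' W'x] sW']; exists W' => // k.
apply: (@cont_diff_eq _ _ _ k W' f g oW') => [y /sW'[]//|].
by apply: cont_diff_sub (sf k) => y /sW'[].
Qed.

Lemma smooth_binop n (W : normedModType R) (W' X : normedModType R)
    (f : 'rV[R]_n -> W) (g : 'rV[R]_n -> W') (h : 'rV[R]_n -> X) x :
  (forall U k, open U -> cont_diff k U f -> cont_diff k U g -> cont_diff k U h) ->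
  smooth_at f x -> smooth_at g x -> smooth_at h x.
Proof.
move=> H [A [oA Ax] sf] [B [oB Bx] sg]; exists (A `&` B) => [|k].
  by split=> //; exact: openI.
apply: H; first exact: openI.
  by apply: cont_diff_sub (sf k) => y [].
by apply: cont_diff_sub (sg k) => y [].
Qed.

Section Gen.
Context {n : nat} {V : normedModType R}.
Implicit Types (f g : 'rV[R]_n -> V) (x v : 'rV[R]_n).

Lemma smooth_cont f x : smooth_at f x -> {for x, continuous f}.
Proof. by move=> [W [oW Wx] sf]; exact: (sf 0%N).1. Qed.

Lemma smooth_derivable f x v : smooth_at f x -> derivable f x v.
Proof. by move=> [W [oW Wx] sf]; exact: ((sf 1%N).2 v).1. Qed.

Lemma smooth_derive f x v : smooth_at f x -> smooth_at ('D_v f) x.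
Proof.
by move=> [W [oW Wx] sf]; exists W => // k; exact: ((sf k.+1).2 v).2.
Qed.

Lemma smooth_cst (a : V) x : smooth_at (cst a : 'rV[R]_n -> V) x.
Proof. by exists setT; [split=> //; exact: openT|move=> k; exact: cont_diff_cst]. Qed.

Lemma smooth_cstR (a : R) x : smooth_at (fun _ : 'rV[R]_n => a) x.
Proof. by exists setT; [split=> //; exact: openT|move=> k; exact: cont_diff_cst]. Qed.

Lemma smoothD f g x :
  smooth_at f x -> smooth_at g x -> smooth_at (fun y => f y + g y) x.
Proof. by apply: smooth_binop => U k oU; exact: cont_diffD. Qed.

Lemma smoothN f x : smooth_at f x -> smooth_at (fun y => - f y) x.
Proof. by move=> sf; apply: smooth_binop (sf) (sf) => U k oU + _; exact: cont_diffN. Qed.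

Lemma smoothB f g x :
  smooth_at f x -> smooth_at g x -> smooth_at (fun y => f y - g y) x.
Proof. by move=> sf sg; apply: smoothD => //; exact: smoothN. Qed.

Lemma smooth_sum (I : Type) (r : seq I) (P : pred I) (F : I -> 'rV[R]_n -> V) x :
  (forall i, P i -> smooth_at (F i) x) ->
  smooth_at (fun y => \sum_(i <- r | P i) F i y) x.
Proof.
move=> sF; elim: r => [|i r IH].
  apply: smooth_at_eq (smooth_cst 0 x); apply: near_all => y; by rewrite big_nil.
case Pi: (P i).
  apply: smooth_at_eq (smoothD (sF i Pi) IH); apply: near_all => y.
  by rewrite big_cons Pi.
by apply: smooth_at_eq IH; apply: near_all => y; rewrite big_cons Pi.
Qed.

End Gen.
Arguments smooth_derivable {n V f x} v.

Section Real.
Context {n : nat}.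
Implicit Types (x v : 'rV[R]_n).

Lemma smoothM (f g : 'rV[R]_n -> R) x :
  smooth_at f x -> smooth_at g x -> smooth_at (fun y => f y * g y) x.
Proof. by apply: smooth_binop => U k oU; exact: cont_diffM. Qed.

Lemma smooth_prod (I : Type) (r : seq I) (P : pred I) (F : I -> 'rV[R]_n -> R) x :
  (forall i, P i -> smooth_at (F i) x) ->
  smooth_at (fun y => \prod_(i <- r | P i) F i y) x.
Proof.
move=> sF; elim: r => [|i r IH].
  have E : \forall y \near x, cst (1 : R) y = \prod_(i <- [::] | P i) F i y.
    by apply: near_all => y; rewrite big_nil.
  apply: smooth_at_eq E _.
  exact: smooth_cstR.
case Pi: (P i).
  apply: smooth_at_eq (smoothM (sF i Pi) IH); apply: near_all => y.
  by rewrite big_cons Pi.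
by apply: smooth_at_eq IH; apply: near_all => y; rewrite big_cons Pi.
Qed.

Lemma smooth_inv (f : 'rV[R]_n -> R) x :
  f x != 0 -> smooth_at f x -> smooth_at (fun y => (f y)^-1) x.
Proof.
move=> fx0 sf; have [W [oW Wx] sW] := sf.
have : nbhs x (W `&` [set y | f y != 0]).
  apply: near_setI; first exact: open_near.
  have := smooth_cont sf => /cvgrPdist_lt /(_ `|f x|); rewrite normr_gt0 => /(_ fx0).
  by apply: near_impl => y; apply: contraTneq => ->; rewrite subr0 ltxx.
rewrite nbhsE => -[W' [oW' W'x] sW']; exists W' => // k.
apply: cont_diffV => // [y /sW'[]//|].
by apply: cont_diff_sub (sW k) => y /sW'[].
Qed.

Lemma smooth_mx m1 m2 (f : 'rV[R]_n -> 'M[R]_(m1, m2)) x :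
  smooth_at f x <-> forall i j, smooth_at (fun y => f y i j) x.
Proof.
split=> [[W [oW Wx] sf] i j|H].
  by exists W => // k; apply: (cont_diff_mx k f oW).1.
have : \forall y \near x, forall i j, smooth_at (fun y => f y i j) y.
  by apply: near_forall => i; apply: near_forall => j; exact/smooth_at_nbhs/H.
move=> /near_open[W [oW Wx sW]]; exists W => // k.
apply/cont_diff_mx => // i j; apply: smooth_at_on => y /sW; exact.
Qed.

Lemma smooth_entry m1 m2 (f : 'rV[R]_n -> 'M[R]_(m1, m2)) i j x :
  smooth_at f x -> smooth_at (fun y => f y i j) x.
Proof. by move/smooth_mx. Qed.

Lemma derive_entry m1 m2 (f : 'rV[R]_n -> 'M[R]_(m1, m2)) i j x v :
  smooth_at f x -> 'D_v f x i j = 'D_v (fun y => f y i j) x.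
Proof. by move=> /(smooth_derivable v) df; rewrite derive_mx// mxE. Qed.

Lemma smooth_differentiable (f : 'rV[R]_n -> R) x :
  smooth_at f x -> differentiable f x.
Proof. by move=> [W [oW Wx] sf]; apply: (C1_differentiable oW Wx); exact: sf. Qed.

Lemma smooth_mulmx m1 m2 m3 (f : 'rV[R]_n -> 'M[R]_(m1, m2))
    (g : 'rV[R]_n -> 'M[R]_(m2, m3)) x :
  smooth_at f x -> smooth_at g x -> smooth_at (fun y => f y *m g y) x.
Proof.
move=> /smooth_mx sf /smooth_mx sg; apply/smooth_mx => i j.
apply: smooth_at_eq (smooth_sum (index_enum 'I_m2) (P := xpredT)
  (fun l _ => smoothM (sf i l) (sg l j))).
by apply: near_all => y; rewrite mxE.
Qed.

Lemma smooth_tr m1 m2 (f : 'rV[R]_n -> 'M[R]_(m1, m2)) x :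
  smooth_at f x -> smooth_at (fun y => (f y)^T) x.
Proof.
move=> /smooth_mx sf; apply/smooth_mx => i j.
by apply: smooth_at_eq (sf j i); apply: near_all => y; rewrite mxE.
Qed.

Lemma smooth_det m (f : 'rV[R]_n -> 'M[R]_m) x :
  smooth_at f x -> smooth_at (fun y => \det (f y)) x.
Proof.
move=> /smooth_mx sf; apply: smooth_sum => s _.
apply: smoothM; last by apply: smooth_prod => i _; exact: sf.
exact: smooth_cstR.
Qed.

Lemma smooth_invmx m (f : 'rV[R]_n -> 'M[R]_m) x :
  (\forall y \near x, f y \in unitmx) ->
  smooth_at f x -> smooth_at (fun y => invmx (f y)) x.
Proof.
move=> fu sf; apply/smooth_mx => i j.
have sdet := smooth_det sf.
have d0 : \det (f x) != 0 by have := nbhs_singleton fu; rewrite /= unitmxE unitfE.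
(* Cramer's formula. It is available only where [f] is invertible, since [invmx] returns a singular
   matrix unchanged. *)
have E : \near x, (\det (f x))^-1 * cofactor (f x) j i = invmx (f x) i j.
  by apply: near_impl fu => y yu; rewrite /invmx yu !mxE.
apply: smooth_at_eq E _; apply: smoothM; first exact: smooth_inv.
apply: smoothM.
  exact: smooth_cstR.
apply: smooth_det; apply/smooth_mx => a b.
by move/smooth_mx: sf => /(_ (lift j a) (lift i b)); apply: smooth_at_eq;
  apply: near_all => y; rewrite !mxE.
Qed.

Lemma smooth_id x : smooth_at (id : 'rV[R]_n -> 'rV[R]_n) x.
Proof.
exists setT => [|k]; first by split=> //; exact: openT.
case: k => [|k]; first by split=> [y _|]; [exact: cvg_id|].
split=> [y _|v]; first exact: cvg_id.
split=> [y _|]; first exact: derivable_id.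
have -> : 'D_v id = cst v by apply/funext => y; exact: derive_id.
exact: cont_diff_cst.
Qed.

Lemma smooth_coord j x : smooth_at (fun y : 'rV[R]_n => y 0 j) x.
Proof. exact: (smooth_entry 0 j (smooth_id x)). Qed.

Lemma smooth_linear m1 m2 (f : {linear 'rV[R]_n -> 'M[R]_(m1, m2)}) x :
  smooth_at f x.
Proof.
apply/smooth_mx => a b.
apply: smooth_at_eq (smooth_sum (index_enum 'I_n) (P := xpredT)
  (fun j _ => smoothM (smooth_coord j x) (smooth_cstR (f (base j) a b) x))).
apply: near_all => y; rewrite {2}(row_sum_delta y) linear_sum summxE.
by apply: eq_bigr => j _; rewrite linearZ mxE.
Qed.

Lemma derive_linfun (W : normedModType R) (f : {linear 'rV[R]_n -> W}) x v :
  'D_v f x = f v.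
Proof.
apply/lim_near_cst => //=; near=> h.
have h0 : h != 0 by near: h; exact: nbhs_dnbhs_neq.
by rewrite /= (linearD f) addrK (linearZ_LR f) scalerA mulVf// scale1r.
Unshelve. all: by end_near. Qed.

End Real.

Lemma smooth_comp n m m1 m2 (g : 'rV[R]_n -> 'rV[R]_m)
    (f : 'rV[R]_m -> 'M[R]_(m1, m2)) x :
  smooth_at g x -> smooth_at f (g x) -> smooth_at (f \o g) x.
Proof.
move=> [A [oA Ax] sg] [B [oB Bgx] sf].
have gc : {for x, continuous g} by apply: smooth_cont; exists A.
have : nbhs x (A `&` g @^-1` B) by apply: near_setI; [exact: open_near|exact/gc/open_near].
rewrite nbhsE => -[W [oW Wx] sW]; exists W => // k.
apply/cont_diff_mx => // i j.
apply: (@cont_diff_comp _ _ _ W B g (fun y => f y i j)) => //.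
- by move=> y /sW[].
- by apply: cont_diff_sub (sg k) => y /sW[].
- exact: (cont_diff_mx k f oB).1.
Qed.

Lemma smooth_comp_real n m (g : 'rV[R]_n -> 'rV[R]_m) (f : 'rV[R]_m -> R) x :
  smooth_at g x -> smooth_at f (g x) -> smooth_at (f \o g) x.
Proof.
move=> sg sf; pose F y : 'rV[R]_1 := const_mx (f y).
have sF : smooth_at F (g x).
  by apply/smooth_mx => i j; apply: smooth_at_eq sf; apply: near_all => y; rewrite mxE.
by apply: smooth_at_eq (smooth_entry 0 0 (smooth_comp sg sF)); apply: near_all => y;
  rewrite mxE.
Qed.

Lemma derive_comp_real n m (g : 'rV[R]_n -> 'rV[R]_m) (f : 'rV[R]_m -> R) x v :
  smooth_at g x -> smooth_at f (g x) ->
  'D_v (f \o g) x = 'D_('D_v g x) f (g x).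
Proof.
move=> sg sf.
by have [] := is_derive_chain (smooth_derivable v sg) (smooth_differentiable sf).
Qed.

Lemma derive_comp n m m1 m2 (g : 'rV[R]_n -> 'rV[R]_m)
    (f : 'rV[R]_m -> 'M[R]_(m1, m2)) x v :
  smooth_at g x -> smooth_at f (g x) ->
  'D_v (f \o g) x = 'D_('D_v g x) f (g x).
Proof.
move=> sg sf; apply/matrixP => i j.
apply: etrans (derive_entry i j v (smooth_comp sg sf)) _.
apply: etrans _ (esym (derive_entry i j ('D_v g x) sf)).
exact: (@derive_comp_real _ _ g (fun y => f y i j) x v sg (smooth_entry _ _ sf)).
Qed.

Lemma derive_slice n m (W : normedModType R) (F : 'rV[R]_(n + m) -> W) a b w :
  'D_(row_mx 0 w) F (row_mx a b) = 'D_w (fun y => F (row_mx a y)) b.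
Proof.
rewrite /derive; set g1 := fun h => h^-1 *: _; set g2 := fun h => h^-1 *: _.
suff -> : g1 = g2 by [].
apply/funext => h; rewrite /g1 /g2 /=; congr (_ *: (F _ - _)).
by rewrite scale_row_mx scaler0 add_row_mx add0r.
Qed.

Lemma smooth_Clairaut n (f : 'rV[R]_n -> R) x v w :
  smooth_at f x -> 'D_w ('D_v f) x = 'D_v ('D_w f) x.
Proof. by move=> [W [oW Wx] sf]; exact: (Clairaut _ _ oW Wx (sf 2%N)). Qed.

End SmoothAt.
Arguments smooth_derivable {R n V f x} v.

(** * Differentiation rules for matrix-valued functions *)

Section Rules.
Context {R : realType} {n : nat}.
Implicit Types (x v : 'rV[R]_n).

Lemma sderiveD (V : normedModType R) (f g : 'rV[R]_n -> V) x v :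
  smooth_at f x -> smooth_at g x ->
  'D_v (fun y => f y + g y) x = 'D_v f x + 'D_v g x.
Proof.
move=> sf sg.
exact: (deriveD (smooth_derivable v sf) (smooth_derivable v sg)).
Qed.

Lemma sderiveN (V : normedModType R) (f : 'rV[R]_n -> V) x v :
  smooth_at f x -> 'D_v (fun y => - f y) x = - 'D_v f x.
Proof. by move=> sf; exact: (deriveN (smooth_derivable v sf)). Qed.

Lemma sderiveB (V : normedModType R) (f g : 'rV[R]_n -> V) x v :
  smooth_at f x -> smooth_at g x ->
  'D_v (fun y => f y - g y) x = 'D_v f x - 'D_v g x.
Proof.
move=> sf sg.
exact: (deriveB (smooth_derivable v sf) (smooth_derivable v sg)).
Qed.

Lemma sderiveZ (V : normedModType R) (a : R) (f : 'rV[R]_n -> V) x v :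
  smooth_at f x -> 'D_v (fun y => a *: f y) x = a *: 'D_v f x.
Proof. by move=> sf; exact: (deriveZ a (smooth_derivable v sf)). Qed.

Lemma sderiveM (f g : 'rV[R]_n -> R) x v :
  smooth_at f x -> smooth_at g x ->
  'D_v (fun y => f y * g y) x = f x * 'D_v g x + 'D_v f x * g x.
Proof.
move=> sf sg.
have := deriveM (smooth_derivable v sf) (smooth_derivable v sg).
by move=> ->; rewrite [X in _ + X]mulrC.
Qed.

Lemma sderive_sum (I : Type) (r : seq I) (P : pred I) (V : normedModType R)
    (F : I -> 'rV[R]_n -> V) x v :
  (forall i, smooth_at (F i) x) ->
  'D_v (fun y => \sum_(i <- r | P i) F i y) x = \sum_(i <- r | P i) 'D_v (F i) x.
Proof.
move=> sF; elim: r => [|i r IH].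
  under eq_fun do rewrite big_nil.
  by rewrite big_nil; exact: derive_cst.
under eq_fun do rewrite big_cons.
rewrite big_cons; case: (P i) => //; rewrite -IH; apply: sderiveD => //.
by apply: smooth_sum.
Qed.

Lemma sderive_prod (I : eqType) (r : seq I) (F : I -> 'rV[R]_n -> R) x v :
  uniq r -> (forall i, smooth_at (F i) x) ->
  'D_v (fun y => \prod_(i <- r) F i y) x =
  \sum_(i <- r) 'D_v (F i) x * \prod_(j <- r | j != i) F j x.
Proof.
move=> + sF; elim: r => [_|i r IH /= /andP[ir ur]].
  under eq_fun do rewrite big_nil.
  by rewrite big_nil; exact: derive_cst.
under eq_fun do rewrite big_cons.
rewrite sderiveM//; last exact: smooth_prod.
rewrite IH// big_cons [RHS]addrC; congr (_ + _).
  rewrite mulr_sumr; apply: eq_big_seq => j jr.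
  rewrite [in RHS]big_cons; have -> : i != j by apply: contraNneq ir => ->.
  by rewrite mulrCA.
congr (_ * _); rewrite big_cons eqxx [RHS]big_mkcond; apply: eq_big_seq => j jr.
by rewrite ifT//; apply: contraNneq ir => <-.
Qed.

Lemma sderive_mulmx m1 m2 m3 (f : 'rV[R]_n -> 'M[R]_(m1, m2))
    (g : 'rV[R]_n -> 'M[R]_(m2, m3)) x v :
  smooth_at f x -> smooth_at g x ->
  'D_v (fun y => f y *m g y) x = f x *m 'D_v g x + 'D_v f x *m g x.
Proof.
move=> sf sg; apply/matrixP => i j; rewrite derive_entry; last exact: smooth_mulmx.
under eq_fun do rewrite mxE.
rewrite sderive_sum => [|l]; last by apply: smoothM; exact: smooth_entry.
rewrite !mxE -big_split; apply: eq_bigr => l _ /=.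
rewrite sderiveM; [|exact: smooth_entry|exact: smooth_entry].
by rewrite !derive_entry.
Qed.

Lemma sderive_tr m1 m2 (f : 'rV[R]_n -> 'M[R]_(m1, m2)) x v :
  smooth_at f x -> 'D_v (fun y => (f y)^T) x = ('D_v f x)^T.
Proof.
move=> sf; apply/matrixP => i j; rewrite derive_entry; last exact: smooth_tr.
by under eq_fun do rewrite mxE; rewrite mxE derive_entry.
Qed.

Lemma near_unit m (f : 'rV[R]_n -> 'M[R]_m) x :
  smooth_at f x -> f x \in unitmx -> \forall y \near x, f y \in unitmx.
Proof.
move=> sf; rewrite unitmxE unitfE => fx0.
have := smooth_cont (smooth_det sf) => /cvgrPdist_lt /(_ `|\det (f x)|).
rewrite normr_gt0 => /(_ fx0); apply: near_impl => y /= H; rewrite unitmxE unitfE.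
by apply: contraTneq H => ->; rewrite subr0 ltxx.
Qed.

(** Jacobi's formula. The Leibniz expansion differentiates one row at a time; expanding each
    resulting determinant along that row gives cofactors, which the invertibility of [f x] turns
    into the entries of [invmx (f x)]. *)
Lemma sderive_det m (f : 'rV[R]_n -> 'M[R]_m) x v :
  smooth_at f x -> f x \in unitmx ->
  'D_v (fun y => \det (f y)) x = \det (f x) * \tr (invmx (f x) *m 'D_v f x).
Proof.
move=> sf fu.
have sfe i j : smooth_at (fun y => f y i j) x by exact: smooth_entry.
transitivity (\sum_i \det (\matrix_(a, b) (if a == i then 'D_v f x a b else f x a b))).
  rewrite /determinant sderive_sum => [|s]; last first.
    by apply: smoothM; [exact: smooth_cstR|exact: smooth_prod].
  rewrite exchange_big /=; apply: eq_bigr => s _.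
  rewrite sderiveM; [|exact: smooth_cstR|exact: smooth_prod].
  rewrite [X in _ + X * _]derive_cst mul0r addr0 -mulr_sumr; congr (_ * _).
  rewrite sderive_prod//; last exact: index_enum_uniq.
  apply: eq_bigr => i _; rewrite [RHS](bigD1 i)//= mxE eqxx derive_entry//.
  by congr (_ * _); apply: eq_bigr => j ji; rewrite mxE (negbTE ji).
transitivity (\sum_i \sum_j 'D_v f x i j * cofactor (f x) i j).
  apply: eq_bigr => i _; rewrite (expand_det_row _ i); apply: eq_bigr => j _.
  rewrite mxE eqxx; congr (_ * _); rewrite /cofactor; congr (_ * \det _).
  by apply/matrixP => a b; rewrite !mxE eq_sym (negbTE (neq_lift _ _)).
have -> : invmx (f x) = (\det (f x))^-1 *: \adj (f x) by rewrite /invmx fu.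
rewrite -scalemxAl linearZ /= mulrA mulfV ?mul1r; last by rewrite -unitfE -unitmxE.
rewrite exchange_big; apply: eq_bigr => j _; rewrite mxE; apply: eq_bigr => i _.
by rewrite mxE mulrC.
Qed.

(** Vectors are rows acting from the left, so this is the transpose of the usual Jacobian matrix:
    ['D_v f x = v *m jac f x]. *)
Definition jac m (f : 'rV[R]_n -> 'rV[R]_m) x : 'M[R]_(n, m) :=
  \matrix_(i, j) 'D_(base i) f x 0 j.

Lemma smooth_jac m (f : 'rV[R]_n -> 'rV[R]_m) x :
  smooth_at f x -> smooth_at (jac f) x.
Proof.
move=> sf; apply/smooth_mx => i j; apply: smooth_at_eq (smooth_entry 0 j
  (smooth_derive (base i) sf)).
by apply: near_all => y; rewrite mxE.
Qed.

Lemma derive_jac m (f : 'rV[R]_n -> 'rV[R]_m) x v :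
  smooth_at f x -> 'D_v f x = v *m jac f x.
Proof.
move=> sf; apply/rowP => j; rewrite derive_entry// derive_coord; last first.
  exact/smooth_differentiable/smooth_entry.
by rewrite mxE; apply: eq_bigr => i _; rewrite mxE derive_entry.
Qed.

Lemma smooth_derive_linear m (f : 'rV[R]_n -> 'rV[R]_m) x a v w :
  smooth_at f x -> 'D_(a *: v + w) f x = a *: 'D_v f x + 'D_w f x.
Proof. by move=> sf; rewrite !derive_jac// mulmxDl -scalemxAl. Qed.

Lemma derive_coord_mx m1 m2 (f : 'rV[R]_n -> 'M[R]_(m1, m2)) x v :
  smooth_at f x -> 'D_v f x = \sum_a v 0 a *: 'D_(base a) f x.
Proof.
move=> sf; apply/matrixP => i j; rewrite derive_entry// summxE derive_coord; last first.
  exact/smooth_differentiable/smooth_entry.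
by apply: eq_bigr => a _; rewrite mxE derive_entry.
Qed.

End Rules.

(** * Divergence and Laplacian in coordinates *)

Local Opaque derive.

Section Divergence.
Context {R : realType}.

Definition volume n (G : 'rV[R]_n -> 'M[R]_n) x : R := Num.sqrt (\det (G x)).

Definition divg n (G : 'rV[R]_n -> 'M[R]_n) (X : 'rV[R]_n -> 'rV[R]_n) x : R :=
  (volume G x)^-1 * \sum_i 'D_(base i) (fun y => volume G y * X y 0 i) x.

Definition gradm n (G : 'rV[R]_n -> 'M[R]_n) (f : 'rV[R]_n -> R) x : 'rV[R]_n :=
  \row_i \sum_j invmx (G x) i j * 'D_(base j) f x.

Definition lap n (G : 'rV[R]_n -> 'M[R]_n) (f : 'rV[R]_n -> R) x : R :=
  - divg G (gradm G f) x.

(** The derivative of log det G along [v]; half of it is the logarithmic derivative of the volume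
    density. *)
Definition dlogdet n (G : 'rV[R]_n -> 'M[R]_n) x v : R :=
  \tr (invmx (G x) *m 'D_v G x).

Lemma laplacian_lap (T : topologicalType) n (A : atlas R T n) (g : form2 R T n)
    (f : T -> R) p :
  laplacian A g f p = lap (gram A g p) (f \o chart_inv (A p)) (chart_fun (A p) p).
Proof.
rewrite /laplacian /lap /divg; congr (- (_ * _)); apply: eq_bigr => i _.
by under [in RHS]eq_fun do rewrite mxE.
Qed.

Lemma det_gt0_unit n (M : 'M[R]_n) : 0 < \det M -> M \in unitmx.
Proof. by rewrite unitmxE unitfE => /gt_eqF ->. Qed.

Lemma is_derive_volume n (G : 'rV[R]_n -> 'M[R]_n) x v :
  smooth_at G x -> 0 < \det (G x) ->
  is_derive x v (volume G) (volume G x * (dlogdet G x v / 2)).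
Proof.
move=> sG d0; have sd := smooth_det sG; have := is_derive1_sqrt d0 => -[ds Ds].
have dsq : differentiable (Num.sqrt : R -> R) (\det (G x)) by apply/derivable1_diffP.
have H := is_derive_chain (smooth_derivable v sd) dsq.
apply: is_derive_eq H _.
rewrite sderive_det//; last exact: det_gt0_unit.
set d := \det _ * _; rewrite -[d]mulr1 -[d * 1]/(d *: 1).
have -> : 'D_(d *: 1) Num.sqrt (\det (G x)) = d * 'D_1 Num.sqrt (\det (G x)).
  exact: (derivableZdir d ds).2.
rewrite Ds /d /volume -/(dlogdet G x v) -{1}(sqr_sqrtr (ltW d0)).
have : Num.sqrt (\det (G x)) != 0 by rewrite gt_eqF// sqrtr_gt0.
by move=> ?; field.
Qed.

(** The product rule cancels the density against its inverse and leaves half of [dlogdet]. In this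
    form the divergence contains no square root. *)
Lemma divgE n (G : 'rV[R]_n -> 'M[R]_n) (X : 'rV[R]_n -> 'rV[R]_n) x :
  smooth_at G x -> 0 < \det (G x) -> smooth_at X x ->
  divg G X x = \tr (jac X x) + \sum_i X x 0 i * (dlogdet G x (base i) / 2).
Proof.
move=> sG d0 sX; have v0 : volume G x != 0 by rewrite gt_eqF// sqrtr_gt0.
rewrite /divg mulr_sumr -big_split; apply: eq_bigr => i _ /=.
have [dv Dv] := is_derive_volume (base i) sG d0.
have dX := smooth_derivable (base i) (smooth_entry 0 i sX).
rewrite (deriveM dv dX) Dv mxE derive_entry// -![_ *: _]/(_ * _).
by field.
Qed.

Lemma divg_near n (G : 'rV[R]_n -> 'M[R]_n) X Y x :
  (\forall y \near x, X y = Y y) -> divg G X x = divg G Y x.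
Proof.
move=> XY; congr (_ * _); apply: eq_bigr => i _; apply: near_eq_derive.
by apply: near_impl XY => y ->.
Qed.

Lemma divg_near_metric n (G G' : 'rV[R]_n -> 'M[R]_n) X x :
  (\forall y \near x, volume G y = volume G' y) -> divg G X x = divg G' X x.
Proof.
move=> XY; rewrite /divg (nbhs_singleton XY); congr (_ * _); apply: eq_bigr => i _.
by apply: near_eq_derive; apply: near_impl XY => y ->.
Qed.

Lemma invmx_congruence n (J G' : 'M[R]_n) :
  J \in unitmx -> G' \in unitmx ->
  invmx (J *m G' *m J^T) = invmx J^T *m invmx G' *m invmx J.
Proof.
move=> uJ uG'; have uJT : J^T \in unitmx by rewrite unitmx_tr.
have uG : J *m G' *m J^T \in unitmx by rewrite !unitmx_mul uJ uG'.
apply: (can_inj (mulKmx uG)); rewrite mulmxV//.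
by rewrite !mulmxA mulmxK// -!mulmxA mulKVmx// mulmxV.
Qed.

(** With [D] and [D'] the derivatives of [J] and [G'], the second factor on the left is the
    derivative of [J *m G' *m J^T]. The identity is the logarithmic derivative of det (J G' J^T) =
    (det J)^2 det G'. *)
Lemma trace_congruence_metric n (J D G' D' : 'M[R]_n) :
  J \in unitmx -> G' \in unitmx ->
  \tr (invmx (J *m G' *m J^T) *m (J *m G' *m D^T + (J *m D' + D *m G') *m J^T)) =
  \tr (invmx J *m D) *+ 2 + \tr (invmx G' *m D').
Proof.
move=> uJ uG'; have uJT : J^T \in unitmx by rewrite unitmx_tr.
rewrite invmx_congruence//.
rewrite mulmxDr mxtraceD mulmxDl mulmxDr mxtraceD.
have -> : \tr (invmx J^T *m invmx G' *m invmx J *m (J *m G' *m D^T)) =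
    \tr (invmx J *m D).
  rewrite -!mulmxA mulKmx// mulKmx// -mxtrace_tr trmx_mul trmxK.
  by rewrite trmx_inv trmxK mxtrace_mulC.
have -> : \tr (invmx J^T *m invmx G' *m invmx J *m (J *m D' *m J^T)) =
    \tr (invmx G' *m D').
  rewrite mxtrace_mulC !mulmxA mulmxK// mxtrace_mulC !mulmxA mulVmx// mul1mx.
  by rewrite mxtrace_mulC.
have -> : \tr (invmx J^T *m invmx G' *m invmx J *m (D *m G' *m J^T)) =
    \tr (invmx J *m D).
  by rewrite mxtrace_mulC !mulmxA mulmxK// mulmxK// mxtrace_mulC.
by rewrite addrCA addrC mulr2n.
Qed.

Lemma derive_jac_sym n m (psi : 'rV[R]_n -> 'rV[R]_m) x i k a :
  smooth_at psi x ->
  'D_(base i) (jac psi) x k a = 'D_(base k) (jac psi) x i a.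
Proof.
move=> sp; have sJ := smooth_jac sp.
have jE c d : 'D_(base d) (jac psi) x c a =
    'D_(base d) ('D_(base c) (fun y => psi y 0 a)) x.
  rewrite derive_entry//.
  apply: near_eq_derive; apply: near_impl (smooth_at_nbhs sp) => y spy.
  by rewrite mxE derive_entry.
apply: etrans (jE k i) _; apply: etrans _ (esym (jE i k)).
by apply: smooth_Clairaut; exact: smooth_entry.
Qed.

(** Differentiate the relation between [X] and [Y] along each coordinate. The product rule yields
    the derivative of [jac psi] in the coordinate direction applied to [X]; symmetry of second
    derivatives turns it into the derivative of [jac psi] along [X]. *)
Lemma chain_frame n (X Y psi : 'rV[R]_n -> 'rV[R]_n) x :
  smooth_at psi x -> smooth_at X x -> smooth_at Y (psi x) ->
  (\forall y \near x, Y (psi y) = X y *m jac psi y) ->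
  jac psi x *m jac Y (psi x) =
  jac X x *m jac psi x + \sum_k X x 0 k *: 'D_(base k) (jac psi) x.
Proof.
move=> sp sX sY XY; have sJ := smooth_jac sp.
apply/row_matrixP => i; rewrite !rowE.
have -> : delta_mx 0 i *m (jac psi x *m jac Y (psi x)) = 'D_(base i) (Y \o psi) x.
  by rewrite mulmxA -(derive_jac _ sp) -(derive_jac _ sY) (derive_comp _ sp sY).
rewrite (near_eq_derive _ XY) (sderive_mulmx _ sX sJ) mulmxDr mulmxA.
rewrite -(derive_jac _ sX) addrC; congr (_ + _); apply/rowP => a.
rewrite -rowE !mxE summxE; apply: eq_bigr => k _.
rewrite [RHS]mxE; congr (_ * _); exact: derive_jac_sym.
Qed.

Lemma dlogdet_lin n (G : 'rV[R]_n -> 'M[R]_n) x v : smooth_at G x ->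
  dlogdet G x v = \sum_a v 0 a * dlogdet G x (base a).
Proof.
move=> sG; rewrite /dlogdet (derive_coord_mx _ sG) mulmx_sumr raddf_sum.
by apply: eq_bigr => a _ /=; rewrite -scalemxAr mxtraceZ.
Qed.

Lemma dlogdet_natural n (G G' : 'rV[R]_n -> 'M[R]_n) (psi : 'rV[R]_n -> 'rV[R]_n) x v :
  smooth_at psi x -> smooth_at G' (psi x) -> jac psi x \in unitmx ->
  G' (psi x) \in unitmx ->
  (\forall y \near x, G y = jac psi y *m G' (psi y) *m (jac psi y)^T) ->
  dlogdet G x v =
    \tr (invmx (jac psi x) *m 'D_v (jac psi) x) *+ 2 +
    dlogdet G' (psi x) (v *m jac psi x).
Proof.
move=> sp sG' uJ uG' GG'; have sJ := smooth_jac sp.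
have Gx := nbhs_singleton GG'; rewrite /= in Gx.
have sG'p : smooth_at (G' \o psi) x by exact: (smooth_comp sp).
have DG : 'D_v (G' \o psi) x = 'D_(v *m jac psi x) G' (psi x).
  by rewrite -(derive_jac v sp); exact: (derive_comp v sp sG').
rewrite /dlogdet (near_eq_derive _ GG').
rewrite (sderive_mulmx _ (smooth_mulmx sJ sG'p) (smooth_tr sJ)).
rewrite (sderive_mulmx _ sJ sG'p) (sderive_tr _ sJ) DG Gx.
exact: trace_congruence_metric.
Qed.

(* Both sides are expanded with Jacobi's formula; the terms with a derivative of
   the Jacobian J cancel because D_i J_ka = D_k J_ia. *)
Lemma divg_natural n (G G' : 'rV[R]_n -> 'M[R]_n) (X Y : 'rV[R]_n -> 'rV[R]_n)
    (psi : 'rV[R]_n -> 'rV[R]_n) x :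
  smooth_at psi x -> smooth_at G x -> smooth_at G' (psi x) ->
  0 < \det (G x) -> 0 < \det (G' (psi x)) ->
  (\forall y \near x, G y = jac psi y *m G' (psi y) *m (jac psi y)^T) ->
  smooth_at X x -> smooth_at Y (psi x) ->
  (\forall y \near x, Y (psi y) = X y *m jac psi y) ->
  divg G X x = divg G' Y (psi x).
Proof.
move=> sp sG sG' d0 d0' GG' sX sY XY.
rewrite (divgE sG d0 sX) (divgE sG' d0' sY).
have Gx := nbhs_singleton GG'; have Yx := nbhs_singleton XY; rewrite /= in Gx Yx.
have uJ : jac psi x \in unitmx.
  rewrite unitmxE unitfE; apply: contraTneq d0 => J0.
  by rewrite Gx !det_mulmx det_tr J0 mulr0 ltxx.
have dl v := dlogdet_natural v sp sG' uJ (det_gt0_unit d0') GG'.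
have trE : \tr (jac Y (psi x)) = \tr (jac X x) +
    \sum_k X x 0 k * \tr (invmx (jac psi x) *m 'D_(base k) (jac psi) x).
  rewrite -[jac Y (psi x)](mulKmx uJ) (chain_frame sp sX sY XY).
  rewrite mulmxDr mxtraceD mxtrace_mulC mulmxK//.
  congr (_ + _); rewrite mulmx_sumr raddf_sum; apply: eq_bigr => k _ /=.
  by rewrite -scalemxAr mxtraceZ.
rewrite trE -!addrA; congr (_ + _).
have := fun v => dlogdet_lin v sG'.
move: (dlogdet G' (psi x)) dl => D dl Dlin.
have sumE : \sum_i X x 0 i * (D (base i *m jac psi x) / 2) =
    \sum_i Y (psi x) 0 i * (D (base i) / 2).
  transitivity (\sum_i \sum_a X x 0 i * (jac psi x i a * D (base a) / 2)).
    apply: eq_bigr => i _; rewrite Dlin mulr_suml mulr_sumr.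
    by apply: eq_bigr => a _; rewrite -rowE mxE.
  rewrite exchange_big; apply: eq_bigr => a _ /=; rewrite Yx mxE mulr_suml.
  by apply: eq_bigr => i _; rewrite !mulrA.
rewrite -sumE -big_split; apply: eq_bigr => i _ /=; rewrite dl.
move: (\tr _) (D _) => a b; by rewrite mulr2n; field.
Qed.

Lemma gradmE n (G : 'rV[R]_n -> 'M[R]_n) (f : 'rV[R]_n -> R) x :
  gradm G f x = (\row_j 'D_(base j) f x) *m (invmx (G x))^T.
Proof.
apply/rowP => i; rewrite !mxE; apply: eq_bigr => j _.
by rewrite !mxE mulrC.
Qed.

Lemma smooth_gradm n (G : 'rV[R]_n -> 'M[R]_n) (f : 'rV[R]_n -> R) x :
  smooth_at G x -> G x \in unitmx -> smooth_at f x -> smooth_at (gradm G f) x.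
Proof.
move=> sG uG sf; apply/smooth_mx => a i.
have E : \near x, \sum_j invmx (G x) i j * 'D_(base j) f x = gradm G f x a i.
  by apply: near_all => y; rewrite mxE.
apply: smooth_at_eq E _; apply: smooth_sum => j _; apply: smoothM.
  apply: smooth_entry; apply: smooth_invmx => //; exact: near_unit.
exact: smooth_derive.
Qed.

(** The gradient of [f \o psi] is carried by [jac psi] to the gradient of [f], because inverting the
    congruence between the metrics gives J^-T G'^-1 J^-1. The rest is [divg_natural]. *)
Lemma lap_natural n (G G' : 'rV[R]_n -> 'M[R]_n) (f : 'rV[R]_n -> R)
    (psi : 'rV[R]_n -> 'rV[R]_n) x :
  smooth_at psi x -> smooth_at G x -> smooth_at G' (psi x) ->
  0 < \det (G x) -> 0 < \det (G' (psi x)) ->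
  (\forall y \near x, G y = jac psi y *m G' (psi y) *m (jac psi y)^T) ->
  smooth_at f (psi x) ->
  lap G (f \o psi) x = lap G' f (psi x).
Proof.
move=> sp sG sG' d0 d0' GG' sf; rewrite /lap; apply: (congr1 -%R).
have pc := smooth_cont sp.
have sfp : smooth_at (f \o psi) x by exact: smooth_comp_real.
apply: (divg_natural sp sG sG' d0 d0' GG').
- by apply: smooth_gradm => //; exact: det_gt0_unit.
- by apply: smooth_gradm => //; exact: det_gt0_unit.
have nG := near_unit sG (det_gt0_unit d0).
have nf := pc _ (smooth_at_nbhs sf).
apply: near_impl (near_and (near_and GG' nG) (near_and (smooth_at_nbhs sp) nf)).
move=> y [[Gy uG] [spy sfy]]; rewrite !gradmE.
have uJG : jac psi y *m G' (psi y) *m (jac psi y)^T \in unitmx by rewrite -Gy.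
move: (uJG); rewrite !unitmx_mul unitmx_tr => /andP[/andP[uJ uG'] _].
have -> : \row_j 'D_(base j) (f \o psi) y =
    (\row_j 'D_(base j) f (psi y)) *m (jac psi y)^T.
  apply/rowP => j; rewrite !mxE (derive_comp_real _ spy sfy).
  rewrite (derive_coord _ (smooth_differentiable sfy)); apply: eq_bigr => a _.
  by rewrite !mxE mulrC.
rewrite -!mulmxA; congr (_ *m _); rewrite Gy.
apply: trmx_inj; rewrite !trmx_mul !trmxK.
rewrite invmx_congruence// -!mulmxA mulVmx// mulmx1 mulKVmx//.
by rewrite unitmx_tr.
Qed.

End Divergence.

(** * Bernstein's gradient estimate *)

Section Bernstein.
Context {R : realType}.

Lemma unit_interval_shift (a b : R) :
  0 <= a <= 1 -> 0 <= b <= 1 -> -1 <= b + a - 1 <= 1.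
Proof. by move=> /andP[a0 a1] /andP[b0 b1]; apply/andP; split; lra. Qed.

Lemma second_difference_le0 (p m q : R) :
  p <= m -> q <= m -> p - m - (m - q) <= 0.
Proof. lra. Qed.

(** A positive second derivative would stay positive near [y]. The second difference of [w] centred
    at [y] is a positive multiple of a nearby value of it, yet it is at most zero at a maximum. *)
Lemma second_derivative_test n (w : 'rV[R]_n -> R) y v :
  smooth_at w y -> (\forall z \near y, w z <= w y) -> 'D_v ('D_v w) y <= 0.
Proof.
move=> sw wmax; rewrite leNgt; apply/negP => pos.
have cD := smooth_cont (smooth_derive v (smooth_derive v sw)).
have nD : \forall z \near y, 0 < 'D_v ('D_v w) z.
  have := cD => /cvgrPdist_lt /(_ _ pos); apply: near_impl => z.
  by rewrite ltr_distlC subrr => /andP[].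
have [W [oW Wy] sW] := sw.
have nall := near_and (open_near oW Wy) (near_and wmax nD).
have [s s0 Hs] := near_lines v (- v) nall.
have line (c : R) : -1 <= c <= 1 ->
    W (c *: (s *: v) + y) /\ w (c *: (s *: v) + y) <= w y /\
    0 < 'D_v ('D_v w) (c *: (s *: v) + y).
  move=> /andP[c0 c1]; have [cp|cn] := leP 0 c.
    have := Hs c 0; rewrite scale0r add0r; apply; first by rewrite cp c1.
    by rewrite lexx ler01.
  have := Hs 0 (- c); rewrite scale0r add0r scaleNr !scalerN opprK; apply.
    by rewrite lexx ler01.
  by rewrite oppr_ge0 (ltW cn) lerNl c0.
(* Starting the second difference at y - s v centres it at [y]. *)
pose x := (-1) *: (s *: v) + y.
have Ex a b : b *: (s *: v) + (a *: (s *: v) + x) = (b + a - 1) *: (s *: v) + y.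
  by rewrite /x !addrA -!scalerDl.
have [|z [[a [b [a01 b01 Ez]]] E]] :=
    @second_difference R n W w x (s *: v) (s *: v) (sW 2%N).
  by move=> a b ai bi; rewrite Ex; apply: (line _ _).1; exact: unit_interval_shift.
have [Wz [_ Dz]] := line _ (unit_interval_shift a01 b01).
rewrite -Ex -Ez in Wz Dz.
have := derive2Z v v s oW Wz (sW 2%N); rewrite -E.
have := Ex 1 1; rewrite !scale1r => ->.
have := Ex 0 1; rewrite scale1r scale0r add0r => ->.
have l1 : w ((1 + 1 - 1) *: (s *: v) + y) <= w y.
  have i1 : 0 <= (1 : R) <= 1 by rewrite ler01 lexx.
  by have [_ []] := line _ (unit_interval_shift i1 i1).
have l2 : w x <= w y.
  have i1 : -1 <= (-1 : R) <= 1.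
    by apply/andP; split=> //; exact: le_trans (lerN10 R) ler01.
  by have [_ []] := line _ i1.
rewrite addr0 subrr scale0r add0r => Eq.
have : 0 < s * s * 'D_v ('D_v w) z by rewrite !mulr_gt0.
by rewrite -Eq ltNge second_difference_le0.
Qed.

Lemma quad_delta n (M : 'M[R]_n) (v : 'rV[R]_n) :
  (v *m M *m v^T) 0 0 = \sum_i \sum_j v 0 i * v 0 j * M i j.
Proof.
rewrite mxE exchange_big; apply: eq_bigr => j _.
by rewrite mxE mulr_suml; apply: eq_bigr => i _; rewrite mxE mulrAC.
Qed.

Definition posdef n (A : 'M[R]_n) :=
  A^T = A /\ forall v : 'rV_n, v != 0 -> 0 < (v *m A *m v^T) 0 0.

(** Splitting off a Schur complement: with u = (a, b) the first row of [A], one has A = a^-1 u^T u +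
    diag(0, S). The rank one part contributes a^-1 u W u^T, and the induction hypothesis treats the
    positive definite block [S]. *)
Lemma posdef_trace_step n (A W : 'M[R]_(1 + n)) :
  (forall A W : 'M[R]_n, posdef A ->
    (forall v : 'rV_n, (v *m W *m v^T) 0 0 <= 0) -> \tr (A *m W^T) <= 0) ->
  posdef A ->
  (forall v : 'rV_(1 + n), (v *m W *m v^T) 0 0 <= 0) -> \tr (A *m W^T) <= 0.
Proof.
move=> IH [sA pA] nW.
pose a := A 0 0; pose b : 'rV_n := ursubmx A; pose D : 'M_n := drsubmx A.
have ul : ulsubmx A = a%:M by rewrite [LHS]mx11_scalar !mxE !lshift0.
have EA : A = block_mx a%:M b b^T D.
  rewrite -{1}(submxK A) ul; congr block_mx.
  by rewrite /b trmx_ursub sA.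
have sD : D^T = D by rewrite /D trmx_drsub sA.
have a0 : 0 < a.
  have := pA (row_mx 1%:M 0); rewrite EA mul_row_block tr_row_mx.
  rewrite !mul1mx !mul0mx !addr0 mul_row_col trmx1 mulmx1 trmx0 mulmx0 addr0.
  rewrite mxE eqxx; apply; apply/eqP => /(congr1 lsubmx).
  by rewrite row_mxKl linear0 => /matrixP/(_ 0 0); rewrite !mxE => /eqP; rewrite oner_eq0.
pose S := D - a^-1 *: (b^T *m b).
have EAS : A = a^-1 *: ((row_mx a%:M b)^T *m row_mx a%:M b) + block_mx 0 0 0 S.
  rewrite tr_row_mx mul_col_row tr_scalar_mx scale_block_mx add_block_mx !addr0.
  rewrite EA /S addrC subrK; congr block_mx.
  - by rewrite -scalar_mxM scale_scalar_mx mulKf// gt_eqF.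
  - by rewrite mul_scalar_mx scalerA mulVf ?scale1r// gt_eqF.
  - by rewrite mul_mx_scalar scalerA mulVf ?scale1r// gt_eqF.
have sS : S^T = S by rewrite /S linearB /= linearZ /= trmx_mul trmxK sD.
have pS (v : 'rV_n) : v != 0 -> 0 < (v *m S *m v^T) 0 0.
  (* This [t] makes (t, v) orthogonal to the first row of [A], so the rank one part vanishes and [A]
     takes at (t, v) the value of [S] at [v]. *)
  move=> v0; pose t : 'rV[R]_1 := - a^-1 *: (v *m b^T).
  have := pA (row_mx t v); rewrite EAS mulmxDr mulmxDl.
  have -> : row_mx t v *m (a^-1 *: ((row_mx a%:M b)^T *m row_mx a%:M b)) = 0.
    rewrite -scalemxAr mulmxA tr_row_mx mul_row_col tr_scalar_mx mul_mx_scalar.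
    by rewrite /t scalerA mulrN mulfV ?gt_eqF// scaleN1r addNr mul0mx scaler0.
  rewrite mul0mx add0r mul_row_block !mulmx0 !addr0 add0r tr_row_mx mul_row_col.
  rewrite mul0mx add0r; apply; apply/eqP => /(congr1 rsubmx).
  by rewrite row_mxKr linear0; apply/eqP.
rewrite EAS mulmxDl mxtraceD (le_trans (@lerD _ _ 0 _ 0 _ _)) ?addr0//.
  rewrite -scalemxAl mxtraceZ -mulmxA mxtrace_mulC pmulr_rle0 ?invr_gt0//.
  have := nW (row_mx a%:M b); set u := row_mx _ _ => H.
  by rewrite /mxtrace big_ord1 -[_ *m u^T]trmxK mxE !trmx_mul !trmxK mulmxA.
rewrite -(submxK W) tr_block_mx mulmx_block !mul0mx !add0r mxtrace_block.
rewrite mxtrace0 add0r; apply: IH => [|v]; first by split.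
have := nW (row_mx 0 v); rewrite -{1}(submxK W) mul_row_block !mul0mx !add0r.
by rewrite tr_row_mx mul_row_col trmx0 mulmx0 add0r.
Qed.

Lemma posdef_trace_nonpos n (A W : 'M[R]_n) : posdef A ->
  (forall v : 'rV_n, (v *m W *m v^T) 0 0 <= 0) -> \tr (A *m W^T) <= 0.
Proof.
elim: n A W => [|n IH] A W; first by rewrite /mxtrace big_ord0.
exact: (@posdef_trace_step n A W).
Qed.

End Bernstein.

(** * Pointwise algebra of Bernstein's estimate *)

Section BernsteinAlgebra.
Context {R : realType}.

Lemma norm_sum_ord_le n (F : 'I_n -> R) M :
  (forall i, `|F i| <= M) -> `|\sum_i F i| <= n%:R * M.
Proof.
move=> H; apply: le_trans (ler_norm_sum _ _ _) _.
apply: le_trans (ler_sum _ (fun i _ => H i)) _.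
by rewrite sumr_const card_ord mulr_natl.
Qed.

Lemma le_normM (x y a b : R) : `|x| <= a -> `|y| <= b -> `|x * y| <= a * b.
Proof. by move=> xa yb; rewrite normrM ler_pM. Qed.

Lemma le_normD (x y a b : R) : `|x| <= a -> `|y| <= b -> `|x + y| <= a + b.
Proof. by move=> xa yb; rewrite (le_trans (ler_normD _ _))// lerD. Qed.

Lemma norm_le_sqrt_sum (I : finType) (F : I -> R) i :
  `|F i| <= Num.sqrt (\sum_i F i ^+ 2).
Proof.
rewrite -sqrtr_sqr ler_wsqrtr// (bigD1 i)//= lerDl.
by apply: sumr_ge0 => j _; exact: sqr_ge0.
Qed.

Lemma absorb (a b g h u w z t : R) :
  a + (b + b) <= t + h + (u + w) -> h <= a + g -> u <= b + z ->
  b <= t + g + (w + z).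
Proof. lra. Qed.

(* Young's inequality absorbs the mixed terms in the two coercive ones, the
   ellipticity of the principal part and the multiple K of f^2. *)
Lemma bernstein_scalar (th c d e B : R) : 0 < th -> 0 <= c -> 0 <= B ->
  exists2 K : R, 0 <= K & exists2 C : R, 0 <= C & forall X al F : R,
  2 * th * X ^+ 2 + 2 * K * (th * al ^+ 2) <=
    c * al ^+ 2 + d * X * al + 2 * K * (F * (e * al + B * F)) ->
  al ^+ 2 <= C * F ^+ 2.
Proof.
move=> th0 c0 B0.
have d2 : 0 <= d ^+ 2 / (8 * th) by rewrite divr_ge0 ?sqr_ge0 ?mulr_ge0// ltW.
(* After absorption, the coefficient of [al ^+ 2] on the left exceeds the one on the right by
   exactly 1. *)
have [K K0 Kth] : exists2 K, 0 <= K & K * th = c + d ^+ 2 / (8 * th) + 1.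
  exists ((c + d ^+ 2 / (8 * th) + 1) / th); last by rewrite divfK// gt_eqF.
  by apply: divr_ge0 (ltW th0); rewrite !addr_ge0.
exists K => //; exists (2 * K * B + K * e ^+ 2 / th).
  apply: addr_ge0; first by rewrite !mulr_ge0.
  by apply: divr_ge0 (ltW th0); rewrite mulr_ge0 ?sqr_ge0.
move=> X al F H.
have Y1 : d * X * al <= 2 * th * X ^+ 2 + d ^+ 2 / (8 * th) * al ^+ 2.
  have : 0 <= (4 * th * X - d * al) ^+ 2 / (8 * th).
    by rewrite divr_ge0 ?sqr_ge0 ?mulr_ge0// ltW.
  have -> : (4 * th * X - d * al) ^+ 2 / (8 * th) =
     2 * th * X ^+ 2 + d ^+ 2 / (8 * th) * al ^+ 2 - d * X * al.
    by field; rewrite gt_eqF.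
  by rewrite subr_ge0.
have Y2 : 2 * (F * (e * al)) <= th * al ^+ 2 + e ^+ 2 / th * F ^+ 2.
  have : 0 <= (th * al - e * F) ^+ 2 / th by rewrite divr_ge0 ?sqr_ge0// ltW.
  have -> : (th * al - e * F) ^+ 2 / th =
     th * al ^+ 2 + e ^+ 2 / th * F ^+ 2 - 2 * (F * (e * al)).
    by field; rewrite gt_eqF.
  by rewrite subr_ge0.
have Y3 := ler_wpM2l K0 Y2.
have : K * th * al ^+ 2 <= (c + d ^+ 2 / (8 * th)) * al ^+ 2 +
     (2 * K * B + K * e ^+ 2 / th) * F ^+ 2.
  have E1 : 2 * K * (F * (e * al + B * F)) =
      K * (2 * (F * (e * al))) + 2 * K * B * F ^+ 2 by ring.
  have E2 : K * (th * al ^+ 2 + e ^+ 2 / th * F ^+ 2) =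
      K * th * al ^+ 2 + K * e ^+ 2 / th * F ^+ 2 by ring.
  have E3 : 2 * K * (th * al ^+ 2) = K * th * al ^+ 2 + K * th * al ^+ 2 by ring.
  rewrite E1 E3 in H; rewrite E2 in Y3.
  rewrite [(c + _) * _]mulrDl [(2 * K * B + _) * _]mulrDl.
  exact: (absorb H Y1 Y3).
rewrite Kth => L; have := L; rewrite [X in X <= _]mulrDl mul1r lerD2l.
exact.
Qed.

(** The pointwise content of the method at an interior maximum. [A], [b] are the coefficients of the
    operator, [f], [p], [H], [T] the values of the solution and of its derivatives up to order
    three, [rho] the cutoff, and a prime marks derivatives. The last hypothesis is the second order
    part applied to the test function. The differentiated equation removes [T]; ellipticity makes
    the square of rho |H| coercive, and |H| enters the other terms only through this product, so
    that the bound survives as rho tends to 0. [K] and [C] depend only on [n], [th] and [B]. *)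
Lemma bernstein_algebra n (th B : R) : 0 < th -> 0 <= B ->
  exists2 K : R, 0 <= K & exists2 C : R, 0 <= C &
  forall (A : 'I_n -> 'I_n -> R) (A' : 'I_n -> 'I_n -> 'I_n -> R)
    (b : 'I_n -> R) (b' : 'I_n -> 'I_n -> R) (mu rho : R)
    (r' : 'I_n -> R) (r'' : 'I_n -> 'I_n -> R)
    (f : R) (p : 'I_n -> R) (H : 'I_n -> 'I_n -> R) (T : 'I_n -> 'I_n -> 'I_n -> R),
  (forall i j, `|A i j| <= B) -> (forall k i j, `|A' k i j| <= B) ->
  (forall i, `|b i| <= B) -> (forall k i, `|b' k i| <= B) ->
  `|mu| <= B -> 0 <= rho <= B -> (forall i, `|r' i| <= B) ->
  (forall i j, `|r'' i j| <= B) ->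
  (forall v : 'I_n -> R,
     th * (\sum_i v i ^+ 2) <= \sum_i \sum_j A i j * (v i * v j)) ->
  \sum_i \sum_j A i j * H i j + \sum_i b i * p i = - mu * f ->
  (forall k, \sum_i \sum_j A i j * T i j k =
     - (\sum_i \sum_j A' k i j * H i j) - \sum_i b' k i * p i
     - \sum_i b i * H i k - mu * p k) ->
  let P := \sum_k p k ^+ 2 in
  let q i := 2 * \sum_k p k * H i k in
  let Q i j := 2 * \sum_k (H i k * H j k + p k * T i j k) in
  \sum_i \sum_j A i j * ((2 * (r' i * r' j) + 2 * rho * r'' i j) * P
     + 2 * rho * (r' j * q i + r' i * q j) + rho ^+ 2 * Q i j
     + 2 * K * (p i * p j) + 2 * K * f * H i j) <= 0 ->
  P <= C * f ^+ 2.
Proof.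
move=> th0 B0; pose N : R := n%:R.
have N0 : 0 <= N by exact: ler0n.
(* [c] and [d] collect what [S1], [S2] and [S4] below contribute to the coefficients of [al ^+ 2]
   and of [rho * be * al]. *)
pose c := N * (N * (B * (2 * (B * B) + 2 * B * B))) + 2 * (B ^+ 2 * (N * (N * B + B))).
pose d := N * (N * (B * (2 * (B * (2 * N) + B * (2 * N))))) +
   2 * (B * (N * (N * (N * B) + N * B))).
have c0 : 0 <= c.
  by rewrite /c addr_ge0// ?mulr_ge0 ?addr_ge0 ?mulr_ge0 ?addr_ge0 ?exprn_ge0 ?mulr_ge0.
have [K K0 [C C0 HKC]] := bernstein_scalar d (N * B) th0 c0 B0.
exists K => //; exists C => // A A' b b' mu rho r' r'' f p H T.
move=> hA hA' hb hb' hmu /andP[rho0 rhoB] hr' hr'' hth hE hEk P q Q hW.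
pose al := Num.sqrt P.
pose be := Num.sqrt (\sum_ij H ij.1 ij.2 ^+ 2).
have P0 : 0 <= P by apply: sumr_ge0 => i _; exact: sqr_ge0.
have al0 : 0 <= al by exact: sqrtr_ge0.
have be0 : 0 <= be by exact: sqrtr_ge0.
have hp k : `|p k| <= al by exact: norm_le_sqrt_sum.
have hH i j : `|H i j| <= be.
  exact: (norm_le_sqrt_sum (fun ij : 'I_n * 'I_n => H ij.1 ij.2) (i, j)).
have al2 : al ^+ 2 = P by rewrite sqr_sqrtr.
have be2 : be ^+ 2 = \sum_i \sum_j H i j ^+ 2.
  rewrite sqr_sqrtr; last by apply: sumr_ge0 => i _; exact: sqr_ge0.
  by rewrite pair_bigA.
have hrho : `|rho| <= rho by rewrite ger0_norm.
have h2 : `|2 : R| <= 2 by rewrite ger0_norm.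
pose S1 := \sum_i \sum_j A i j * (2 * (r' i * r' j) + 2 * rho * r'' i j).
pose S2 := \sum_i \sum_j A i j * (2 * (r' j * q i + r' i * q j)).
pose S3 := \sum_k \sum_i \sum_j A i j * (H i k * H j k).
pose S4 := \sum_k p k * \sum_i \sum_j A i j * T i j k.
pose S5 := \sum_i \sum_j A i j * (p i * p j).
pose S6 := \sum_i \sum_j A i j * H i j.
have EW : S1 * P + rho * S2 + rho ^+ 2 * (2 * S3 + 2 * S4) + 2 * K * S5 + 2 * K * f * S6 <= 0.
  apply: le_trans hW; rewrite le_eqVlt; apply/orP; left; apply/eqP.
  have -> : 2 * S3 + 2 * S4 = \sum_i \sum_j A i j * Q i j.
    rewrite /S3 /S4 -mulrDr -big_split /=.
    transitivity (\sum_i \sum_j 2 * \sum_k A i j * (H i k * H j k + p k * T i j k)).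
      under [RHS]eq_bigr do rewrite -mulr_sumr exchange_big.
      rewrite -mulr_sumr exchange_big; congr (_ * _); apply: eq_bigr => k _ /=.
      rewrite mulr_sumr -big_split; apply: eq_bigr => i _ /=.
      rewrite mulr_sumr -big_split; apply: eq_bigr => j _ /=.
      by rewrite mulrDr [X in _ + X]mulrCA.
    apply: eq_bigr => i _; apply: eq_bigr => j _.
    by rewrite /Q -mulr_sumr mulrCA.
  rewrite /S1 /S2 /S5 /S6 mulr_suml !mulr_sumr -!big_split; apply: eq_bigr => i _ /=.
  rewrite mulr_suml !mulr_sumr -!big_split; apply: eq_bigr => j _ /=.
  by move: (Q i j) (q i) (q j) => *; ring.
have hS1 : `|S1| <= N * (N * (B * (2 * (B * B) + 2 * B * B))).
  apply: norm_sum_ord_le => i; apply: norm_sum_ord_le => j.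
  apply: le_normM => //; apply: le_normD; first by do 2![apply: le_normM => //].
  by apply: le_normM => //; apply: le_normM => //; exact: le_trans rhoB.
have hq i : `|q i| <= 2 * N * (al * be).
  rewrite -mulrA; apply: le_normM => //; apply: norm_sum_ord_le => k.
  exact: le_normM.
have hS2 : `|S2| <= N * (N * (B * (2 * (B * (2 * N) + B * (2 * N))))) * (al * be).
  rewrite -!mulrA; apply: norm_sum_ord_le => i; apply: norm_sum_ord_le => j.
  apply: le_normM => //; apply: le_normM => //; rewrite mulrDl.
  by rewrite -![B * _ * _]mulrA; apply: le_normD; apply: le_normM.
have hS3 : th * be ^+ 2 <= S3.
  rewrite be2 exchange_big mulr_sumr; apply: ler_sum => k _ /=.
  exact: (hth (fun i => H i k)).
have hS4 : `|S4| <= N * (al * (N * (N * (B * be)) + N * (B * al) + N * (B * be) + B * al)).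
  apply: norm_sum_ord_le => k; apply: le_normM => //; rewrite hEk.
  apply: le_normD; last by rewrite normrN; exact: le_normM.
  apply: le_normD; last by rewrite normrN; apply: norm_sum_ord_le => i; exact: le_normM.
  apply: le_normD; last by rewrite normrN; apply: norm_sum_ord_le => i; exact: le_normM.
  by rewrite normrN; apply: norm_sum_ord_le => i; apply: norm_sum_ord_le => j;
    exact: le_normM.
have hS5 : th * al ^+ 2 <= S5 by rewrite al2; exact: hth.
have hS6 : `|S6| <= N * (B * al) + B * `|f|.
  have -> : S6 = - mu * f - \sum_i b i * p i by rewrite -hE addrK.
  rewrite addrC; apply: le_normD.
    by rewrite normrN; apply: norm_sum_ord_le => i; exact: le_normM.
  by apply: le_normM => //; rewrite normrN.
rewrite -al2 -[f ^+ 2]real_normK ?num_real//.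
apply: (HKC (rho * be) al `|f|).
have EX : 2 * th * (rho * be) ^+ 2 + 2 * K * (th * al ^+ 2) <=
    - (S1 * P) - rho * S2 - 2 * rho ^+ 2 * S4 - 2 * K * f * S6.
  have M3 : 2 * rho ^+ 2 * (th * be ^+ 2) <= 2 * rho ^+ 2 * S3.
    by rewrite ler_wpM2l// mulr_ge0// sqr_ge0.
  have M5 : 2 * K * (th * al ^+ 2) <= 2 * K * S5 by rewrite ler_wpM2l// mulr_ge0.
  have -> : 2 * th * (rho * be) ^+ 2 = 2 * rho ^+ 2 * (th * be ^+ 2) by ring.
  apply: le_trans (lerD M3 M5) _; rewrite -subr_le0; apply: le_trans EW.
  by rewrite le_eqVlt; apply/orP; left; apply/eqP; ring.
apply: (le_trans EX).
have T1 : - (S1 * P) <= N * (N * (B * (2 * (B * B) + 2 * B * B))) * al ^+ 2.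
  by rewrite al2 -mulNr ler_wpM2r//; apply: le_trans hS1; rewrite -normrN ler_norm.
have T2 : - (rho * S2) <=
    N * (N * (B * (2 * (B * (2 * N) + B * (2 * N))))) * (rho * be) * al.
  have -> : N * (N * (B * (2 * (B * (2 * N) + B * (2 * N))))) * (rho * be) * al =
    rho * (N * (N * (B * (2 * (B * (2 * N) + B * (2 * N))))) * (al * be)) by ring.
  rewrite -mulrN ler_wpM2l//; apply: le_trans hS2; rewrite -normrN; exact: ler_norm.
(* One factor [rho] is kept in the terms with [al * be], which must be controlled by [rho * be]; in
   the terms with [al ^+ 2] both factors are bounded by [B]. *)
have T4 : - (2 * rho ^+ 2 * S4) <=
    2 * (B * (N * (N * (N * B) + N * B))) * (rho * be) * al +
    2 * (B ^+ 2 * (N * (N * B + B))) * al ^+ 2.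
  have := hS4; rewrite -normrN => /(le_trans (ler_norm _)) h4.
  have r2 : rho ^+ 2 <= B ^+ 2 by rewrite ler_sqr.
  have r1 : rho ^+ 2 <= B * rho by rewrite expr2 ler_wpM2r.
  rewrite -mulrN; apply: le_trans (ler_wpM2l _ h4) _.
    by rewrite mulr_ge0// sqr_ge0.
  have -> : 2 * rho ^+ 2 *
    (N * (al * (N * (N * (B * be)) + N * (B * al) + N * (B * be) + B * al))) =
    rho ^+ 2 * (2 * (N * (al * (N * (N * (B * be)) + N * (B * be))))) +
    rho ^+ 2 * (2 * (N * (al * (N * (B * al) + B * al)))) by ring.
  apply: lerD.
    apply: le_trans (ler_wpM2r _ r1) _; last by rewrite le_eqVlt; apply/orP; left; apply/eqP; ring.
    by rewrite ?(mulr_ge0, addr_ge0).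
  apply: le_trans (ler_wpM2r _ r2) _; last by rewrite le_eqVlt; apply/orP; left; apply/eqP; ring.
  by rewrite ?(mulr_ge0, addr_ge0).
have T6 : - (2 * K * f * S6) <= 2 * K * (`|f| * (N * B * al + B * `|f|)).
  rewrite -!mulrA -!mulrN ler_wpM2l// ler_wpM2l// mulrN.
  apply: le_trans (ler_norm _) _; rewrite normrN normrM ler_wpM2l//.
apply: le_trans (lerD (lerD (lerD T1 T2) T4) T6) _.
by rewrite le_eqVlt; apply/orP; left; apply/eqP; rewrite /c /d; ring.
Qed.

End BernsteinAlgebra.

(** * Derivatives of the test function and of the equation *)

Section GradientEstimate.
Context {R : realType}.

Lemma sderiveMc n (c : R) (f : 'rV[R]_n -> R) x v :
  smooth_at f x -> 'D_v (fun y => c * f y) x = c * 'D_v f x.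
Proof. exact: sderiveZ. Qed.

Lemma near_bound n (I : finType) (g : I -> 'rV[R]_n -> R) x :
  (forall i, smooth_at (g i) x) ->
  exists2 M : R, 0 <= M & \forall y \near x, forall i, `|g i y| <= M.
Proof.
move=> sg; exists (\sum_i (`|g i x| + 1)).
  by apply: sumr_ge0 => i _; exact: addr_ge0.
apply: near_forall => i; have := smooth_cont (sg i).
move=> /cvgrPdist_le /(_ 1 ltr01); apply: near_impl => y H.
rewrite (bigD1 i)//= -[X in X <= _]addr0 lerD//; last first.
  by apply: sumr_ge0 => j _; exact: addr_ge0.
rewrite -lerBlDl; apply: le_trans H; rewrite distrC.
by rewrite (le_trans _ (lerB_dist _ _)).
Qed.

Section Products.
Context {n : nat}.
Variables (rho q f : 'rV[R]_n -> R) (K : R).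

Let w y := rho y * rho y * q y + K * (f y * f y).

Lemma smooth_cutoff_energy y :
  smooth_at rho y -> smooth_at q y -> smooth_at f y -> smooth_at w y.
Proof.
move=> sr sq sf; apply: smoothD; first by apply: smoothM => //; exact: smoothM.
by apply: smoothM; [exact: smooth_cstR|exact: smoothM].
Qed.

Lemma derive_cutoff_energy y v :
  smooth_at rho y -> smooth_at q y -> smooth_at f y ->
  'D_v w y = 2 * (rho y * 'D_v rho y * q y) + rho y * rho y * 'D_v q y
     + 2 * K * (f y * 'D_v f y).
Proof.
move=> sr sq sf; have srr := smoothM sr sr; have sff := smoothM sf sf.
have sK := smooth_cstR K y.
rewrite (sderiveD v (smoothM srr sq) (smoothM sK sff)) (sderiveM v srr sq).
rewrite (sderiveM v sr sr) (sderiveMc K v sff) (sderiveM v sf sf).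
by move: ('D_v _ _) ('D_v _ _) ('D_v _ _) => *; ring.
Qed.

Lemma derive2_cutoff_energy y u v :
  smooth_at rho y -> smooth_at q y -> smooth_at f y ->
  'D_u ('D_v w) y =
    (2 * ('D_u rho y * 'D_v rho y) + 2 * rho y * 'D_u ('D_v rho) y) * q y
    + 2 * rho y * ('D_v rho y * 'D_u q y + 'D_u rho y * 'D_v q y)
    + rho y ^+ 2 * 'D_u ('D_v q) y
    + 2 * K * ('D_u f y * 'D_v f y) + 2 * K * f y * 'D_u ('D_v f) y.
Proof.
move=> sr sq sf.
pose g z := 2 * (rho z * 'D_v rho z * q z) + rho z * rho z * 'D_v q z
     + 2 * K * (f z * 'D_v f z).
have E : \near y, 'D_v w y = g y.
  apply: near_impl (near_and (smooth_at_nbhs sr)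
    (near_and (smooth_at_nbhs sq) (smooth_at_nbhs sf))) => z [? [? ?]].
  exact: derive_cutoff_energy.
rewrite (near_eq_derive _ E).
have sr' := smooth_derive v sr; have sq' := smooth_derive v sq.
have sf' := smooth_derive v sf.
have s2 := smooth_cstR 2 y; have s2K := smooth_cstR (2 * K) y.
have t1 := smoothM (smoothM sr sr') sq; have t2 := smoothM (smoothM sr sr) sq'.
have t3 := smoothM sf sf'.
rewrite (sderiveD u (smoothD (smoothM s2 t1) t2) (smoothM s2K t3)).
rewrite (sderiveD u (smoothM s2 t1) t2) (sderiveMc 2 u t1) (sderiveMc (2 * K) u t3).
rewrite (sderiveM u (smoothM sr sr') sq) (sderiveM u sr sr').
rewrite (sderiveM u (smoothM sr sr) sq') (sderiveM u sr sr) (sderiveM u sf sf').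
move: ('D_u ('D_v rho) y) ('D_u ('D_v q) y) ('D_u ('D_v f) y).
move: ('D_u rho y) ('D_v rho y) ('D_u q y) ('D_v q y) ('D_u f y) ('D_v f y).
by move: (rho y) (q y) (f y) => *; ring.
Qed.

End Products.

Lemma derive_sumsq n m (F : 'I_m -> 'rV[R]_n -> R) y v :
  (forall k, smooth_at (F k) y) ->
  'D_v (fun z => \sum_k F k z * F k z) y = 2 * \sum_k F k y * 'D_v (F k) y.
Proof.
move=> sF; rewrite sderive_sum => [|k]; last exact: smoothM.
rewrite mulr_sumr; apply: eq_bigr => k _; rewrite (sderiveM v (sF k) (sF k)).
by rewrite [X in _ + X]mulrC mulrDl mul1r.
Qed.

Lemma derive2_sumsq n m (F : 'I_m -> 'rV[R]_n -> R) y u v :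
  (forall k, smooth_at (F k) y) ->
  'D_u ('D_v (fun z => \sum_k F k z * F k z)) y =
  2 * \sum_k ('D_u (F k) y * 'D_v (F k) y + F k y * 'D_u ('D_v (F k)) y).
Proof.
move=> sF; have sD k := smooth_derive v (sF k).
have E : \near y, 'D_v (fun z => \sum_k F k z * F k z) y =
    2 * \sum_k F k y * 'D_v (F k) y.
  have nF : \forall z \near y, forall k, smooth_at (F k) z.
    by apply: near_forall => k; exact: smooth_at_nbhs.
  by apply: near_impl nF => z; exact: derive_sumsq.
rewrite (near_eq_derive _ E) sderiveMc; last first.
  by apply: smooth_sum => k _; apply: smoothM.
congr (_ * _).
rewrite sderive_sum => [|k]; last exact: smoothM.
apply: eq_bigr => k _; rewrite (sderiveM u (sF k) (sD k)) addrC; congr (_ + _).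
Qed.

Lemma derive_quad n (w : 'rV[R]_n -> R) y (v : 'rV[R]_n) : smooth_at w y ->
  'D_v ('D_v w) y =
  \sum_i \sum_j v 0 i * v 0 j * 'D_(base i) ('D_(base j) w) y.
Proof.
move=> sw.
rewrite (derive_coord _ (smooth_differentiable (smooth_derive v sw))).
apply: eq_bigr => i _.
have E : \near y, 'D_v w y = \sum_j v 0 j * 'D_(base j) w y.
  apply: near_impl (smooth_at_nbhs sw) => z sz.
  exact: (derive_coord _ (smooth_differentiable sz)).
rewrite (near_eq_derive _ E) sderive_sum => [|j]; last first.
  by apply: smoothM; [exact: smooth_cstR|exact: smooth_derive].
rewrite -[_ *: _]/(_ * _) mulr_sumr; apply: eq_bigr => j _.
by rewrite (sderiveMc _ _ (smooth_derive (base j) sw)) mulrA.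
Qed.

(** The second derivative test in every direction makes the Hessian negative semidefinite, and its
    trace against a positive definite matrix is then at most zero. *)
Lemma elliptic_at_max n (A : 'M[R]_n) (w : 'rV[R]_n -> R) y :
  posdef A -> smooth_at w y -> (\forall z \near y, w z <= w y) ->
  \sum_i \sum_j A i j * 'D_(base i) ('D_(base j) w) y <= 0.
Proof.
move=> pA sw wmax.
pose W : 'M[R]_n := \matrix_(i, j) 'D_(base i) ('D_(base j) w) y.
have -> : \sum_i \sum_j A i j * 'D_(base i) ('D_(base j) w) y = \tr (A *m W^T).
  by apply: eq_bigr => i _; rewrite mxE; apply: eq_bigr => j _; rewrite !mxE.
apply: posdef_trace_nonpos => // v; rewrite quad_delta.
have := second_derivative_test v sw wmax; rewrite (derive_quad v sw).
congr (_ <= _); apply: eq_bigr => i _; apply: eq_bigr => j _; by rewrite mxE.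
Qed.

Definition elliptic_op n (a : 'I_n -> 'I_n -> 'rV[R]_n -> R)
    (b : 'I_n -> 'rV[R]_n -> R) (f : 'rV[R]_n -> R) y : R :=
  \sum_i \sum_j a i j y * 'D_(base i) ('D_(base j) f) y +
  \sum_i b i y * 'D_(base i) f y.

Lemma pde_rearrange (s1 s2 s3 s4 mu d : R) :
  s1 + s2 + (s3 + s4) = - mu * d -> s1 = - s2 - s4 - s3 - mu * d.
Proof. by rewrite mulNr => H; rewrite -H; ring. Qed.

(** The equation is differentiated along [base k] and solved for the third order terms. Symmetry of
    second derivatives brings ['D_(base k)] next to [f], which is the order in which the test
    function produces these terms. *)
Lemma derive_pde n (a : 'I_n -> 'I_n -> 'rV[R]_n -> R)
    (b : 'I_n -> 'rV[R]_n -> R) (f : 'rV[R]_n -> R) mu y k :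
  (forall i j, smooth_at (a i j) y) -> (forall i, smooth_at (b i) y) ->
  smooth_at f y -> (\forall z \near y, elliptic_op a b f z = - mu * f z) ->
  \sum_i \sum_j a i j y * 'D_(base i) ('D_(base j) ('D_(base k) f)) y =
    - (\sum_i \sum_j 'D_(base k) (a i j) y * 'D_(base i) ('D_(base j) f) y)
    - \sum_i 'D_(base k) (b i) y * 'D_(base i) f y
    - \sum_i b i y * 'D_(base i) ('D_(base k) f) y - mu * 'D_(base k) f y.
Proof.
move=> sa sb sf pde.
have sD i := smooth_derive (base i) sf.
have sDD i j := smooth_derive (base i) (sD j).
have comm i j : 'D_(base k) ('D_(base i) ('D_(base j) f)) y =
    'D_(base i) ('D_(base j) ('D_(base k) f)) y.
  apply: etrans (smooth_Clairaut (base i) (base k) (sD j)) _.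
  apply: near_eq_derive; apply: near_impl (smooth_at_nbhs sf) => z sz.
  exact: (smooth_Clairaut (base j) (base k) sz).
have := near_eq_derive (base k) pde.
rewrite (sderiveMc _ _ sf).
rewrite sderiveD; first last.
- by apply: smooth_sum => i _; exact: smoothM.
- by apply: smooth_sum => i _; apply: smooth_sum => j _; exact: smoothM.
rewrite sderive_sum => [|i]; last by apply: smooth_sum => j _; exact: smoothM.
rewrite [X in _ + X = _]sderive_sum => [|i]; last exact: smoothM.
have -> : \sum_i 'D_(base k) (fun z => \sum_j a i j z * 'D_(base i) ('D_(base j) f) z) y =
  \sum_i \sum_j a i j y * 'D_(base i) ('D_(base j) ('D_(base k) f)) y +
  \sum_i \sum_j 'D_(base k) (a i j) y * 'D_(base i) ('D_(base j) f) y.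
  rewrite -big_split; apply: eq_bigr => i _ /=.
  rewrite sderive_sum => [|j]; last exact: smoothM.
  rewrite -big_split; apply: eq_bigr => j _ /=.
  apply: etrans (sderiveM _ (sa i j) (sDD i j)) _.
  exact: (congr1 (fun t => a i j y * t + _) (comm i j)).
have -> : \sum_i 'D_(base k) (fun z => b i z * 'D_(base i) f z) y =
  \sum_i b i y * 'D_(base i) ('D_(base k) f) y +
  \sum_i 'D_(base k) (b i) y * 'D_(base i) f y.
  rewrite -big_split; apply: eq_bigr => i _ /=.
  by rewrite (sderiveM _ (sb i) (sD i)) (smooth_Clairaut (base i) (base k) sf).
exact: pde_rearrange.
Qed.

End GradientEstimate.

(** * The local gradient bound *)

Section GradientBound.
Context {R : realType}.

(** The Euclidean square distance. The norm of row vectors is the maximum norm, whose square is not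
    smooth and cannot serve in a cutoff. *)
Definition sqdist n (x y : 'rV[R]_n) : R := \sum_i (y 0 i - x 0 i) * (y 0 i - x 0 i).

Lemma smooth_sqdist n (x y : 'rV[R]_n) : smooth_at (sqdist x) y.
Proof.
apply: smooth_sum => i _; have s : smooth_at (fun z : 'rV[R]_n => z 0 i - x 0 i) y.
  by apply: smoothB; [exact: smooth_coord|exact: smooth_cstR].
exact: smoothM.
Qed.

Lemma sqdist_norm n (x y : 'rV[R]_n) r :
  0 <= r -> sqdist x y <= r ^+ 2 -> `|y - x| <= r.
Proof.
move=> r0 H; apply: row_norm_le => // i; rewrite !mxE.
rewrite -(ler_pXn2r (_ : 0 < 2)%N) ?nnegrE// real_normK ?num_real//.
apply: le_trans H; rewrite /sqdist (bigD1 i)//= -expr2 lerDl.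
by apply: sumr_ge0 => j _; rewrite -expr2 sqr_ge0.
Qed.

Lemma sqdist_self n (x : 'rV[R]_n) : sqdist x x = 0.
Proof. by apply: big1 => i _; rewrite subrr mul0r. Qed.

Lemma sqdist_ge0 n (x y : 'rV[R]_n) : 0 <= sqdist x y.
Proof. by apply: sumr_ge0 => i _; rewrite -expr2 sqr_ge0. Qed.

Lemma half_le_sub (a q : R) : q < a / 2 -> a / 2 <= a - q.
Proof. lra. Qed.

Lemma gradient_from_energy (r t D C K S q e : R) :
  0 < r -> r ^+ 2 / 2 <= t -> 0 <= q -> 0 <= e ->
  t * t * q + K * e <= (C + K) * S ^+ 2 -> 0 <= K -> 0 <= C -> 0 <= S ->
  D ^+ 2 <= q -> `|D| <= Num.sqrt ((C + K) / (r ^+ 2 / 2) ^+ 2) * S.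
Proof.
move=> r0 tr q0 e0 H K0 C0 S0 Dq.
have h0 : 0 < r ^+ 2 / 2 by rewrite divr_gt0// exprn_gt0.
have Z0 : 0 <= (C + K) / (r ^+ 2 / 2) ^+ 2.
  by apply: divr_ge0; [exact: addr_ge0|exact: sqr_ge0].
rewrite -(ler_pXn2r (_ : 0 < 2)%N) ?nnegrE ?mulr_ge0 ?sqrtr_ge0//.
rewrite real_normK ?num_real// exprMn sqr_sqrtr// mulrAC ler_pdivlMr; last first.
  exact: exprn_gt0.
apply: le_trans H; apply: (@le_trans _ _ (t * t * q)); last first.
  by rewrite lerDl mulr_ge0.
rewrite mulrC ler_pM ?sqr_ge0// -expr2 ler_pXn2r// nnegrE ltW//.
exact: lt_le_trans tr.
Qed.

Lemma energy_le (rho2 q C K S e : R) :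
  0 <= rho2 <= 1 -> 0 <= C -> 0 <= K -> 0 <= q -> q <= C * e -> e <= S ^+ 2 ->
  rho2 * q + K * e <= (C + K) * S ^+ 2.
Proof.
move=> /andP[r0 r1] C0 K0 q0 qe eS; rewrite mulrDl lerD//; last exact: ler_wpM2l.
apply: (@le_trans _ _ q); first exact: ler_piMl.
by apply: (le_trans qe); exact: ler_wpM2l.
Qed.

(* Bernstein's method: the function (r^2 - |y - x|^2)^2 |grad f|^2 + K f^2 has an
   interior maximum or is bounded by K f^2. *)
Lemma gradient_bound n (a : 'I_n -> 'I_n -> 'rV[R]_n -> R)
    (b : 'I_n -> 'rV[R]_n -> R) (mu th : R) x (U : set 'rV[R]_n) :
  (forall i j, smooth_at (a i j) x) -> (forall i, smooth_at (b i) x) ->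
  0 < th -> nbhs x U ->
  (\forall y \near x, posdef (\matrix_(i, j) a i j y)) ->
  (\forall y \near x, forall v : 'I_n -> R,
     th * (\sum_i v i ^+ 2) <= \sum_i \sum_j a i j y * (v i * v j)) ->
  exists2 C : R, 0 <= C & \forall y \near x,
  forall (f : 'rV[R]_n -> R) (S : R),
  (forall z, U z -> smooth_at f z /\ elliptic_op a b f z = - mu * f z) ->
  (forall z, U z -> `|f z| <= S) ->
  forall k, `|'D_(base k) f y| <= C * S.
Proof.
move=> sa sb th0 nU pda ell.
have [Ba Ba0 nBa] := near_bound (fun ij : 'I_n * 'I_n => sa ij.1 ij.2).
have [Bda Bda0 nBda] := near_bound (fun kij : 'I_n * 'I_n * 'I_n =>
  smooth_derive (base kij.1.1) (sa kij.1.2 kij.2)).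
have [Bb Bb0 nBb] := near_bound sb.
have [Bdb Bdb0 nBdb] := near_bound (fun ki : 'I_n * 'I_n =>
  smooth_derive (base ki.1) (sb ki.2)).
have [Br Br0 nBr] := near_bound (fun i : 'I_n =>
  smooth_derive (base i) (smooth_sqdist x x)).
have [Brr Brr0 nBrr] := near_bound (fun ij : 'I_n * 'I_n =>
  smooth_derive (base ij.1) (smooth_derive (base ij.2) (smooth_sqdist x x))).
have nBrho := near_and nBr nBrr.
(* One bound for all coefficients; the summand 1 dominates the cutoff, which is at most
   [r ^+ 2 <= 1]. *)
pose B := Ba + Bda + Bb + Bdb + Br + Brr + `|mu| + 1.
have B0 : 0 <= B by rewrite !addr_ge0.
have [K K0 [C C0 HKC]] := bernstein_algebra n th0 B0.
have nsa : \forall y \near x, forall i j, smooth_at (a i j) y.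
  by apply: near_forall => i; apply: near_forall => j; exact: smooth_at_nbhs.
have nsb : \forall y \near x, forall i, smooth_at (b i) y.
  by apply: near_forall => i; exact: smooth_at_nbhs.
have := near_and (near_and (near_and pda ell) nU) (near_and (near_and nsa nsb)
  (near_and (near_and nBa nBda) (near_and (near_and nBb nBdb) nBrho))).
move=> /nbhs_normP[d /= d0 Hd].
(* [d / 2] keeps the closed ball inside the neighbourhood where all bounds hold. *)
pose r := Num.min (d / 2) 1.
have r0 : 0 < r by rewrite lt_min divr_gt0//= ltr01.
have rd : r < d.
  by rewrite (@le_lt_trans _ _ (d / 2))// ?ge_min ?lexx// ltr_pdivrMr// ltr_pMr// ltr1n.
have r_le1 : r <= 1 by rewrite /r ge_min lexx orbT.
have r1 : r ^+ 2 <= 1 by rewrite exprn_ile1// ltW.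
(* The test function is at most (C + K) S^2 on the ball, and its cutoff is at least [r ^+ 2 / 2]
   near [x]. Constant and neighbourhood are fixed before [f] and [S]: this uniformity is what a
   covering argument can use. *)
exists (Num.sqrt ((C + K) / (r ^+ 2 / 2) ^+ 2)); first exact: sqrtr_ge0.
have nq : \forall y \near x, sqdist x y < r ^+ 2 / 2.
  have := smooth_cont (smooth_sqdist x x).
  move=> /cvgrPdist_lt /(_ (r ^+ 2 / 2)); rewrite divr_gt0 ?exprn_gt0// => /(_ isT).
  by apply: near_impl => y; rewrite sqdist_self sub0r normrN ger0_norm ?sqdist_ge0.
apply: near_impl nq => y qy f S HfU HSU k.
have dU z : `|z - x| < d -> U z by rewrite distrC => /Hd[[_ Uz] _].
have Hf z zd := HfU z (dU z zd).
have HS z zd := HSU z (dU z zd).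
have S0 : 0 <= S by apply: le_trans (HS x _); rewrite // subrr normr0.
pose rho z := r ^+ 2 - sqdist x z.
pose q z := \sum_k 'D_(base k) f z * 'D_(base k) f z.
pose w z := rho z * rho z * q z + K * (f z * f z).
pose D : set 'rV[R]_n := [set z | 0 <= rho z].
have DB z : D z -> `|z - x| < d.
  rewrite /D /= /rho subr_ge0 => /(sqdist_norm (ltW r0)) H.
  exact: le_lt_trans H rd.
have q0 z : 0 <= q z by apply: sumr_ge0 => i _; rewrite -expr2 sqr_ge0.
have srho z : smooth_at rho z.
  by apply: smoothB; [exact: smooth_cstR|exact: smooth_sqdist].
have sq z : smooth_at f z -> smooth_at q z.
  by move=> sf; apply: smooth_sum => i _; apply: smoothM; exact: smooth_derive.
have sw z : smooth_at f z -> smooth_at w z.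
  by move=> sf; apply: smooth_cutoff_energy => //; exact: sq.
have rho_le z : rho z <= r ^+ 2 by rewrite /rho lerBlDr lerDl sqdist_ge0.
have Dx : D x by rewrite /D /= /rho sqdist_self subr0 ltW// exprn_gt0.
have Dcompact : compact D.
  apply: bounded_closed_compact.
    exists (`|x| + r); split; first exact: num_real.
    move=> M HM z Dz; have Hz : `|z - x| <= r.
      by apply: sqdist_norm; [exact: ltW|rewrite -subr_ge0].
    apply: le_trans (ltW HM); rewrite -(subrK x z) addrC.
    by rewrite (le_trans (ler_normD _ _))// lerD2l.
  have -> : D = rho @^-1` [set t : R | 0 <= t] by [].
  apply: closed_comp; last exact: closed_ge.
  by move=> z _; exact/smooth_cont/srho.
have wc : {within D, continuous w}.
  apply: continuous_in_subspaceT => z; rewrite inE => Dz.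
  by apply/smooth_cont/sw; exact: (Hf z (DB z Dz)).1.
have [c cD cmax] := EVT_max_rV (ex_intro _ x Dx) Dcompact wc.
rewrite inE in cD.
have fS z : `|z - x| < d -> f z * f z <= S ^+ 2.
  move=> zd; rewrite -expr2 -[f z ^+ 2]real_normK ?num_real//.
  by rewrite ler_pXn2r ?nnegrE// HS.
have [sf pdec] := Hf c (DB c cD).
have rho2 z : 0 <= rho z -> 0 <= rho z * rho z <= 1.
  move=> rz; rewrite mulr_ge0//= mulr_ile1//; exact: le_trans (rho_le z) r1.
have wS : w c <= (C + K) * S ^+ 2.
  have [rc0|rcpos] := leP (rho c) 0.
    have -> : w c = 0 * 0 + K * (f c * f c).
      rewrite /w; have -> : rho c = 0 by apply/eqP; rewrite eq_le rc0 cD.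
      by rewrite !mul0r.
    apply: energy_le => //; first by rewrite lexx ler01.
      by rewrite mulr_ge0// -expr2 sqr_ge0.
    exact: fS (DB c cD).
  apply: energy_le => //; [exact: rho2|idtac|exact: fS (DB c cD)].
  have npos : \forall z \near c, 0 < rho z.
    have := smooth_cont (srho c) => /cvgrPdist_lt /(_ _ rcpos).
    by apply: near_impl => z; rewrite ltr_distlC subrr => /andP[].
  have nmax : \forall z \near c, w z <= w c.
    by apply: near_impl npos => z /ltW Dz; apply: cmax; rewrite inE.
  have npde : \forall z \near c, elliptic_op a b f z = - mu * f z.
    by apply: near_impl npos => z /ltW Dz; exact: (Hf z (DB z Dz)).2.
  have cx : `|x - c| < d by rewrite distrC; exact: DB.
  have [[[pdc ellc] _] [[sac sbc] [[Bac Bdac] [[Bbc Bdbc] [Brc Brrc]]]]] := Hd c cx.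
  have B1 : Ba <= B by rewrite /B -!addrA lerDl !addr_ge0.
  have B2 : Bda <= B by rewrite /B [Ba + _]addrC -!addrA lerDl !addr_ge0.
  have B3 : Bb <= B by rewrite /B [_ + Bb]addrC -!addrA lerDl !addr_ge0.
  have B4 : Bdb <= B by rewrite /B [_ + Bdb]addrC -!addrA lerDl !addr_ge0.
  have B5 : Br <= B by rewrite /B [_ + Br]addrC -!addrA lerDl !addr_ge0.
  have B6 : Brr <= B by rewrite /B [_ + Brr]addrC -!addrA lerDl !addr_ge0.
  have B7 : `|mu| <= B by rewrite /B [_ + `|mu|]addrC -!addrA lerDl !addr_ge0.
  have B8 : 1 <= B by rewrite /B lerDr !addr_ge0.
  have Drho i z : 'D_(base i) rho z = - 'D_(base i) (sqdist x) z.
    apply: etrans (sderiveB _ (smooth_cstR (r ^+ 2) z) (smooth_sqdist x z)) _.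
    by rewrite [X in X - _]derive_cst sub0r.
  have DDrho i j : 'D_(base i) ('D_(base j) rho) c =
      - 'D_(base i) ('D_(base j) (sqdist x)) c.
    apply: etrans (sderiveN _ (smooth_derive _ (smooth_sqdist x c))).
    by apply: near_eq_derive; apply: near_all => z; exact: Drho.
  have -> : q c = \sum_l 'D_(base l) f c ^+ 2 by apply: eq_bigr => l _; rewrite expr2.
  rewrite -expr2.
  apply: (HKC (fun i j => a i j c) (fun k i j => 'D_(base k) (a i j) c)
    (fun i => b i c) (fun k i => 'D_(base k) (b i) c) mu (rho c)
    (fun i => 'D_(base i) rho c) (fun i j => 'D_(base i) ('D_(base j) rho) c)
    (f c) (fun k => 'D_(base k) f c) (fun i k => 'D_(base i) ('D_(base k) f) c)
    (fun i j k => 'D_(base i) ('D_(base j) ('D_(base k) f)) c)) => //.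
  - by move=> i j; apply: le_trans B1; exact: (Bac (i, j)).
  - by move=> l i j; apply: le_trans B2; exact: (Bdac (l, i, j)).
  - by move=> i; apply: le_trans B3; exact: Bbc.
  - by move=> l i; apply: le_trans B4; exact: (Bdbc (l, i)).
  - by rewrite ltW//= (le_trans (rho_le c))// (le_trans r1).
  - by move=> i; rewrite Drho normrN; apply: le_trans B5; exact: Brc.
  - by move=> i j; rewrite DDrho normrN; apply: le_trans B6; exact: (Brrc (i, j)).
  - by move=> l; exact: derive_pde.
  have sq' := sq c sf.
  have sD l : smooth_at ('D_(base l) f) c by exact: smooth_derive.
  have := elliptic_at_max pdc (sw c sf) nmax.
  apply: le_trans; rewrite le_eqVlt; apply/orP; left; apply/eqP.
  apply: eq_bigr => i _; apply: eq_bigr => j _; rewrite mxE; congr (_ * _).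
  apply/esym; apply: etrans (derive2_cutoff_energy K _ _ (srho c) sq' sf) _.
  by rewrite !(derive_sumsq _ sD) (derive2_sumsq _ _ sD).
have yd : D y.
  by apply: le_trans (half_le_sub qy); rewrite ltW// divr_gt0// exprn_gt0.
apply: (gradient_from_energy (t := rho y) (q := q y) (e := f y * f y)) => //.
- exact: half_le_sub.
- by rewrite -expr2 sqr_ge0.
- by apply: le_trans wS; apply: cmax; rewrite inE.
by rewrite /q (bigD1 k)//= expr2 lerDl; apply: sumr_ge0 => i _; rewrite -expr2 sqr_ge0.
Qed.

End GradientBound.

(** * Charts and Gram matrices *)

Lemma open_near_top (T : topologicalType) (U : set T) x :
  open U -> U x -> \forall y \near x, U y.
Proof. by move=> oU Ux; exact: open_nbhs_nbhs. Qed.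

(** The local conditions on an atlas, in a form that passes directly to products;
    [prod_smooth_atlas] provides it for N x H. *)
Definition smooth_atlas (R : realType) (T : topologicalType) (n : nat)
    (A : atlas R T n) : Prop :=
  (forall p, is_chart (A p) /\ chart_dom (A p) p) /\
  forall p q, smooth_on
    (chart_fun (A p) @` (chart_dom (A p) `&` chart_dom (A q)))
    (chart_fun (A q) \o chart_inv (A p)).

Lemma manifold_smooth_atlas (R : realType) (T : topologicalType) (n : nat)
  (A : atlas R T n) : is_manifold A -> smooth_atlas A.
Proof. by case. Qed.

Section Charts.
Context {R : realType} {T : topologicalType} {n : nat} (A : atlas R T n).
Hypothesis hA : smooth_atlas A.

Lemma chart_is p : is_chart (A p). Proof. by have [/(_ p)[]] := hA. Qed.

Lemma chart_dom_self p : chart_dom (A p) p.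
Proof. by have [/(_ p)[]] := hA. Qed.

Lemma chart_img_self p : chart_img (A p) (chart_fun (A p) p).
Proof. by exists p => //; exact: chart_dom_self. Qed.

Lemma chart_funK p y : chart_dom (A p) y -> chart_inv (A p) (chart_fun (A p) y) = y.
Proof. by have [_ _ cK _ _] := chart_is p; exact: cK. Qed.

Lemma chart_inv_self p : chart_inv (A p) (chart_fun (A p) p) = p.
Proof. exact/chart_funK/chart_dom_self. Qed.

Lemma chart_inv_dom p x : chart_img (A p) x -> chart_dom (A p) (chart_inv (A p) x).
Proof. by move=> [y yd <-]; rewrite chart_funK. Qed.

Lemma chart_invK p x : chart_img (A p) x -> chart_fun (A p) (chart_inv (A p) x) = x.
Proof. by move=> [y yd <-]; rewrite chart_funK. Qed.

Lemma chart_img_near p x : chart_img (A p) x -> \forall y \near x, chart_img (A p) y.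
Proof. by have [_ oi _ _ _] := chart_is p; exact: open_near. Qed.

Lemma chart_dom_near p y : chart_dom (A p) y -> \forall z \near y, chart_dom (A p) z.
Proof. by have [od _ _ _ _] := chart_is p; exact: open_near_top. Qed.

Lemma chart_inv_cont p x : chart_img (A p) x -> {for x, continuous (chart_inv (A p))}.
Proof. by have [_ _ _ _ cc] := chart_is p; exact: cc. Qed.

Lemma chart_fun_cont p y : chart_dom (A p) y -> {for y, continuous (chart_fun (A p))}.
Proof. by have [_ _ _ cc _] := chart_is p; exact: cc. Qed.

Lemma chart_inv_near p x (P : T -> Prop) : chart_img (A p) x ->
  (\forall y \near chart_inv (A p) x, P y) -> \forall z \near x, P (chart_inv (A p) z).
Proof. by move=> /chart_inv_cont; apply. Qed.

Lemma chart_dom_inv_near p q x : chart_img (A p) x ->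
  chart_dom (A q) (chart_inv (A p) x) ->
  \forall z \near x, chart_dom (A q) (chart_inv (A p) z).
Proof. by move=> xi d; apply: chart_inv_near => //; exact: chart_dom_near. Qed.

Lemma chart_fun_image_open p (O : set T) : open O ->
  open (chart_fun (A p) @` (chart_dom (A p) `&` O)).
Proof.
move=> oO; rewrite openE => _ [y [yd Oy] <-]; rewrite /interior.
have xi : chart_img (A p) (chart_fun (A p) y) by exists y.
have nO : \forall z \near chart_inv (A p) (chart_fun (A p) y), O z.
  by rewrite chart_funK//; exact: open_near_top.
apply: near_impl (near_and (chart_img_near xi) (chart_inv_near xi nO)).
move=> z [zi Oz]; exists (chart_inv (A p) z); last exact: chart_invK.
by split=> //; exact: chart_inv_dom.
Qed.

End Charts.

Section SmoothMaps.
Context {R : realType} {T S : topologicalType} {n m : nat}.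
Context (A : atlas R T n) (B : atlas R S m).
Hypothesis (hA : smooth_atlas A) (hB : smooth_atlas B).
Implicit Types f : T -> S.

Definition local_rep f p q := chart_fun (B q) \o f \o chart_inv (A p).

Lemma smooth_map_rep f p q x : smooth_map A B f -> chart_img (A p) x ->
  chart_dom (B q) (f (chart_inv (A p) x)) -> smooth_at (local_rep f p q) x.
Proof.
move=> [fc sf] xi xd.
apply: (smooth_on_at _ _ (sf p q)).
  apply: chart_fun_image_open => //; apply: open_comp => [y _|]; first exact: fc.
  by have [] := chart_is hB q.
exists (chart_inv (A p) x); last by rewrite (chart_invK hA).
by split=> //; exact: chart_inv_dom.
Qed.

Lemma smooth_map_chart_near f p q x : smooth_map A B f -> chart_img (A p) x ->
  chart_dom (B q) (f (chart_inv (A p) x)) ->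
  \forall z \near x, chart_dom (B q) (f (chart_inv (A p) z)).
Proof.
move=> [fc _] xi xd; apply: (chart_inv_near hA xi (P := fun y => chart_dom (B q) (f y))).
exact/fc/(chart_dom_near hB).
Qed.

End SmoothMaps.

Lemma quad_form (R : realType) n (M : 'M[R]_n) (v w : 'rV[R]_n) :
  (v *m M *m w^T) 0 0 = \sum_i v 0 i * \sum_j M i j * w 0 j.
Proof.
rewrite -mulmxA mxE; apply: eq_bigr => i _; congr (_ * _); rewrite mxE.
by apply: eq_bigr => j _; rewrite mxE.
Qed.

Section Transition.
Context {R : realType} {T : topologicalType} {n : nat} (A : atlas R T n).
Hypothesis hA : smooth_atlas A.

Lemma smooth_map_id : smooth_map A A id.
Proof.
split=> [x|p q]; first exact: cvg_id.
by have [_ /(_ p q)] := hA.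
Qed.

Lemma smooth_trans p q x : chart_img (A p) x ->
  chart_dom (A q) (chart_inv (A p) x) ->
  smooth_at (chart_fun (A q) \o chart_inv (A p)) x.
Proof. exact: (smooth_map_rep hA hA smooth_map_id). Qed.

Lemma coord_vec_self p v : coord_vec A p (chart_fun (A p) p) v = v.
Proof.
rewrite /coord_vec (chart_inv_self hA) -[RHS](derive_id (chart_fun (A p) p)).
apply: near_eq_derive; apply: near_impl (chart_img_near hA (chart_img_self hA p)).
by move=> z; exact: chart_invK.
Qed.

Lemma coord_vec_linear p x a v w : chart_img (A p) x ->
  coord_vec A p x (a *: v + w) = a *: coord_vec A p x v + coord_vec A p x w.
Proof.
move=> xi; apply: smooth_derive_linear; apply: smooth_trans => //.
exact: chart_dom_self.
Qed.

Lemma mdiff_id p v : mdiff A A id p v = v.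
Proof. by rewrite -[RHS](coord_vec_self p) /coord_vec (chart_inv_self hA). Qed.

Section Gram.
Variable g : form2 R T n.
Hypothesis hg : is_metric A g.

Lemma local_form_gram p x v w : chart_img (A p) x ->
  local_form2 A g p v w x = (v *m gram A g p x *m w^T) 0 0.
Proof.
move=> xi; have [glin gsym _ _] := hg.
have lin1 a u1 u2 u : local_form2 A g p (a *: u1 + u2) u x =
    a * local_form2 A g p u1 u x + local_form2 A g p u2 u x.
  rewrite /local_form2 (coord_vec_linear _ _ _ xi).
  move: (coord_vec A p x u1) (coord_vec A p x u2) (coord_vec A p x u) => c1 c2 c.
  by rewrite gsym glin (gsym _ c) (gsym _ c).
have sym u1 u2 : local_form2 A g p u1 u2 x = local_form2 A g p u2 u1 x.
  exact: gsym.
have lin0 u : local_form2 A g p 0 u x = 0.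
  by have := lin1 1 0 0 u; rewrite scale1r addr0 mul1r => /eqP;
    rewrite -subr_eq0 opprD addrA subrr sub0r oppr_eq0 => /eqP.
have expand u1 u2 : local_form2 A g p u1 u2 x =
    \sum_i u1 0 i * local_form2 A g p (base i) u2 x.
  rewrite {1}(row_sum_delta u1).
  elim/big_rec2: _ => [|i a b _ IH]; first exact: lin0.
  by rewrite lin1 IH.
rewrite quad_form expand; apply: eq_bigr => i _; rewrite sym expand.
by congr (_ * _); apply: eq_bigr => j _; rewrite mxE sym mulrC.
Qed.

Lemma gram_sym p x : (gram A g p x)^T = gram A g p x.
Proof.
have [_ gsym _ _] := hg.
by apply/matrixP => i j; rewrite !mxE; exact: gsym.
Qed.

(** A coordinate vector that represents the zero tangent vector is zero, since the change of charts
    to the chart selected at the point has a smooth inverse. *)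
Lemma gram_posdef p x : chart_img (A p) x -> posdef (gram A g p x).
Proof.
move=> xi; split=> [|v v0]; first exact: gram_sym.
rewrite -local_form_gram//; have [_ _ gpos _] := hg; apply: gpos.
apply: contra_neq v0 => cv0.
have sid := smooth_map_id.
set q := chart_inv (A p) x in cv0.
have qp : chart_dom (A p) q by exact: chart_inv_dom.
have st := smooth_trans xi (chart_dom_self hA q).
have tx : (chart_fun (A q) \o chart_inv (A p)) x = chart_fun (A q) q by [].
have sb : smooth_at (chart_fun (A p) \o chart_inv (A q)) (chart_fun (A q) q).
  by apply: smooth_trans; rewrite ?(chart_inv_self hA)//; exact: chart_img_self.
have E := derive_comp v st sb.
have D0 : 'D_v (chart_fun (A q) \o chart_inv (A p)) x = 0 := cv0.
rewrite D0 derive0 in E.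
apply: etrans (esym (derive_id x v)) _; apply: etrans _ E; apply: near_eq_derive.
have nq := chart_dom_inv_near hA xi (chart_dom_self hA q).
apply: near_impl (near_and nq (chart_img_near hA xi)) => z [zq zi] /=.
by apply: esym; rewrite (chart_funK hA)// (chart_invK hA).
Qed.

Lemma gram_smooth p x : chart_img (A p) x -> smooth_at (gram A g p) x.
Proof.
move=> xi; apply/smooth_mx => i j; have [_ _ _ gs] := hg.
apply: (smooth_at_eq _ (smooth_on_at _ xi (gs p (base i) (base j)))).
  by apply: near_all => y; rewrite mxE.
by have [_ oi _ _ _] := chart_is hA p.
Qed.

End Gram.

End Transition.

(** * The Laplacian on a manifold *)

Section PosDef.
Context {R : realType}.

(** Gaussian elimination of the first column by the unipotent matrix [P] gives det M = a det S with
    [a] positive and [S] the positive definite Schur complement. *)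
Lemma posdef_det_gt0 n (A : 'M[R]_n) : posdef A -> 0 < \det A.
Proof.
elim: n A => [|n IH] A pA; first by rewrite det_mx00 ltr01.
suff H (M : 'M[R]_(1 + n)) : posdef M -> 0 < \det M by exact: (H A).
move=> {A pA} [sA pA].
pose a := M 0 0; pose b : 'rV_n := ursubmx M; pose D : 'M_n := drsubmx M.
have ul : ulsubmx M = a%:M by rewrite [LHS]mx11_scalar !mxE !lshift0.
have EA : M = block_mx a%:M b b^T D.
  by rewrite -{1}(submxK M) ul; congr block_mx; rewrite /b trmx_ursub sA.
have sD : D^T = D by rewrite /D trmx_drsub sA.
have a0 : 0 < a.
  have := pA (row_mx 1%:M 0); rewrite EA mul_row_block tr_row_mx.
  rewrite !mul1mx !mul0mx !addr0 mul_row_col trmx1 mulmx1 trmx0 mulmx0 addr0.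
  rewrite mxE eqxx; apply; apply/eqP => /(congr1 lsubmx).
  by rewrite row_mxKl linear0 => /matrixP/(_ 0 0); rewrite !mxE => /eqP; rewrite oner_eq0.
pose P : 'M[R]_(1 + n) := block_mx 1%:M 0 (- a^-1 *: b^T) 1%:M.
pose S := D - a^-1 *: (b^T *m b).
have EP : P *m M = block_mx a%:M b 0 S.
  rewrite EA mulmx_block !mul1mx !mul0mx !addr0 -!scalemxAl; congr block_mx.
    by rewrite mul_mx_scalar scalerA mulNr mulVf ?gt_eqF// scaleN1r addNr.
  by rewrite /S addrC scaleNr.
have dP : \det P = 1 by rewrite /P det_lblock !det1 mulr1.
have -> : \det M = a * \det S.
  by rewrite -[LHS]mul1r -dP -det_mulmx EP det_ublock det_scalar1.
rewrite mulr_gt0//; apply: IH; split=> [|v v0].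
  by rewrite /S linearB /= linearZ /= trmx_mul trmxK sD.
pose t : 'rV[R]_1 := - a^-1 *: (v *m b^T).
have := pA (row_mx t v).
have -> : row_mx t v *m M = row_mx 0 (v *m S).
  rewrite EA mul_row_block; congr row_mx.
    by rewrite mul_mx_scalar scalerA mulrN mulfV ?gt_eqF// scaleN1r addNr.
  by rewrite /S mulmxBr -scalemxAl scaleNr addrC -scalemxAr mulmxA.
rewrite tr_row_mx mul_row_col mul0mx add0r; apply; apply/eqP => /(congr1 rsubmx).
by rewrite row_mxKr linear0; apply/eqP.
Qed.

Lemma posdef_unit n (A : 'M[R]_n) : posdef A -> A \in unitmx.
Proof. by move=> /posdef_det_gt0/det_gt0_unit. Qed.

Lemma posdef_inv n (A : 'M[R]_n) : posdef A -> posdef (invmx A).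
Proof.
move=> pA; have uA := posdef_unit pA; have [sA ppA] := pA; split.
  by rewrite trmx_inv sA.
move=> v v0; have := ppA (v *m invmx A); rewrite mulmxKV// trmx_mul trmx_inv sA.
rewrite mulmxA; apply; apply: contra_neq v0 => H.
by rewrite -(mulmxKV uA v) H mul0mx.
Qed.

Lemma row_normsq n (v : 'rV[R]_n) : (v *m v^T) 0 0 = \sum_i v 0 i ^+ 2.
Proof. by rewrite mxE; apply: eq_bigr => i _; rewrite mxE expr2. Qed.

Lemma quad_le n (G : 'M[R]_n) (v : 'rV[R]_n) M :
  (forall ij : 'I_n * 'I_n, `|G ij.1 ij.2| <= M) ->
  (v *m G *m v^T) 0 0 <= n%:R * (n%:R * M) * \sum_i v 0 i ^+ 2.
Proof.
move=> HG; rewrite quad_delta -!mulrA; apply: le_trans (ler_norm _) _.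
apply: norm_sum_ord_le => i; apply: norm_sum_ord_le => j; rewrite mulrC.
apply: le_normM; first exact: (HG (i, j)).
rewrite -(@sqr_sqrtr _ (\sum_i v 0 i ^+ 2)); last first.
  by apply: sumr_ge0 => l _; exact: sqr_ge0.
by rewrite expr2; apply: le_normM; exact: norm_le_sqrt_sum.
Qed.

(* Expand the nonnegative value of G at u - t v with u = v G^-1 and t = 1/C. *)
Lemma posdef_inv_elliptic n (G : 'M[R]_n) (C : R) : posdef G -> 0 < C ->
  (forall v : 'rV[R]_n, (v *m G *m v^T) 0 0 <= C * \sum_i v 0 i ^+ 2) ->
  forall v : 'rV[R]_n,
    C^-1 * (\sum_i v 0 i ^+ 2) <= (v *m invmx G *m v^T) 0 0.
Proof.
move=> pG C0 HC v; have uG := posdef_unit pG; have [sG ppG] := pG.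
pose u := v *m invmx G; pose w := u - C^-1 *: v.
have w0 : 0 <= (w *m G *m w^T) 0 0.
  have [->|w0] := eqVneq w 0; first by rewrite !mul0mx mxE.
  exact/ltW/ppG.
have uGK : u *m G = v by rewrite /u mulmxKV.
have GuK : G *m u^T = v^T by rewrite /u trmx_mul trmx_inv sG mulKVmx.
have Ew : w *m G *m w^T = v *m u^T - C^-1 *: (v *m v^T) -
    (C^-1 *: (v *m v^T) - C^-1 *: (C^-1 *: (v *m G *m v^T))).
  rewrite /w mulmxBl uGK -scalemxAl [(u - _)^T]linearB /= [(_ *: v)^T]linearZ /=.
  rewrite mulmxBl !mulmxBr -!scalemxAl -!scalemxAr -(mulmxA v G u^T) GuK.
  by rewrite [C^-1 *: (v *m G *m _)]scalemxAl.
have vu : (v *m u^T) 0 0 = (v *m invmx G *m v^T) 0 0.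
  by rewrite /u trmx_mul trmx_inv sG mulmxA.
move: w0 (HC v); rewrite Ew -vu.
have vv := row_normsq v.
move: (v *m u^T) (v *m v^T) (v *m G *m v^T) vv => m1 m2 m3 vv.
rewrite !mxE vv; move: (m1 0 0) (m3 0 0) (\sum_i _) => x z s.
have c0 : 0 < C^-1 by rewrite invr_gt0.
move=> H1 H2; have : C^-1 * (C^-1 * z) <= C^-1 * s.
  by rewrite ler_pM2l// ler_pdivrMl.
by move: H1; move: (C^-1 * s) (C^-1 * (C^-1 * z)) => *; lra.
Qed.

End PosDef.

(** * The Laplacian in non-divergence form *)

Section LapLocal.
Context {R : realType}.

Lemma near_nbhs (T : topologicalType) (x : T) (P : T -> Prop) :
  (\forall y \near x, P y) -> \forall y \near x, \forall z \near y, P z.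
Proof.
move=> /near_open[W [oW Wx sW]].
have nW := open_near_top oW Wx; apply: near_impl nW => y Wy.
exact: near_impl sW (open_near_top oW Wy).
Qed.

Lemma lap_near n (G : 'rV[R]_n -> 'M[R]_n) (f g : 'rV[R]_n -> R) x :
  (\forall y \near x, f y = g y) -> lap G f x = lap G g x.
Proof.
move=> fg; rewrite /lap; apply: (congr1 -%R); apply: divg_near.
apply: near_impl (near_nbhs fg) => y nfg; apply/rowP => i; rewrite !mxE.
apply: eq_bigr => j _; congr (_ * _); exact: near_eq_derive.
Qed.

Lemma smooth_dlogdet n (G : 'rV[R]_n -> 'M[R]_n) x v :
  smooth_at G x -> G x \in unitmx -> smooth_at (fun y => dlogdet G y v) x.
Proof.
move=> sG uG; apply: smooth_sum => i _; apply: smooth_entry.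
apply: smooth_mulmx; last exact: smooth_derive.
by apply: smooth_invmx => //; exact: near_unit.
Qed.

(** The coefficient of the [j]-th partial derivative when the divergence form is expanded:
    derivatives of the inverse metric, plus the inverse metric applied to the logarithmic derivative
    of the density. *)
Definition lap_drift n (G : 'rV[R]_n -> 'M[R]_n) (j : 'I_n) (y : 'rV[R]_n) : R :=
  \sum_i ('D_(base i) (fun z => invmx (G z) i j) y +
          invmx (G y) i j * (dlogdet G y (base i) / 2)).

Lemma lap_nondiv n (G : 'rV[R]_n -> 'M[R]_n) (f : 'rV[R]_n -> R) y :
  smooth_at G y -> 0 < \det (G y) -> smooth_at f y ->
  lap G f y = - elliptic_op (fun i j z => invmx (G z) i j) (lap_drift G) f y.
Proof.
move=> sG d0 sf; have uG := det_gt0_unit d0.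
have sI i j : smooth_at (fun z => invmx (G z) i j) y.
  by apply: smooth_entry; apply: smooth_invmx => //; exact: near_unit.
have sgr := smooth_gradm sG uG sf.
rewrite /lap (divgE sG d0 sgr) /elliptic_op; apply: (congr1 -%R).
have -> : \tr (jac (gradm G f) y) =
    \sum_i \sum_j invmx (G y) i j * 'D_(base i) ('D_(base j) f) y +
    \sum_i \sum_j 'D_(base i) (fun z => invmx (G z) i j) y * 'D_(base j) f y.
  rewrite -big_split; apply: eq_bigr => i _ /=.
  rewrite mxE (derive_entry _ _ _ sgr); under eq_fun do rewrite mxE.
  have sM j : smooth_at (fun z => invmx (G z) i j * 'D_(base j) f z) y.
    by apply: smoothM => //; exact: smooth_derive.
  rewrite (sderive_sum _ _ _ sM) -big_split; apply: eq_bigr => j _ /=.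
  exact: (sderiveM _ (sI i j) (smooth_derive _ sf)).
rewrite -addrA; congr (_ + _); rewrite exchange_big /=.
have -> : \sum_i gradm G f y 0 i * (dlogdet G y (base i) / 2) =
    \sum_j \sum_i invmx (G y) i j * (dlogdet G y (base i) / 2) * 'D_(base j) f y.
  rewrite exchange_big; apply: eq_bigr => i _ /=; rewrite mxE mulr_suml.
  by apply: eq_bigr => j _; rewrite mulrAC.
rewrite -big_split; apply: eq_bigr => j _ /=; rewrite /lap_drift mulr_suml -big_split.
by apply: eq_bigr => i _ /=; rewrite -mulrDl.
Qed.

Lemma smooth_lap_drift n (G : 'rV[R]_n -> 'M[R]_n) j y :
  smooth_at G y -> G y \in unitmx -> smooth_at (lap_drift G j) y.
Proof.
move=> sG uG; have sI i : smooth_at (fun z => invmx (G z) i j) y.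
  by apply: smooth_entry; apply: smooth_invmx => //; exact: near_unit.
apply: smooth_sum => i _; apply: smoothD; first exact: smooth_derive.
apply: smoothM => //; apply: smoothM; last exact: smooth_cstR.
exact: smooth_dlogdet.
Qed.

End LapLocal.

(** * Naturality of the Laplacian under isometries *)

Section Push.
Context {R : realType} {T S : topologicalType} {n m : nat}.
Context (A : atlas R T n) (B : atlas R S m).
Hypothesis (hA : smooth_atlas A) (hB : smooth_atlas B).
Variable f : T -> S.
Hypothesis sf : smooth_map A B f.

(** Both sides are the derivative of [f] read from the chart [A p] into the chart selected at the
    image point: the left by the chain rule through [B q], the right by the chain rule through the
    chart selected at the source point. *)
Lemma coord_vec_push p q x v : chart_img (A p) x ->
  chart_dom (B q) (f (chart_inv (A p) x)) ->
  coord_vec B q (local_rep A B f p q x) ('D_v (local_rep A B f p q) x) =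
  mdiff A B f (chart_inv (A p) x) (coord_vec A p x v).
Proof.
move=> xi yd; set y := chart_inv (A p) x.
have yi : chart_dom (A p) y by exact: chart_inv_dom.
have zi : chart_img (B q) (local_rep A B f p q x) by exists (f y).
have Kz : chart_inv (B q) (local_rep A B f p q x) = f y by exact: chart_funK.
transitivity ('D_v (local_rep A B f p (f y)) x).
  rewrite /coord_vec Kz.
  have s1 := smooth_map_rep hA hB sf xi yd.
  have s2 : smooth_at (chart_fun (B (f y)) \o chart_inv (B q)) (local_rep A B f p q x).
    by apply: smooth_trans => //; rewrite Kz; exact: chart_dom_self.
  apply: etrans (esym (derive_comp v s1 s2)) _; apply: near_eq_derive.
  apply: near_impl (smooth_map_chart_near hA hB sf xi yd) => z zd.
  by rewrite /local_rep /= (chart_funK hB).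
have yy := chart_img_self hA y.
have iy := chart_inv_self hA y.
have s1 := smooth_trans hA xi (chart_dom_self hA y).
have s2 : smooth_at (local_rep A B f y (f y)) (chart_fun (A y) y).
  by apply: smooth_map_rep => //; rewrite iy; exact: chart_dom_self.
apply: etrans (derive_comp v s1 s2); apply: near_eq_derive.
apply: near_impl (chart_dom_inv_near hA xi (chart_dom_self hA y)) => z zd.
by rewrite /local_rep /= (chart_funK hA).
Qed.

End Push.

Section Pullback.
Context {R : realType} {T S : topologicalType} {n : nat}.
Context (A : atlas R T n) (B : atlas R S n).
Hypothesis (hA : smooth_atlas A) (hB : smooth_atlas B).
Context (g : form2 R T n) (g' : form2 R S n).
Hypothesis (hg : is_metric A g) (hg' : is_metric B g').
Variable f : T -> S.
Hypothesis sf : smooth_map A B f.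
Hypothesis iso : forall y v w,
  g' (f y) (mdiff A B f y v) (mdiff A B f y w) = g y v w.

Lemma gram_pullback p q x : chart_img (A p) x ->
  chart_dom (B q) (f (chart_inv (A p) x)) ->
  gram A g p x = jac (local_rep A B f p q) x *m
    gram B g' q (local_rep A B f p q x) *m (jac (local_rep A B f p q) x)^T.
Proof.
move=> xi yd; have s1 := smooth_map_rep hA hB sf xi yd.
have zi : chart_img (B q) (local_rep A B f p q x) by exists (f (chart_inv (A p) x)).
have Kz : chart_inv (B q) (local_rep A B f p q x) = f (chart_inv (A p) x).
  exact: chart_funK.
apply/matrixP => i j; rewrite [LHS]mxE /local_form2 -iso.
have Pi := coord_vec_push hA hB sf (base i) xi yd.
have Pj := coord_vec_push hA hB sf (base j) xi yd.
rewrite -Pi -Pj -Kz.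
have := local_form_gram hB hg' ('D_(base i) (local_rep A B f p q) x)
  ('D_(base j) (local_rep A B f p q) x) zi.
rewrite {1}/local_form2 => ->; rewrite !(derive_jac _ s1) trmx_mul !mulmxA.
move: (gram _ _ _ _) (jac _ _) => G J.
have -> : base i *m J *m G *m J^T *m (base j)^T =
    base i *m (J *m G *m J^T) *m delta_mx j 0 by rewrite trmx_delta !mulmxA.
by rewrite -rowE -colE [LHS]mxE [LHS]mxE.
Qed.

(** In charts the isometry becomes a congruence of Gram matrices by the Jacobian matrix, so
    [lap_natural] applies. The point [x] ranges over the whole chart, not only over its base
    point. *)
Lemma lap_pullback p x (u : S -> R) : smooth_fun B u -> chart_img (A p) x ->
  lap (gram A g p) (u \o f \o chart_inv (A p)) x =
  laplacian B g' u (f (chart_inv (A p) x)).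
Proof.
move=> su xi; set q := f (chart_inv (A p) x).
have qd : chart_dom (B q) q by exact: chart_dom_self.
have qi : chart_img (B q) (chart_fun (B q) q) by exact: chart_img_self.
rewrite laplacian_lap.
have s1 := smooth_map_rep hA hB sf xi qd.
have nd := smooth_map_chart_near hA hB sf xi qd.
have sG := gram_smooth hA hg xi; have sG' := gram_smooth hB hg' qi.
have d0 := posdef_det_gt0 (gram_posdef hA hg xi).
have d0' := posdef_det_gt0 (gram_posdef hB hg' qi).
have sub : smooth_at (u \o chart_inv (B q)) (chart_fun (B q) q).
  apply: (smooth_on_at _ qi (su q)).
  by have [_ oi _ _ _] := chart_is hB q.
apply: etrans _ (lap_natural s1 sG sG' d0 d0' _ sub).
  apply: lap_near; apply: near_impl nd => z zd.
  by rewrite /local_rep /= (chart_funK hB).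
apply: near_impl (near_and (chart_img_near hA xi) nd) => z [zi zd].
exact: gram_pullback.
Qed.

End Pullback.

Section Eigen.
Context {R : realType} {T : topologicalType} {n : nat} (A : atlas R T n).
Hypothesis hA : smooth_atlas A.
Variable g : form2 R T n.
Hypothesis hg : is_metric A g.

Lemma smooth_fun_at f p x : smooth_fun A f -> chart_img (A p) x ->
  smooth_at (f \o chart_inv (A p)) x.
Proof.
move=> sf xi; apply: (smooth_on_at _ xi (sf p)).
by have [_ oi _ _ _] := chart_is hA p.
Qed.

(** [laplacian] is defined at each point by the chart selected there. The identity is an isometry,
    so any single chart computes it throughout its image; a differential equation can thus be
    studied on an open set of coordinates. *)
Lemma lap_chart p x (u : T -> R) : smooth_fun A u -> chart_img (A p) x ->
  lap (gram A g p) (u \o chart_inv (A p)) x = laplacian A g u (chart_inv (A p) x).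
Proof.
move=> su xi; apply: (lap_pullback hA hA hg hg (smooth_map_id hA)) su xi => y v w.
by rewrite !(mdiff_id hA).
Qed.

Lemma lap_sum (G : 'rV[R]_n -> 'M[R]_n) (I : finType) (c : I -> R)
    (F : I -> 'rV[R]_n -> R) y :
  smooth_at G y -> 0 < \det (G y) -> (forall i, smooth_at (F i) y) ->
  lap G (fun z => \sum_i c i * F i z) y = \sum_i c i * lap G (F i) y.
Proof.
move=> sG d0 sF.
have sS : smooth_at (fun z => \sum_i c i * F i z) y.
  by apply: smooth_sum => i _; apply: smoothM => //; exact: smooth_cstR.
have D v z : (forall i, smooth_at (F i) z) ->
    'D_v (fun z => \sum_i c i * F i z) z = \sum_i c i * 'D_v (F i) z.
  move=> sz; rewrite sderive_sum => [|i]; last first.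
    by apply: smoothM => //; exact: smooth_cstR.
  by apply: eq_bigr => i _; exact: sderiveMc.
have nF : \forall z \near y, forall i, smooth_at (F i) z.
  by apply: near_forall => i; exact: smooth_at_nbhs.
have DD v w : 'D_w ('D_v (fun z => \sum_i c i * F i z)) y =
    \sum_i c i * 'D_w ('D_v (F i)) y.
  have E : \near y, 'D_v (fun z => \sum_i c i * F i z) y = \sum_i c i * 'D_v (F i) y.
    by apply: near_impl nF => z; exact: D.
  rewrite (near_eq_derive _ E) sderive_sum => [|i]; last first.
    by apply: smoothM; [exact: smooth_cstR|exact: smooth_derive].
  by apply: eq_bigr => i _; apply: sderiveMc; exact: smooth_derive.
rewrite (lap_nondiv sG d0 sS) /elliptic_op.
transitivity (\sum_i - (c i *
    elliptic_op (fun i j z => invmx (G z) i j) (lap_drift G) (F i) y)); last first.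
  by apply: eq_bigr => i _; rewrite (lap_nondiv sG d0 (sF i)) mulrN.
rewrite sumrN; apply: (congr1 -%R); rewrite /elliptic_op.
under [RHS]eq_bigr do rewrite mulrDr; rewrite big_split /=; congr (_ + _).
  under [RHS]eq_bigr do rewrite mulr_sumr; rewrite [RHS]exchange_big; apply: eq_bigr => i _ /=.
  under [RHS]eq_bigr do rewrite mulr_sumr; rewrite [RHS]exchange_big; apply: eq_bigr => j _ /=.
  by rewrite DD mulr_sumr; apply: eq_bigr => l _; rewrite mulrCA.
under [RHS]eq_bigr do rewrite mulr_sumr; rewrite [RHS]exchange_big; apply: eq_bigr => i _ /=.
by rewrite (D _ _ sF) mulr_sumr; apply: eq_bigr => l _; rewrite mulrCA.
Qed.

Lemma smooth_fun_sum (I : finType) (c : I -> R) (e : I -> T -> R) :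
  (forall i, smooth_fun A (e i)) -> smooth_fun A (fun x => \sum_i c i * e i x).
Proof.
move=> se p; apply: smooth_at_on => x xi; apply: smooth_sum => i _.
by apply: smoothM; [exact: smooth_cstR|exact: smooth_fun_at].
Qed.

Lemma eigenfunction_sum mu (I : finType) (c : I -> R) (e : I -> T -> R) :
  (forall i, eigenfunction A g mu (e i)) ->
  eigenfunction A g mu (fun x => \sum_i c i * e i x).
Proof.
move=> he; split=> [|p]; first by apply: smooth_fun_sum => i; exact: (he i).1.
have pi := chart_img_self hA p.
rewrite laplacian_lap.
rewrite (@lap_sum _ _ c (fun i => e i \o chart_inv (A p))).
- rewrite mulr_sumr; apply: eq_bigr => i _.
  by rewrite -laplacian_lap (he i).2 mulrCA.
- exact: gram_smooth.
- exact/posdef_det_gt0/gram_posdef.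
- by move=> i; apply: smooth_fun_at => //; exact: (he i).1.
Qed.

End Eigen.

(** * Finite dimension of the eigenspaces *)

Section FiniteDim.
Context {R : realType}.

Lemma near_inv_elliptic n (G : 'rV[R]_n -> 'M[R]_n) x :
  smooth_at G x -> (\forall y \near x, posdef (G y)) ->
  exists2 th : R, 0 < th & \forall y \near x, forall v : 'I_n -> R,
    th * (\sum_i v i ^+ 2) <= \sum_i \sum_j invmx (G y) i j * (v i * v j).
Proof.
move=> sG pG.
have [M M0 nM] := near_bound (fun ij : 'I_n * 'I_n => smooth_entry ij.1 ij.2 sG).
pose C : R := n%:R * (n%:R * M) + 1.
have C0 : 0 < C by rewrite ltr_wpDl// !mulr_ge0.
exists C^-1; first by rewrite invr_gt0.
apply: near_impl (near_and pG nM) => y [py HM] v.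
have HC (w : 'rV[R]_n) : (w *m G y *m w^T) 0 0 <= C * \sum_i w 0 i ^+ 2.
  apply: le_trans (quad_le w HM) _; rewrite ler_wpM2r ?lerDl//.
  by apply: sumr_ge0 => i _; exact: sqr_ge0.
have := posdef_inv_elliptic py C0 HC (\row_i v i); rewrite quad_delta.
under eq_bigr do rewrite mxE.
move=> /le_trans; apply; rewrite le_eqVlt; apply/orP; left; apply/eqP.
by apply: eq_bigr => i _; apply: eq_bigr => j _; rewrite !mxE mulrC.
Qed.

Lemma lipschitz_of_gradient n (f : 'rV[R]_n -> R) x v (M : R) :
  (forall t : R, 0 <= t <= 1 -> smooth_at f (t *: v + x)) ->
  (forall t : R, 0 <= t <= 1 -> forall k, `|'D_(base k) f (t *: v + x)| <= M) ->
  `|f (v + x) - f x| <= n%:R * (`|v| * M).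
Proof.
move=> sf HM.
have [t t01 ->] := mvt_line (fun t t01 => smooth_derivable v (sf t t01)).
rewrite (derive_coord _ (smooth_differentiable (sf t t01))).
apply: norm_sum_ord_le => k; apply: le_normM; first exact: le_row_norm.
exact: HM.
Qed.

Context {T : topologicalType} {n : nat} (A : atlas R T n).
Hypothesis hA : smooth_atlas A.
Variable g : form2 R T n.
Hypothesis hg : is_metric A g.

(** The gradient of [f] is at most a fixed multiple of [S], so [f] can grow to at most [S / 2] along
    a short segment from its zero [p]. The neighbourhood is the same for all eigenfunctions of
    eigenvalue [mu]. *)
Lemma local_oscillation (mu : R) p : \forall y \near p, forall f S,
  eigenfunction A g mu f -> (forall q, `|f q| <= S) -> f p = 0 -> `|f y| <= S / 2.
Proof.
pose x := chart_fun (A p) p; pose G := gram A g p.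
have xi : chart_img (A p) x by exact: chart_img_self.
have nx := chart_img_near hA xi.
have sG : smooth_at G x by exact: gram_smooth.
have pG : \forall y \near x, posdef (G y).
  by apply: near_impl nx => y yi; exact: gram_posdef.
have [th th0 nell] := near_inv_elliptic sG pG.
have uG : \forall y \near x, G y \in unitmx.
  by apply: near_impl pG => y; exact: posdef_unit.
have sI i j : smooth_at (fun z => invmx (G z) i j) x.
  by apply: smooth_entry; exact: smooth_invmx.
have sb j : smooth_at (lap_drift G j) x.
  by apply: smooth_lap_drift => //; exact: nbhs_singleton uG.
have pI : \forall y \near x, posdef (\matrix_(i, j) invmx (G y) i j).
  apply: near_impl pG => y py; have -> : \matrix_(i, j) invmx (G y) i j = invmx (G y).
    by apply/matrixP => i j; rewrite mxE.
  exact: posdef_inv.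
have [C C0 nC] := gradient_bound mu sI sb th0 nx pI nell.
have := near_and nC nx => /nbhs_normP[d /= d0 Hd].
have nd : \forall y \near p, n%:R * (`|chart_fun (A p) y - x| * C) <= 1 / 2 /\
    `|chart_fun (A p) y - x| < d.
  have cf := chart_fun_cont hA (chart_dom_self hA p).
  (* Ensures n |v| C <= 1/2 for the displacement v; the summand 1 keeps the denominator positive
     when n C = 0. *)
  pose e := Num.min d (1 / (2 * (n%:R * C + 1))).
  have D0 : 0 < n%:R * C + 1 by rewrite ltr_wpDl// mulr_ge0.
  have e0 : 0 < e by rewrite lt_min d0 divr_gt0// mulr_gt0.
  have := cf => /cvgrPdist_lt /(_ e e0); apply: near_impl => y.
  rewrite distrC lt_min => /andP[yd ye]; split=> //.
  rewrite mulrCA mulrC; apply: (@le_trans _ _ ((n%:R * C + 1) * `|chart_fun (A p) y - x|)).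
    by rewrite ler_wpM2r// lerDl.
  by move: ye; rewrite ltr_pdivlMr ?mulr_gt0// => /ltW ye;
    rewrite ler_pdivlMr// mulrC mulrA (mulrC _ `|_|).
have ndom := chart_dom_near hA (chart_dom_self hA p).
apply: near_impl (near_and nd ndom) => y [[ye yd] ydom] f S [sf ef] HS fp0.
pose F := f \o chart_inv (A p).
have Fy : F (chart_fun (A p) y) = f y by rewrite /F /= (chart_funK hA).
have Fx : F x = 0 by rewrite /F /= (chart_inv_self hA).
have S0 : 0 <= S by exact: le_trans (HS p).
have HU z : chart_img (A p) z ->
    smooth_at F z /\ elliptic_op (fun i j z => invmx (G z) i j) (lap_drift G) F z = - mu * F z.
  move=> zi; have sFz : smooth_at F z by exact: smooth_fun_at.
  split=> //; rewrite -[LHS]opprK -lap_nondiv//; last 2 first.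
  - exact: gram_smooth.
  - exact/posdef_det_gt0/gram_posdef.
  by rewrite (lap_chart hA hg sf zi) ef mulNr.
have HSF z : chart_img (A p) z -> `|F z| <= S by move=> _; exact: HS.
pose v := chart_fun (A p) y - x.
have seg (t : R) : 0 <= t <= 1 -> `|t *: v + x - x| < d.
  move=> /andP[t0 t1]; rewrite addrK normrZ ger0_norm//.
  by rewrite (le_lt_trans _ yd)// ler_piMl.
have Hgrad (t : R) : 0 <= t <= 1 -> forall k, `|'D_(base k) F (t *: v + x)| <= C * S.
  move=> t01 k; apply: ((Hd _ _).1 F S HU HSF); rewrite /= distrC; exact: seg.
have Hsm (t : R) : 0 <= t <= 1 -> smooth_at F (t *: v + x).
  move=> t01; apply: smooth_fun_at => //; apply: (Hd _ _).2.
  by rewrite /= distrC; exact: seg.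
have := lipschitz_of_gradient Hsm Hgrad.
rewrite /v subrK Fx Fy subr0 => /le_trans; apply.
rewrite (mulrA _ C) mulrA mulrC ler_wpM2l//; move: ye; rewrite mul1r.
exact.
Qed.

Lemma smooth_fun_continuous f : smooth_fun A f -> continuous f.
Proof.
move=> sf p; have pd := chart_dom_self hA p.
have sF := smooth_fun_at hA sf (chart_img_self hA p).
have c : {for p, continuous ((f \o chart_inv (A p)) \o chart_fun (A p))}.
  by apply: continuous_comp; [exact: chart_fun_cont|exact: smooth_cont].
apply: near_eq_continuous_at c.
by apply: near_impl (chart_dom_near hA pd) => y yd /=; rewrite (chart_funK hA).
Qed.

(** Compactness is used as a near covering property, for the filter of finite sequences that contain
    a given list; at each point the list made of that point suffices. *)
Lemma compact_finite_near (P : T -> T -> Prop) : compact [set: T] ->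
  (forall p, \forall y \near p, P p y) ->
  exists s : seq T, forall y, exists2 p, p \in s & P p y.
Proof.
move=> cT nP.
pose F : set_system (seq T) :=
  fun Q => exists s0 : seq T, forall s : seq T, {subset s0 <= s} -> Q s.
have FF : Filter F.
  split.
  - by exists [::].
  - move=> Q Q' [s Hs] [s' Hs']; exists (s ++ s') => t st; split.
      by apply: Hs => z zs; apply: st; rewrite mem_cat zs.
    by apply: Hs' => z zs; apply: st; rewrite mem_cat zs orbT.
  - by move=> Q Q' QQ' [s Hs]; exists s => t /Hs/QQ'.
have [|s Hs] := (compact_near_coveringP [set: T]).1 cT _ F
  (fun s y => exists2 p, p \in s & P p y) FF.
  move=> p _; exists ([set y | P p y], [set s : seq T | p \in s]).
    split; first exact: nP.
    by exists [:: p] => s; apply; rewrite inE.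
  by move=> [y s] /= [Py ps]; exists p.
by exists s => y; exact: (Hs s (fun _ => id)).
Qed.

(** Taken at a maximum of |f| with [S] equal to that maximum, [local_oscillation] gives S <= S /
    2. *)
Lemma eigenfunction_determined (mu : R) : compact [set: T] ->
  exists s : seq T, forall f, eigenfunction A g mu f ->
    (forall p, p \in s -> f p = 0) -> forall q, f q = 0.
Proof.
move=> cT; have [s Hs] := compact_finite_near cT (local_oscillation mu).
exists s => f ef fs q.
have cf := smooth_fun_continuous ef.1.
have cn : {within [set: T], continuous (fun y => `|f y|)}.
  apply: continuous_subspaceT => y; apply: (@continuous_comp _ _ _ f Num.norm).
    exact: cf.
  exact: norm_continuous.
have [c _ cmax] := compact_EVT_max (ex_intro _ q I) cT cn.
have HS y : `|f y| <= `|f c| by apply: cmax; rewrite inE.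
have [p ps /(_ f _ ef HS (fs p ps)) H] := Hs c.
have c0 : `|f c| <= 0 by move: H; rewrite ler_pdivlMr//; lra.
by apply/eqP; rewrite -normr_le0 (le_trans (HS q)).
Qed.

(** More functions than points in the determining set [s] have a nontrivial combination that
    vanishes on [s]; it is an eigenfunction, hence zero everywhere. *)
Lemma lin_indep_eigen_bound (mu : R) : compact [set: T] ->
  exists M : nat, forall m (e : 'I_m -> T -> R),
    (forall i, eigenfunction A g mu (e i)) -> lin_indep e -> (m <= M)%N.
Proof.
move=> cT; have [s Hs] := eigenfunction_determined mu cT.
exists (size s) => m e he ie; rewrite leqNgt; apply/negP => ms.
pose E : 'M[R]_(m, size s) := \matrix_(i, j) e i (tnth (in_tuple s) j).
have : kermx E != 0.
  rewrite kermx_eq0 /row_free; apply: contraTneq (rank_leq_col E) => ->.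
  by rewrite -ltnNge.
move=> /rowV0Pn[c /sub_kermxP cE c0].
have := eigenfunction_sum hA hg (fun i => c 0 i) he => hc.
have c00 i : c 0 i = 0.
  move: i; apply: ie; apply: (Hs _ hc) => p ps.
  have [j ->] := seq_tnthP ps.
  have := congr1 (fun M : 'M_(1, size s) => M 0 j) cE; rewrite !mxE /= => cE0.
  by apply: etrans cE0; apply: eq_bigr => i _; rewrite mxE.
by move/negP: c0; apply; apply/eqP/rowP => i; rewrite c00 mxE.
Qed.

End FiniteDim.

(** * Smooth maps and products *)

Section Blocks.
Context {R : realType} {k : nat}.
Implicit Types x v : 'rV[R]_k.

Lemma smooth_row_mx n m (f : 'rV[R]_k -> 'rV[R]_n) (g : 'rV[R]_k -> 'rV[R]_m) x :
  smooth_at f x -> smooth_at g x -> smooth_at (fun y => row_mx (f y) (g y)) x.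
Proof.
move=> sf sg; apply/smooth_mx => i j; case: (splitP j) => l jl.
  have -> : j = lshift m l by exact: val_inj.
  apply: smooth_at_eq (smooth_entry i l sf); apply: near_all => y.
  by rewrite row_mxEl.
have -> : j = rshift n l by exact: val_inj.
apply: smooth_at_eq (smooth_entry i l sg); apply: near_all => y.
by rewrite row_mxEr.
Qed.

Lemma derive_row_mx n m (f : 'rV[R]_k -> 'rV[R]_n) (g : 'rV[R]_k -> 'rV[R]_m) x v :
  smooth_at f x -> smooth_at g x ->
  'D_v (fun y => row_mx (f y) (g y)) x = row_mx ('D_v f x) ('D_v g x).
Proof.
move=> sf sg; have s := smooth_row_mx sf sg; apply/rowP => j.
rewrite (derive_entry _ _ _ s); case: (splitP j) => l jl.
  have -> : j = lshift m l by exact: val_inj.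
  rewrite row_mxEl (derive_entry _ _ _ sf); apply: near_eq_derive.
  by apply: near_all => y; rewrite row_mxEl.
have -> : j = rshift n l by exact: val_inj.
rewrite row_mxEr (derive_entry _ _ _ sg); apply: near_eq_derive.
by apply: near_all => y; rewrite row_mxEr.
Qed.

End Blocks.

Section BlocksProj.
Context {R : realType} {n m : nat}.
Implicit Types x v : 'rV[R]_(n + m).

Lemma smooth_lsubmx x : smooth_at (lsubmx : 'rV[R]_(n + m) -> 'rV[R]_n) x.
Proof. exact: (smooth_linear (lsubmx : {linear 'rV[R]_(n + m) -> 'rV[R]_n})). Qed.

Lemma smooth_rsubmx x : smooth_at (rsubmx : 'rV[R]_(n + m) -> 'rV[R]_m) x.
Proof. exact: (smooth_linear (rsubmx : {linear 'rV[R]_(n + m) -> 'rV[R]_m})). Qed.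

Lemma derive_comp_lsubmx p (f : 'rV[R]_n -> 'rV[R]_p) x v :
  smooth_at f (lsubmx x) -> 'D_v (fun y => f (lsubmx y)) x = 'D_(lsubmx v) f (lsubmx x).
Proof.
move=> sf; apply: etrans (derive_comp v (smooth_lsubmx x) sf) _.
congr (derive _ _ _).
exact: (derive_linfun (lsubmx : {linear 'rV[R]_(n + m) -> 'rV[R]_n})).
Qed.

Lemma derive_comp_rsubmx p (f : 'rV[R]_m -> 'rV[R]_p) x v :
  smooth_at f (rsubmx x) -> 'D_v (fun y => f (rsubmx y)) x = 'D_(rsubmx v) f (rsubmx x).
Proof.
move=> sf; apply: etrans (derive_comp v (smooth_rsubmx x) sf) _.
congr (derive _ _ _).
exact: (derive_linfun (rsubmx : {linear 'rV[R]_(n + m) -> 'rV[R]_m})).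
Qed.

End BlocksProj.

Section Prod.
Context {R : realType} {T S : topologicalType} {n m : nat}.
Context (A : atlas R T n) (B : atlas R S m).
Hypothesis (hA : smooth_atlas A) (hB : smooth_atlas B).

Lemma prod_chart_img p x : chart_img (prod_atlas A B p) x <->
  chart_img (A p.1) (lsubmx x) /\ chart_img (B p.2) (rsubmx x).
Proof.
split=> [[y /= [d1 d2] <-]|[[y1 d1 E1] [y2 d2 E2]]].
  by rewrite row_mxKl row_mxKr; split; [exists y.1|exists y.2].
by exists (y1, y2) => //=; rewrite E1 E2 hsubmxK.
Qed.

Lemma smooth_prod_trans p q x : chart_img (prod_atlas A B p) x ->
  chart_dom (prod_atlas A B q) (chart_inv (prod_atlas A B p) x) ->
  smooth_at (chart_fun (prod_atlas A B q) \o chart_inv (prod_atlas A B p)) x.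
Proof.
move=> /prod_chart_img[i1 i2] [/= d1 d2]; apply: smooth_row_mx.
  exact: (smooth_comp (smooth_lsubmx x) (smooth_trans hA i1 d1)).
exact: (smooth_comp (smooth_rsubmx x) (smooth_trans hB i2 d2)).
Qed.

Lemma prod_smooth_atlas : smooth_atlas (prod_atlas A B).
Proof.
split=> [p|p q]; last first.
  apply: smooth_at_on => _ [y [yp yq] <-]; apply: smooth_prod_trans.
    by exists y.
  by case: yp => y1 y2 /=; rewrite row_mxKl row_mxKr !chart_funK.
split; last by split; exact: chart_dom_self.
have [op1 i1 _ _ _] := chart_is hA p.1; have [op2 i2 _ _ _] := chart_is hB p.2.
split.
- have -> : chart_dom (prod_atlas A B p) =
    fst @^-1` chart_dom (A p.1) `&` snd @^-1` chart_dom (B p.2) by [].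
  apply: openI; apply: open_comp => // y _; [exact: cvg_fst|exact: cvg_snd].
- rewrite openE => x /prod_chart_img[x1 x2]; rewrite /interior.
  have n1 : \forall y \near x, chart_img (A p.1) (lsubmx y).
    by have := smooth_cont (smooth_lsubmx x); apply; exact: chart_img_near.
  have n2 : \forall y \near x, chart_img (B p.2) (rsubmx y).
    by have := smooth_cont (smooth_rsubmx x); apply; exact: chart_img_near.
  by apply: near_impl (near_and n1 n2) => y; rewrite -prod_chart_img.
- by move=> [x1 x2] [/= d1 d2]; rewrite row_mxKl row_mxKr !chart_funK.
- move=> x [d1 d2]; apply/continuous_at_mx => i j /=.
  case: (splitP j) => l jl.
    have -> : j = lshift m l by exact: val_inj.
    rewrite (_ : (fun y : T * S => _) =
      (fun y : T * S => chart_fun (A p.1) y.1 i l)); last first.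
      by apply/funext => y; rewrite row_mxEl.
    apply: ((continuous_at_mx (fun y : T * S => chart_fun (A p.1) y.1) x).1 _).
    apply: (@continuous_comp _ _ _ fst); first exact: cvg_fst.
    exact: chart_fun_cont.
  have -> : j = rshift n l by exact: val_inj.
  rewrite (_ : (fun y : T * S => _) =
    (fun y : T * S => chart_fun (B p.2) y.2 i l)); last first.
    by apply/funext => y; rewrite row_mxEr.
  apply: ((continuous_at_mx (fun y : T * S => chart_fun (B p.2) y.2) x).1 _).
  apply: (@continuous_comp _ _ _ snd); first exact: cvg_snd.
  exact: chart_fun_cont.
- move=> x /prod_chart_img[x1 x2].
  have c1 := @continuous_comp _ _ _ (lsubmx : 'rV[R]_(n + m) -> 'rV[R]_n)
    (chart_inv (A p.1)) x (smooth_cont (smooth_lsubmx x)) (chart_inv_cont hA x1).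
  have c2 := @continuous_comp _ _ _ (rsubmx : 'rV[R]_(n + m) -> 'rV[R]_m)
    (chart_inv (B p.2)) x (smooth_cont (smooth_rsubmx x)) (chart_inv_cont hB x2).
  exact: (cvg_pair c1 c2).
Qed.

Lemma prod_coord_vec p x v : chart_img (prod_atlas A B p) x ->
  coord_vec (prod_atlas A B) p x v =
  row_mx (coord_vec A p.1 (lsubmx x) (lsubmx v)) (coord_vec B p.2 (rsubmx x) (rsubmx v)).
Proof.
move=> /prod_chart_img[i1 i2].
have s1 := smooth_trans hA i1 (chart_dom_self hA _).
have s2 := smooth_trans hB i2 (chart_dom_self hB _).
apply: etrans (derive_row_mx v (smooth_comp (smooth_lsubmx x) s1)
  (smooth_comp (smooth_rsubmx x) s2)) _.
exact: (congr2 _ (derive_comp_lsubmx v s1) (derive_comp_rsubmx v s2)).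
Qed.

End Prod.

Section MapCalculus.
Context {R : realType}.

Lemma smooth_mapI (T S : topologicalType) n m (A : atlas R T n) (B : atlas R S m)
    (f : T -> S) : smooth_atlas A -> continuous f ->
  (forall p q x, chart_img (A p) x -> chart_dom (B q) (f (chart_inv (A p) x)) ->
     smooth_at (local_rep A B f p q) x) -> smooth_map A B f.
Proof.
move=> hA cf H; split=> // p q; apply: smooth_at_on => _ [y [yp yq] <-].
by apply: H; [exists y|rewrite (chart_funK hA)].
Qed.

Section Comp.
Context {T S Q : topologicalType} {n m l : nat}.
Context (A : atlas R T n) (B : atlas R S m) (C : atlas R Q l).
Hypothesis (hA : smooth_atlas A) (hB : smooth_atlas B) (hC : smooth_atlas C).
Context (f : T -> S) (g : S -> Q).
Hypothesis (sf : smooth_map A B f) (sg : smooth_map B C g).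

Lemma local_rep_comp p q r x : chart_img (A p) x ->
  chart_dom (B q) (f (chart_inv (A p) x)) ->
  \forall y \near x, (local_rep B C g q r \o local_rep A B f p q) y =
    local_rep A C (g \o f) p r y.
Proof.
move=> xi xd; apply: near_impl (smooth_map_chart_near hA hB sf xi xd) => y yd.
by rewrite /local_rep /= (chart_funK hB).
Qed.

Lemma smooth_map_comp : smooth_map A C (g \o f).
Proof.
apply: smooth_mapI => // [y|p r x xi zd].
  by apply: continuous_comp; [exact: sf.1|exact: sg.1].
set y := f (chart_inv (A p) x).
have yd := chart_dom_self hB y.
apply: smooth_at_eq (local_rep_comp r xi yd) _.
apply: smooth_comp; first exact: smooth_map_rep.
apply: smooth_map_rep => //; first exact: chart_img_self.
by rewrite (chart_inv_self hB).
Qed.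

Lemma mdiff_comp p v : mdiff A C (g \o f) p v = mdiff B C g (f p) (mdiff A B f p v).
Proof.
have pi := chart_img_self hA p; have ip := chart_inv_self hA p.
have yd : chart_dom (B (f p)) (f (chart_inv (A p) (chart_fun (A p) p))).
  by rewrite ip; exact: chart_dom_self.
rewrite /mdiff; rewrite -(near_eq_derive v (local_rep_comp (g (f p)) pi yd)).
have s1 := smooth_map_rep hA hB sf pi yd.
have E : local_rep A B f p (f p) (chart_fun (A p) p) = chart_fun (B (f p)) (f p).
  by rewrite /local_rep /= ip.
have s2 : smooth_at (local_rep B C g (f p) (g (f p)))
    (local_rep A B f p (f p) (chart_fun (A p) p)).
  rewrite E; apply: smooth_map_rep => //; first exact: chart_img_self.
  by rewrite (chart_inv_self hB); exact: chart_dom_self.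
by apply: etrans (derive_comp v s1 s2) _; rewrite E.
Qed.

End Comp.

Section Pair.
Context {T S Q : topologicalType} {n m l : nat}.
Context (A : atlas R T n) (B : atlas R S m) (C : atlas R Q l).
Hypothesis (hA : smooth_atlas A) (hB : smooth_atlas B) (hC : smooth_atlas C).

Lemma smooth_map_cst (c : S) : smooth_map A B (fun _ => c).
Proof.
apply: smooth_mapI => // [y|p q x _ _]; first exact: cst_continuous.
exact: (smooth_cst (chart_fun (B q) c)).
Qed.

Lemma mdiff_cst (c : S) p v : mdiff A B (fun _ => c) p v = 0.
Proof. exact: derive_cst. Qed.

Lemma mdiff_linear (f : T -> S) p a v w : smooth_map A B f ->
  mdiff A B f p (a *: v + w) = a *: mdiff A B f p v + mdiff A B f p w.
Proof.
move=> sf; apply: smooth_derive_linear; apply: smooth_map_rep => //.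
  exact: chart_img_self.
by rewrite (chart_inv_self hA); exact: chart_dom_self.
Qed.

Context (f : T -> S) (g : T -> Q).
Hypothesis (sf : smooth_map A B f) (sg : smooth_map A C g).

Lemma smooth_map_pair : smooth_map A (prod_atlas B C) (fun y => (f y, g y)).
Proof.
apply: smooth_mapI => // [y|p [q r] x xi [/= d1 d2]].
  by apply: cvg_pair; [exact: sf.1|exact: sg.1].
apply: smooth_row_mx; first exact: (smooth_map_rep hA hB sf xi d1).
exact: (smooth_map_rep hA hC sg xi d2).
Qed.

Lemma mdiff_pair p v : mdiff A (prod_atlas B C) (fun y => (f y, g y)) p v =
  row_mx (mdiff A B f p v) (mdiff A C g p v).
Proof.
have pi := chart_img_self hA p; have ip := chart_inv_self hA p.
apply: derive_row_mx.
  by apply: (smooth_map_rep hA hB sf); rewrite ?ip//; exact: chart_dom_self.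
by apply: (smooth_map_rep hA hC sg); rewrite ?ip//; exact: chart_dom_self.
Qed.

End Pair.

Section Proj.
Context {S Q : topologicalType} {m l : nat}.
Context (B : atlas R S m) (C : atlas R Q l).
Hypothesis (hB : smooth_atlas B) (hC : smooth_atlas C).

Let hP := prod_smooth_atlas hB hC.

Lemma smooth_map_fst : smooth_map (prod_atlas B C) B fst.
Proof.
apply: smooth_mapI => // [y|p q x /prod_chart_img[i1 i2] d]; first exact: cvg_fst.
exact: (smooth_comp (smooth_lsubmx x) (smooth_trans hB i1 d)).
Qed.

Lemma smooth_map_snd : smooth_map (prod_atlas B C) C snd.
Proof.
apply: smooth_mapI => // [y|p q x /prod_chart_img[i1 i2] d]; first exact: cvg_snd.
exact: (smooth_comp (smooth_rsubmx x) (smooth_trans hC i2 d)).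
Qed.

Lemma mdiff_fst p v : mdiff (prod_atlas B C) B fst p v = lsubmx v.
Proof.
rewrite -[RHS](coord_vec_self hB p.1) /coord_vec (chart_inv_self hB).
have s : smooth_at (chart_fun (B p.1) \o chart_inv (B p.1))
    (lsubmx (chart_fun (prod_atlas B C p) p)).
  rewrite row_mxKl; apply: smooth_trans; rewrite ?(chart_inv_self hB)//.
    exact: chart_img_self.
  exact: chart_dom_self.
by apply: etrans (derive_comp_lsubmx _ s) _; rewrite row_mxKl.
Qed.

Lemma mdiff_snd p v : mdiff (prod_atlas B C) C snd p v = rsubmx v.
Proof.
rewrite -[RHS](coord_vec_self hC p.2) /coord_vec (chart_inv_self hC).
have s : smooth_at (chart_fun (C p.2) \o chart_inv (C p.2))
    (rsubmx (chart_fun (prod_atlas B C p) p)).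
  rewrite row_mxKr; apply: smooth_trans; rewrite ?(chart_inv_self hC)//.
    exact: chart_img_self.
  exact: chart_dom_self.
by apply: etrans (derive_comp_rsubmx _ s) _; rewrite row_mxKr.
Qed.

End Proj.

End MapCalculus.

(** * Invariant metrics on abelian Lie groups *)

Section AbelianLieGroup.
Context {R : realType} {H : topologicalZmodType} {k : nat} (B : atlas R H k).
Hypothesis hB : smooth_atlas B.
Hypothesis sadd : smooth_map (prod_atlas B B) B (fun z : H * H => z.1 + z.2).
Hypothesis sopp : smooth_map B B (fun z : H => - z).

Let hBB := prod_smooth_atlas hB hB.

Lemma smooth_mapD (T : topologicalType) n (A : atlas R T n) (f g : T -> H) :
  smooth_atlas A -> smooth_map A B f -> smooth_map A B g ->
  smooth_map A B (fun y => f y + g y).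
Proof.
move=> hA sf sg.
exact: (smooth_map_comp hA hBB hB (smooth_map_pair hA hB hB sf sg) sadd).
Qed.

Lemma mdiffD (T : topologicalType) n (A : atlas R T n) (f g : T -> H) p v :
  smooth_atlas A -> smooth_map A B f -> smooth_map A B g ->
  mdiff A B (fun y => f y + g y) p v =
  mdiff (prod_atlas B B) B (fun z : H * H => z.1 + z.2) (f p, g p)
    (row_mx (mdiff A B f p v) (mdiff A B g p v)).
Proof.
move=> hA sf sg.
have sp := smooth_map_pair hA hB hB sf sg.
have E := mdiff_comp hA hBB hB sp sadd p v.
by rewrite (mdiff_pair hA hB hB sf sg) in E.
Qed.

Lemma smooth_mapN (T : topologicalType) n (A : atlas R T n) (f : T -> H) :
  smooth_atlas A -> smooth_map A B f -> smooth_map A B (fun y => - f y).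
Proof. by move=> hA sf; exact: (smooth_map_comp hA hB hB sf sopp). Qed.

Lemma smooth_transl a : smooth_map B B (fun y => a + y).
Proof.
by apply: smooth_mapD => //; [exact: smooth_map_cst|exact: smooth_map_id].
Qed.

(** By linearity only the two axes count, and on each of them addition restricts to the identity. *)
Lemma mdiff_add0 v w :
  mdiff (prod_atlas B B) B (fun z : H * H => z.1 + z.2) (0, 0) (row_mx v w) = v + w.
Proof.
have -> : row_mx v w = 1 *: row_mx v 0 + row_mx 0 w.
  by rewrite scale1r add_row_mx addr0 add0r.
rewrite (mdiff_linear hBB hB _ _ _ _ sadd) scale1r; congr (_ + _).
  have := @mdiffD H k B id (fun _ => 0) 0 v hB (smooth_map_id hB) (smooth_map_cst B hB 0).
  rewrite (mdiff_id hB) mdiff_cst => <-; rewrite -[RHS](mdiff_id hB 0).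
  by under [X in mdiff _ _ X]eq_fun do rewrite addr0.
have := @mdiffD H k B (fun _ => 0) id 0 w hB (smooth_map_cst B hB 0) (smooth_map_id hB).
rewrite (mdiff_id hB) mdiff_cst => <-; rewrite -[RHS](mdiff_id hB 0).
by under [X in mdiff _ _ X]eq_fun do rewrite add0r.
Qed.

Lemma mdiff_opp0 v : mdiff B B (fun z : H => - z) 0 v = - v.
Proof.
have := @mdiffD H k B id (fun z => - z) 0 v hB (smooth_map_id hB) sopp.
rewrite oppr0 mdiff_add0 (mdiff_id hB).
have -> : (fun y : H => id y + - y) = (fun _ => 0).
  by apply/funext => y; rewrite subrr.
by rewrite mdiff_cst => /esym/eqP; rewrite addrC addr_eq0 => /eqP.
Qed.

Lemma to_lie_linear z a v w : to_lie B z (a *: v + w) = a *: to_lie B z v + to_lie B z w.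
Proof. by apply: mdiff_linear => //; exact: smooth_transl. Qed.

(** [to_lie] is the Maurer-Cartan form of [H]; this is its left invariance. *)
Lemma to_lie_transl a z v :
  to_lie B (a + z) (mdiff B B (fun y => a + y) z v) = to_lie B z v.
Proof.
rewrite /to_lie -(mdiff_comp hB hB hB (smooth_transl a) (smooth_transl _)).
suff -> : (fun y => - (a + z) + y) \o (fun y => a + y) = (fun y => - z + y) by [].
by apply/funext => y /=; rewrite opprD addrACA addNr add0r.
Qed.

Lemma smooth_reflect c : smooth_map B B (fun y => c - y).
Proof. by apply: smooth_mapD => //; exact: smooth_map_cst. Qed.

(** In a commutative group, the reflection followed by the translation back to 0 is the translation
    to 0 followed by negation, whose differential at 0 is -1. *)
Lemma to_lie_reflect c z v :
  to_lie B (c - z) (mdiff B B (fun y => c - y) z v) = - to_lie B z v.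
Proof.
rewrite /to_lie -(mdiff_comp hB hB hB (smooth_reflect c) (smooth_transl _)).
have -> : (fun y => - (c - z) + y) \o (fun y => c - y) =
    (fun y => - y) \o (fun y => - z + y).
  by apply/funext => y /=; rewrite !opprD !opprK [- c + z]addrC -addrA addKr.
rewrite (mdiff_comp hB hB hB (smooth_transl _) sopp) addNr.
exact: mdiff_opp0.
Qed.

(** The Maurer-Cartan form in the chart [B q]: row [i] is its value on the [i]-th coordinate vector.
    Hence [c *m invmx (lie_frame q y)] is the left-invariant field with value [c] at 0. *)
Definition lie_frame q (y : 'rV[R]_k) : 'M[R]_k :=
  \matrix_(i, j) to_lie B (chart_inv (B q) y) (coord_vec B q y (base i)) 0 j.

Lemma lie_frameE q y v : chart_img (B q) y ->
  to_lie B (chart_inv (B q) y) (coord_vec B q y v) = v *m lie_frame q y.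
Proof.
move=> yi.
have := coord_vec_push hB hB (smooth_transl (- chart_inv (B q) y)) (q := 0) _ yi.
rewrite addNr => /(_ _ (chart_dom_self hB 0)) cp.
have s := smooth_map_rep (q := 0) hB hB (smooth_transl (- chart_inv (B q) y)) yi.
rewrite addNr in s; have {}s := s (chart_dom_self hB 0).
have E u : to_lie B (chart_inv (B q) y) (coord_vec B q y u) =
    'D_u (local_rep B B (fun x => - chart_inv (B q) y + x) q 0) y.
  apply: etrans (esym (cp u)) _; apply: etrans _ (coord_vec_self hB 0 _).
  by rewrite {1}/local_rep /= addNr.
rewrite E (derive_jac _ s); congr (_ *m _); apply/matrixP => i j.
by rewrite !mxE E.
Qed.

(** The translation used at [y] itself depends on [y]. Its derivative is the partial derivative in
    the second argument of the jointly smooth map (a, b) |-> - a + b, taken along the diagonal. *)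
Lemma smooth_lie_frame q y : chart_img (B q) y -> smooth_at (lie_frame q) y.
Proof.
move=> yi.
pose sub (z : H * H) := - z.1 + z.2.
have ssub : smooth_map (prod_atlas B B) B sub.
  apply: smooth_mapD => //; last exact: smooth_map_snd.
  by apply: smooth_mapN => //; exact: smooth_map_fst.
pose S := local_rep (prod_atlas B B) B sub (q, q) 0.
have diag z : chart_img (B q) z -> chart_img (prod_atlas B B (q, q)) (row_mx z z).
  by move=> zi; apply/prod_chart_img; rewrite row_mxKl row_mxKr.
have sS z : chart_img (B q) z -> smooth_at S (row_mx z z).
  move=> zi; apply: smooth_map_rep => //; first exact: diag.
  by rewrite /sub /= row_mxKl row_mxKr addNr; exact: chart_dom_self.
have sdiag z : smooth_at (fun y : 'rV[R]_k => row_mx y y) z.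
  by apply: smooth_row_mx; exact: smooth_id.
have E : \near y, (\matrix_(i, j) 'D_(row_mx 0 (base i)) S (row_mx y y) 0 j) =
    lie_frame q y.
  apply: near_impl (chart_img_near hB yi) => z zi; apply/matrixP => i j; rewrite !mxE.
  have cp := coord_vec_push hB hB (smooth_transl (- chart_inv (B q) z)) (q := 0) (base i) zi.
  rewrite addNr in cp; have {}cp := cp (chart_dom_self hB 0).
  apply: etrans _ (congr1 (fun t : 'rV[R]_k => t 0 j) cp).
  have -> : local_rep B B (fun x => - chart_inv (B q) z + x) q 0 z = chart_fun (B 0) 0.
    by rewrite /local_rep /= addNr.
  rewrite (coord_vec_self hB).
  have s2 : smooth_at (fun w : 'rV[R]_k => row_mx z w) z.
    by apply: smooth_row_mx; [exact: smooth_cst|exact: smooth_id].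
  have D2 : 'D_(base i) (fun w : 'rV[R]_k => row_mx z w) z = row_mx 0 (base i).
    apply: etrans (derive_row_mx _ (smooth_cst z z) (smooth_id z)) _.
    by rewrite derive_cst derive_id.
  have := derive_comp (base i) s2 (sS z zi); rewrite D2 => <-.
  apply: (congr1 (fun t : 'rV[R]_k => t 0 j)); apply: near_eq_derive.
  apply: near_all => w.
  by rewrite /S /local_rep /sub /= row_mxKl row_mxKr.
apply: smooth_at_eq E _; apply/smooth_mx => i j.
have E2 : \near y, ('D_(row_mx 0 (base i)) S \o (fun y => row_mx y y)) y 0 j =
   (\matrix_(i, j) 'D_(row_mx 0 (base i)) S (row_mx y y) 0 j) i j.
  by apply: near_all => z; rewrite mxE.
apply: smooth_at_eq E2 _; apply: smooth_entry; apply: smooth_comp => //.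
exact/smooth_derive/sS.
Qed.

Variable gH : form2 R H k.
Hypotheses (hgH : is_metric B gH) (hinv : left_invariant B gH).

Lemma left_invariant_to_lie z v w : gH z v w = gH 0 (to_lie B z v) (to_lie B z w).
Proof. by rewrite -(hinv (- z) z) addNr. Qed.

Lemma lie_frame_unit q y : chart_img (B q) y -> lie_frame q y \in unitmx.
Proof.
move=> yi; rewrite -row_free_unit -kermx_eq0; apply/rowV0P => v /sub_kermxP vM.
apply/eqP; apply: contraT => v0.
have [_ ppos] := gram_posdef hB hgH yi; have := ppos v v0.
rewrite -(local_form_gram hB hgH)// /local_form2 left_invariant_to_lie lie_frameE// vM.
have [glin _ _ _] := hgH; have := glin 0 0 1 0 0.
by rewrite scale1r addr0 mul1r => /eqP; rewrite -subr_eq0 opprD addrA subrr sub0r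
  oppr_eq0 => /eqP ->; rewrite ltxx.
Qed.

Lemma reflect_isometry c y v w :
  gH (c - y) (mdiff B B (fun y => c - y) y v) (mdiff B B (fun y => c - y) y w) = gH y v w.
Proof.
rewrite left_invariant_to_lie [RHS]left_invariant_to_lie !to_lie_reflect.
move: (to_lie B y v) (to_lie B y w) => a b.
have [glin gsym _ _] := hgH.
have gN u x : gH 0 u (- x) = - gH 0 u x.
  have := glin 0 u (-1) x x; rewrite scaleN1r addNr mulN1r addNr => g0.
  by have := glin 0 u (-1) x 0; rewrite scaleN1r addr0 mulN1r g0 addr0.
by rewrite gN gsym gN opprK gsym.
Qed.

(* The reflection y |-> q + q - y is an isometry that fixes q and reverses
   left-invariant fields, hence also their divergence at q. *)
Lemma left_invariant_divergence_free q c :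
  divg (gram B gH q) (fun y => c *m invmx (lie_frame q y)) (chart_fun (B q) q) = 0.
Proof.
pose sg (y : H) := q + q - y; set x := chart_fun (B q) q.
have ssg : smooth_map B B sg := smooth_reflect (q + q).
pose psi := local_rep B B sg q q.
have xi : chart_img (B q) x by exact: chart_img_self.
have ix : chart_inv (B q) x = q by exact: chart_inv_self.
have sgq : sg q = q by rewrite /sg addrK.
have xd : chart_dom (B q) (sg (chart_inv (B q) x)).
  by rewrite ix sgq; exact: chart_dom_self.
have psix : psi x = x by rewrite /psi /local_rep /= ix sgq.
have sp : smooth_at psi x := smooth_map_rep hB hB ssg xi xd.
have sG := gram_smooth hB hgH xi.
have d0 := posdef_det_gt0 (gram_posdef hB hgH xi).
pose X y := c *m invmx (lie_frame q y).
have nxi := chart_img_near hB xi.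
have sX : smooth_at X x.
  apply: smooth_mulmx; first exact: smooth_cst.
  apply: smooth_invmx; last exact: smooth_lie_frame.
  by apply: near_impl nxi => y; exact: lie_frame_unit.
have nd := smooth_map_chart_near hB hB ssg xi xd.
have GG : \forall y \near x, gram B gH q y =
    jac psi y *m gram B gH q (psi y) *m (jac psi y)^T.
  apply: near_impl (near_and nxi nd) => y [yi yd].
  by apply: (gram_pullback hB hB hgH ssg) => // z v w; exact: reflect_isometry.
have XX : \forall y \near x, - X (psi y) = X y *m jac psi y.
  apply: near_impl (near_and nxi nd) => y [yi yd].
  have pyi : chart_img (B q) (psi y) by exists (sg (chart_inv (B q) y)).
  have ipy : chart_inv (B q) (psi y) = sg (chart_inv (B q) y) by exact: chart_funK.
  have spy := smooth_map_rep hB hB ssg yi yd.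
  apply: (can_inj (mulmxK (lie_frame_unit pyi))).
  have XK : X (psi y) *m lie_frame q (psi y) = c := mulmxKV (lie_frame_unit pyi) c.
  apply: etrans (mulNmx _ _) _; apply: etrans (congr1 -%R XK) _.
  have cp := coord_vec_push hB hB ssg (X y) yi yd.
  have Dp := derive_jac (X y) spy.
  rewrite -(lie_frameE _ pyi) -Dp ipy; apply: etrans _ (congr1 _ (esym cp)).
  rewrite to_lie_reflect (lie_frameE _ yi).
  by rewrite (mulmxKV (lie_frame_unit yi)).
have sXp : smooth_at (fun y => - X y) (psi x) by rewrite psix; exact: smoothN.
have := divg_natural sp sG _ d0 _ GG sX sXp XX.
rewrite psix => /(_ sG d0) E; change (divg (gram B gH q) X x = 0).
have EN : divg (gram B gH q) (fun y => - X y) x = - divg (gram B gH q) X x.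
  have sXN := smoothN sX.
  rewrite (divgE sG d0 sXN) (divgE sG d0 sX) opprD -sumrN -sumrN.
  congr (_ + _); apply: eq_bigr => i _; last by rewrite mxE mulNr.
  rewrite !mxE; have := sderiveN (base i) sX => ->; by rewrite mxE.
by move: E; rewrite EN; move: (divg _ _ _) => d dd; lra.
Qed.

End AbelianLieGroup.

(** * Laplacians of sheared metrics *)

Section DivergenceRules.
Context {R : realType}.

Lemma divgD n (G : 'rV[R]_n -> 'M[R]_n) (X Y : 'rV[R]_n -> 'rV[R]_n) x :
  smooth_at G x -> 0 < \det (G x) -> smooth_at X x -> smooth_at Y x ->
  divg G (fun y => X y + Y y) x = divg G X x + divg G Y x.
Proof.
move=> sG d0 sX sY; have sXY := smoothD sX sY.
rewrite (divgE sG d0 sXY) (divgE sG d0 sX) (divgE sG d0 sY) addrACA; congr (_ + _).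
  rewrite -mxtraceD; congr (\tr _); apply/matrixP => i j; rewrite !mxE.
  by have := sderiveD (base i) sX sY => ->; rewrite mxE.
by rewrite -big_split; apply: eq_bigr => i _; rewrite /= mxE mulrDl.
Qed.

Lemma base_lshift n k (i : 'I_n) : base (lshift k i) = row_mx (base i) 0 :> 'rV[R]_(n + k).
Proof.
apply/rowP => j; case: (splitP j) => l jl.
  have -> : j = lshift k l by exact: val_inj.
  by rewrite row_mxEl !mxE eq_lshift.
have -> : j = rshift n l by exact: val_inj.
by rewrite row_mxEr !mxE eq_rlshift.
Qed.

Lemma base_rshift n k (i : 'I_k) : base (rshift n i) = row_mx 0 (base i) :> 'rV[R]_(n + k).
Proof.
apply/rowP => j; case: (splitP j) => l jl.
  have -> : j = lshift k l by exact: val_inj.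
  by rewrite row_mxEl !mxE eq_lrshift.
have -> : j = rshift n l by exact: val_inj.
by rewrite row_mxEr !mxE eq_rshift.
Qed.

(** On the slice through [a] the density is a constant multiple of the density of the fibre, and the
    constant cancels; the field has no components in the first [n] directions. *)
Lemma divg_vertical n k (G : 'rV[R]_(n + k) -> 'M[R]_(n + k)) (GH : 'rV[R]_k -> 'M[R]_k)
    (X : 'rV[R]_(n + k) -> 'rV[R]_k) a b (c : R) :
  c != 0 -> smooth_at GH b -> 0 < \det (GH b) ->
  smooth_at (fun y => X (row_mx a y)) b ->
  (\forall y \near b, volume G (row_mx a y) = c * volume GH y) ->
  divg G (fun x => row_mx 0 (X x)) (row_mx a b) = divg GH (fun y => X (row_mx a y)) b.
Proof.
move=> c0 sG d0 sX vol; rewrite /divg (nbhs_singleton vol) big_split_ord /=.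
rewrite big1 ?add0r => [|i _]; last first.
  rewrite -[RHS](derive_cst (0 : R) (row_mx a b) (base (lshift k i))).
  by apply: near_eq_derive; apply: near_all => y; rewrite row_mxEl mxE mulr0.
have -> : \sum_(i < k) 'D_(base (rshift n i))
     (fun y => volume G y * row_mx 0 (X y) 0 (rshift n i)) (row_mx a b) =
   c * \sum_(i < k) 'D_(base i) (fun y => volume GH y * X (row_mx a y) 0 i) b.
  rewrite mulr_sumr; apply: eq_bigr => i _; rewrite base_rshift derive_slice.
  have [dv _] := is_derive_volume (base i) sG d0.
  have dX := smooth_derivable (base i) (smooth_entry 0 i sX).
  apply: etrans _ (deriveZ c (derivableM dv dX)); apply: near_eq_derive.
  by apply: near_impl vol => y ->; rewrite row_mxEr -mulrA.
by rewrite invfM mulrACA mulVf// mul1r.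
Qed.

Lemma divg_moving_frame k (G I : 'rV[R]_k -> 'M[R]_k) (c : 'rV[R]_k -> 'rV[R]_k) y :
  smooth_at G y -> 0 < \det (G y) -> smooth_at I y -> smooth_at c y ->
  (forall c0 : 'rV[R]_k, divg G (fun z => c0 *m I z) y = 0) ->
  divg G (fun z => c z *m I z) y = \sum_j 'D_(base j *m I y) c y 0 j.
Proof.
move=> sG d0 sI sc div0.
have sX := smooth_mulmx sc sI; have sX0 := smooth_mulmx (smooth_cst (c y) y) sI.
have := div0 (c y); rewrite (divgE sG d0 sX0) (divgE sG d0 sX).
have trE : \tr (jac (fun z => c z *m I z) y) =
    \tr (jac (fun z => cst (c y) z *m I z) y) + \sum_i ('D_(base i) c y *m I y) 0 i.
  rewrite -big_split; apply: eq_bigr => i _ /=; rewrite [LHS]mxE [X in _ = X + _]mxE.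
  have e1 := sderive_mulmx (base i) sc sI.
  have e2 := sderive_mulmx (base i) (smooth_cst (c y) y) sI.
  rewrite derive_cst mul0mx addr0 in e2.
  by rewrite e1 e2 mxE.
rewrite trE addrAC /cst /= => ->; rewrite add0r.
under [RHS]eq_bigr do rewrite (derive_jac _ sc).
transitivity (\tr (jac c y *m I y)).
  apply: eq_bigr => i _; rewrite mxE [RHS]mxE; apply: eq_bigr => j _.
  by rewrite mxE.
rewrite mxtrace_mulC; apply: eq_bigr => j _.
by rewrite -mulmxA -rowE [RHS]mxE.
Qed.

End DivergenceRules.

(** * Sheared block metrics *)

Section BlockMetric.
Context {R : realType} {n k : nat}.
Implicit Types (h : 'M[R]_n) (M G : 'M[R]_k) (L : 'M[R]_(n, k)).

(** [L] holds the Lie algebra values of the form on coordinate vectors, and [invmx M], for a frame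
    matrix [M], rewrites them in fibre coordinates. *)
Definition shear L M : 'M[R]_(n + k) := block_mx 1%:M (L *m invmx M) 0 1%:M.

Definition sheared_metric h G M L : 'M[R]_(n + k) :=
  shear L M *m block_mx h 0 0 G *m (shear L M)^T.

Lemma det_sheared_metric h G M L : \det (sheared_metric h G M L) = \det h * \det G.
Proof. by rewrite !det_mulmx det_tr !det_ublock !det1 !mulr1 mul1r. Qed.

Lemma sheared_metric_sym h G M L : h^T = h -> G^T = G ->
  (sheared_metric h G M L)^T = sheared_metric h G M L.
Proof.
move=> hs Gs; rewrite /sheared_metric !trmx_mul trmxK mulmxA; congr (_ *m _ *m _).
by rewrite tr_block_mx hs Gs !trmx0.
Qed.

(** For d = (d1, d2) the differential of a function, this is its gradient, with horizontal part [a].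
    The shear is undone block by block. *)
Lemma sheared_metric_inv h G M L (d1 : 'rV[R]_n) (d2 : 'rV[R]_k) :
  h \in unitmx -> G \in unitmx -> h^T = h -> G^T = G ->
  let a := (d1 - d2 *m (L *m invmx M)^T) *m invmx h in
  row_mx d1 d2 *m (invmx (sheared_metric h G M L))^T =
  row_mx a (d2 *m invmx G - a *m (L *m invmx M)).
Proof.
move=> uh uG hs Gs a; set S := sheared_metric h G M L.
have uS : S \in unitmx.
  by rewrite unitmxE det_sheared_metric unitrM -!unitmxE uh uG.
have ST : S^T = S by exact: sheared_metric_sym.
rewrite trmx_inv ST -[RHS](mulmxK uS); congr (_ *m _).
rewrite /S /sheared_metric /shear; set K := L *m invmx M in a *.
rewrite mulmxA (mulmxA _ (block_mx _ _ _ _)) mul_row_block mulmx1 mulmx0 addr0 mulmx1.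
rewrite [X in _ = row_mx _ X *m _ *m _]addrC subrK mul_row_block !mulmx0 addr0 add0r mulmxKV//.
rewrite tr_block_mx !trmx1 trmx0 mul_row_block !mulmx1 mulmx0 add0r.
by rewrite /a mulmxKV// subrK.
Qed.

End BlockMetric.

(** * Comparison of two shears in one chart *)

Section Comparison.
Context {R : realType} {n k : nat}.
Context (h : 'rV[R]_n -> 'M[R]_n) (M : 'rV[R]_k -> 'M[R]_k) (G0 : 'M[R]_k).
Context (x1 : 'rV[R]_n) (y0 : 'rV[R]_k).
Let G y := M y *m G0 *m (M y)^T.
Hypothesis sh : smooth_at h x1.
Hypothesis ph : \forall x \near x1, posdef (h x).
Hypothesis sM : smooth_at M y0.
Hypothesis uM : \forall y \near y0, M y \in unitmx.
Hypothesis pG : \forall y \near y0, posdef (G y).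
Hypothesis div0 : forall c : 'rV[R]_k, divg G (fun y => c *m invmx (M y)) y0 = 0.

Implicit Types L : 'rV[R]_n -> 'M[R]_(n, k).

Definition local_metric L (x : 'rV[R]_(n + k)) : 'M[R]_(n + k) :=
  sheared_metric (h (lsubmx x)) (M (rsubmx x) *m G0 *m (M (rsubmx x))^T)
    (M (rsubmx x)) (L (lsubmx x)).

Let x0 : 'rV[R]_(n + k) := row_mx x1 y0.

Lemma near_lsubmx (P : 'rV[R]_n -> Prop) : (\forall x \near x1, P x) ->
  \forall x \near x0, P (lsubmx x).
Proof.
move=> nP; have := smooth_cont (smooth_lsubmx x0); apply.
by rewrite row_mxKl.
Qed.

Lemma near_rsubmx (P : 'rV[R]_k -> Prop) : (\forall y \near y0, P y) ->
  \forall x \near x0, P (rsubmx x).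
Proof.
move=> nP; have := smooth_cont (smooth_rsubmx x0); apply.
by rewrite row_mxKr.
Qed.

Lemma smooth_of_lsubmx a b (F : 'rV[R]_n -> 'M[R]_(a, b)) :
  smooth_at F x1 -> smooth_at (fun x : 'rV[R]_(n + k) => F (lsubmx x)) x0.
Proof. by move=> sF; apply: (smooth_comp (smooth_lsubmx x0)); rewrite row_mxKl. Qed.

Lemma smooth_of_rsubmx a b (F : 'rV[R]_k -> 'M[R]_(a, b)) :
  smooth_at F y0 -> smooth_at (fun x : 'rV[R]_(n + k) => F (rsubmx x)) x0.
Proof. by move=> sF; apply: (smooth_comp (smooth_rsubmx x0)); rewrite row_mxKr. Qed.

Lemma smooth_block_mx a b c d m (A : 'rV[R]_m -> 'M[R]_(a, c))
    (B : 'rV[R]_m -> 'M[R]_(a, d)) (C : 'rV[R]_m -> 'M[R]_(b, c))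
    (D : 'rV[R]_m -> 'M[R]_(b, d)) x :
  smooth_at A x -> smooth_at B x -> smooth_at C x -> smooth_at D x ->
  smooth_at (fun y => block_mx (A y) (B y) (C y) (D y)) x.
Proof.
move=> sA sB sC sD; apply/smooth_mx => i j.
case: (splitP i) => i' ei; case: (splitP j) => j' ej.
- have -> : i = lshift b i' by exact: val_inj.
  have -> : j = lshift d j' by exact: val_inj.
  by apply: smooth_at_eq (smooth_entry i' j' sA); apply: near_all => y; rewrite block_mxEul.
- have -> : i = lshift b i' by exact: val_inj.
  have -> : j = rshift c j' by exact: val_inj.
  by apply: smooth_at_eq (smooth_entry i' j' sB); apply: near_all => y; rewrite block_mxEur.
- have -> : i = rshift a i' by exact: val_inj.
  have -> : j = lshift d j' by exact: val_inj.
  by apply: smooth_at_eq (smooth_entry i' j' sC); apply: near_all => y; rewrite block_mxEdl.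
- have -> : i = rshift a i' by exact: val_inj.
  have -> : j = rshift c j' by exact: val_inj.
  by apply: smooth_at_eq (smooth_entry i' j' sD); apply: near_all => y; rewrite block_mxEdr.
Qed.

Let sG : smooth_at G y0.
Proof.
apply: smooth_mulmx; last exact: smooth_tr.
by apply: smooth_mulmx; [|exact: smooth_cst].
Qed.

Let sI : smooth_at (fun y => invmx (M y)) y0. Proof. exact: smooth_invmx. Qed.

Lemma smooth_local_metric L : smooth_at L x1 -> smooth_at (local_metric L) x0.
Proof.
move=> sL.
have sS : smooth_at (fun x => shear (L (lsubmx x)) (M (rsubmx x))) x0.
  apply: smooth_block_mx; try exact: smooth_cst.
  by apply: smooth_mulmx; [exact: smooth_of_lsubmx|exact: (smooth_of_rsubmx sI)].
apply: smooth_mulmx; last exact: smooth_tr.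
apply: smooth_mulmx => //; apply: smooth_block_mx; try exact: smooth_cst.
  exact: smooth_of_lsubmx.
exact: (smooth_of_rsubmx sG).
Qed.

Lemma det_local_metric L x : \det (local_metric L x) =
  \det (h (lsubmx x)) * \det (G (rsubmx x)).
Proof. exact: det_sheared_metric. Qed.

Lemma det_local_metric_gt0 L : \forall x \near x0, 0 < \det (local_metric L x).
Proof.
apply: near_impl (near_and (near_lsubmx ph) (near_rsubmx pG)) => x [p1 p2].
by rewrite det_local_metric mulr_gt0//; exact: posdef_det_gt0.
Qed.

Context (u v : 'rV[R]_(n + k) -> R) (zeta : 'rV[R]_k).
Hypotheses (su : smooth_at u x0) (sv : smooth_at v x0).
Hypothesis Du : \forall x \near x0, forall w,
  'D_(row_mx 0 w) u x = - ((w *m M (rsubmx x) *m zeta^T) 0 0 * v x).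
Hypothesis Dv : \forall x \near x0, forall w,
  'D_(row_mx 0 w) v x = (w *m M (rsubmx x) *m zeta^T) 0 0 * u x.

(* The horizontal gradient of u: it depends on L only through zeta *m L^T. *)
Definition horizontal_grad L x : 'rV[R]_n :=
  (\row_i 'D_(row_mx (base i) 0) u x + v x *: (zeta *m (L (lsubmx x))^T)) *m
  invmx (h (lsubmx x)).

(** By [Du] the fibre part of the differential is - v zeta M^T. Its factor M^T cancels the inverse
    frame in the shear, which leaves [zeta *m L^T] in the horizontal part. *)
Lemma gradm_local_metric L : \forall x \near x0,
  gradm (local_metric L) u x = row_mx (horizontal_grad L x)
    (- (v x *: (zeta *m (M (rsubmx x))^T)) *m invmx (G (rsubmx x)) -
     horizontal_grad L x *m (L (lsubmx x) *m invmx (M (rsubmx x)))).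
Proof.
apply: near_impl (near_and (near_and (near_lsubmx ph) (near_rsubmx pG))
  (near_and Du (near_rsubmx uM))) => x [[p1 p2] [Dux uMx]].
rewrite gradmE; have -> : \row_j 'D_(base j) u x =
    row_mx (\row_i 'D_(row_mx (base i) 0) u x) (- (v x *: (zeta *m (M (rsubmx x))^T))).
  apply/rowP => j; case: (splitP j) => l jl.
    have -> : j = lshift k l by exact: val_inj.
    by rewrite row_mxEl !mxE base_lshift.
  have -> : j = rshift n l by exact: val_inj.
  have E : (zeta *m (M (rsubmx x))^T) 0 l = (base l *m M (rsubmx x) *m zeta^T) 0 0.
    transitivity ((M (rsubmx x) *m zeta^T)^T 0 l); first by rewrite trmx_mul trmxK.
    by rewrite [LHS]mxE -mulmxA -rowE [RHS]mxE.
  rewrite row_mxEr [LHS]mxE base_rshift Dux [RHS]mxE [X in _ = - X]mxE E.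
  by rewrite mulrC.
have [h1 _] := p1; have [g1 _] := p2.
rewrite /local_metric sheared_metric_inv//; try exact: posdef_unit.
have -> : - (v x *: (zeta *m (M (rsubmx x))^T)) *m
    (L (lsubmx x) *m invmx (M (rsubmx x)))^T = - (v x *: (zeta *m (L (lsubmx x))^T)).
  rewrite trmx_mul trmx_inv mulNmx -scalemxAl mulmxA mulmxK//.
  by rewrite unitmx_tr.
by rewrite opprK.
Qed.

Lemma derive_along_fst w0 (w : 'rV[R]_k) :
  'D_(row_mx w0 0) (fun x : 'rV[R]_(n + k) => (w *m M (rsubmx x) *m zeta^T) 0 0) x0 = 0.
Proof.
have sF : smooth_at (fun y => w *m M y *m zeta^T) y0.
  apply: smooth_mulmx; last exact: smooth_cst.
  by apply: smooth_mulmx => //; exact: smooth_cst.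
have sFx := smooth_of_rsubmx sF.
apply: etrans (esym (derive_entry 0 0 (row_mx w0 0) sFx)) _.
have sF' : smooth_at (fun y => w *m M y *m zeta^T) (rsubmx x0) by rewrite row_mxKr.
have := @derive_comp_rsubmx _ n k 1 (fun y => w *m M y *m zeta^T) x0 (row_mx w0 0) sF'.
by move=> ->; rewrite [rsubmx (row_mx w0 0)]row_mxKr derive0 mxE.
Qed.

(** Minus the horizontal gradient of [v], formed from the pair (v, - u) as [horizontal_grad] is
    formed from (u, v). *)
Definition conj_horizontal_grad L : 'rV[R]_n :=
  (- (\row_i 'D_(row_mx (base i) 0) v x0) + u x0 *: (zeta *m (L x1)^T)) *m
  invmx (h x1).

(** The real part of the statement that a fibre derivative multiplies the horizontal gradient of u +
    i v by i z, where z = w M zeta^T. Symmetry of second derivatives moves the fibre derivative onto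
    [u], and z does not change in the horizontal directions. *)
Lemma derive_horizontal_grad L w :
  'D_w (fun y => horizontal_grad L (row_mx x1 y)) y0 =
  (w *m M y0 *m zeta^T) 0 0 *: conj_horizontal_grad L.
Proof.
set z := (w *m M y0 *m zeta^T) 0 0.
have sslice : smooth_at (fun y : 'rV[R]_k => row_mx x1 y) y0.
  by apply: smooth_row_mx; [exact: smooth_cst|exact: smooth_id].
have sd i : smooth_at ('D_(row_mx (base i) 0) u) x0 by exact: smooth_derive.
pose r y := \row_i 'D_(row_mx (base i) 0) u (row_mx x1 y).
have sr : smooth_at r y0.
  apply/smooth_mx => a i; apply: smooth_at_eq (smooth_comp_real sslice (sd i)).
  by apply: near_all => y; rewrite mxE.
have sv' : smooth_at (fun y => v (row_mx x1 y)) y0.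
  exact: (smooth_comp_real sslice sv).
pose c := zeta *m (L x1)^T.
have svc : smooth_at (fun y => v (row_mx x1 y) *: c) y0.
  apply/smooth_mx => a i; apply: smooth_at_eq (smoothM sv' (smooth_cstR (c a i) y0)).
  by apply: near_all => y; rewrite [RHS]mxE.
transitivity ('D_w (fun y => (r y + v (row_mx x1 y) *: c) *m invmx (h x1)) y0).
  by apply: near_eq_derive; apply: near_all => y; rewrite /horizontal_grad row_mxKl.
have sI1 := smooth_cst (invmx (h x1)) y0.
apply: etrans (sderive_mulmx w (smoothD sr svc) sI1) _.
rewrite derive_cst mulmx0 add0r scalemxAl; congr (_ *m _).
rewrite (sderiveD w sr svc) scalerDr; congr (_ + _); apply/rowP => i.
  rewrite (derive_entry _ _ _ sr) scalerN [RHS]mxE [X in _ = - X]mxE [X in _ = - (_ * X)]mxE.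
  transitivity ('D_w (fun y => 'D_(row_mx (base i) 0) u (row_mx x1 y)) y0).
    by apply: near_eq_derive; apply: near_all => y; rewrite mxE.
  apply: etrans (esym (derive_slice ('D_(row_mx (base i) 0) u) x1 y0 w)) _.
  apply: etrans (smooth_Clairaut (row_mx (base i) 0) (row_mx 0 w) su) _.
  pose F (x : 'rV[R]_(n + k)) : R := (w *m M (rsubmx x) *m zeta^T) 0 0.
  have sF : smooth_at F x0.
    apply: smooth_entry; apply: (@smooth_of_rsubmx _ _ (fun y => w *m M y *m zeta^T)).
    apply: smooth_mulmx; last exact: smooth_cst.
    by apply: smooth_mulmx => //; exact: smooth_cst.
  transitivity ('D_(row_mx (base i) 0) (fun x => - (F x * v x)) x0).
    by apply: near_eq_derive; apply: near_impl Du => x ->.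
  apply: etrans (sderiveN _ (smoothM sF sv)) _; apply: (congr1 -%R).
  apply: etrans (sderiveM _ sF sv) _.
  have -> : 'D_(row_mx (base i) 0) F x0 = 0 by exact: derive_along_fst.
  by rewrite mul0r addr0 /F row_mxKr.
rewrite (derive_entry _ _ _ svc) [RHS]mxE [X in _ = _ * X]mxE.
transitivity ('D_w (fun y => v (row_mx x1 y)) y0 * c 0 i).
  apply: etrans (_ : 'D_w (fun y => v (row_mx x1 y) * c 0 i) y0 = _).
    by apply: near_eq_derive; apply: near_all => y; rewrite [LHS]mxE.
  apply: etrans (sderiveM w sv' (smooth_cstR (c 0 i) y0)) _.
  by rewrite [X in _ * X]derive_cst mulr0 add0r.
by rewrite -(derive_slice v x1 y0 w) (nbhs_singleton Dv) row_mxKr mulrA.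
Qed.

(** The determinants do not involve the shear, so the densities agree. The gradients agree up to a
    vertical field whose coefficients in the left-invariant frame are - a (L'' - L'), with [a] the
    horizontal gradient. By [divg_moving_frame] only these coefficients are differentiated, and the
    outcome contains (L'' - L') zeta^T = 0. *)
Lemma lap_local_metric L' L'' :
  smooth_at L' x1 -> smooth_at L'' x1 ->
  (\forall x \near x1, L' x *m zeta^T = L'' x *m zeta^T) ->
  lap (local_metric L') u x0 = lap (local_metric L'') u x0.
Proof.
move=> s' s'' EL; apply/esym; rewrite /lap; apply: (congr1 -%R).
have vol x : volume (local_metric L'') x = volume (local_metric L') x.
  by rewrite /volume !det_local_metric.
rewrite (divg_near_metric _ (near_all _ vol)).
pose b x := - (horizontal_grad L' x *m (L'' (lsubmx x) - L' (lsubmx x))).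
pose X2 x := b x *m invmx (M (rsubmx x)).
have hE : \forall x \near x0, horizontal_grad L'' x = horizontal_grad L' x.
  apply: near_impl (near_lsubmx EL) => x Ex; rewrite /horizontal_grad; congr ((_ + _ *: _) *m _).
  by apply: trmx_inj; rewrite !trmx_mul !trmxK.
have sG' := smooth_local_metric s'.
have d0' := nbhs_singleton (det_local_metric_gt0 L').
have sgr : smooth_at (gradm (local_metric L') u) x0.
  by apply: smooth_gradm => //; exact: det_gt0_unit.
have sd i : smooth_at ('D_(row_mx (base i) 0) u) x0 by exact: smooth_derive.
have shI : smooth_at (fun x => invmx (h x)) x1.
  apply: smooth_invmx => //; apply: near_impl ph => x; exact: posdef_unit.
have shg : smooth_at (horizontal_grad L') x0.
  apply: smooth_mulmx; last exact: (smooth_of_lsubmx shI).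
  apply: smoothD; apply/smooth_mx => a i.
    by apply: smooth_at_eq (sd i); apply: near_all => x; rewrite mxE.
  have sc : smooth_at (fun x => zeta *m (L' (lsubmx x))^T) x0.
    apply: smooth_mulmx; first exact: smooth_cst.
    exact/smooth_tr/smooth_of_lsubmx.
  apply: smooth_at_eq (smoothM sv (smooth_entry a i sc)).
  by apply: near_all => x; rewrite [RHS]mxE.
have sb : smooth_at b x0.
  apply: smoothN; apply: smooth_mulmx => //.
  by apply: smoothB; exact: smooth_of_lsubmx.
have sX2 : smooth_at X2 x0 by apply: smooth_mulmx => //; exact: (smooth_of_rsubmx sI).
have sX : smooth_at (fun x => row_mx (0 : 'rV[R]_n) (X2 x)) x0.
  by apply: smooth_row_mx => //; exact: smooth_cst.
have gE : \forall x \near x0, gradm (local_metric L'') u x =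
    gradm (local_metric L') u x + row_mx 0 (X2 x).
  apply: near_impl (near_and hE (near_and (gradm_local_metric L')
    (gradm_local_metric L''))) => x [hx [-> ->]].
  rewrite hx add_row_mx addr0; congr row_mx; rewrite -addrA; congr (_ + _).
  by rewrite /X2 /b mulNmx mulmxBr mulmxBl opprB !mulmxA addKr.
rewrite (divg_near _ gE) (divgD sG' d0' sgr sX).
suff -> : divg (local_metric L') (fun x => row_mx 0 (X2 x)) x0 = 0 by rewrite addr0.
have sslice : smooth_at (fun y : 'rV[R]_k => row_mx x1 y) y0.
  by apply: smooth_row_mx; [exact: smooth_cst|exact: smooth_id].
have px1 := nbhs_singleton ph; have py0 := nbhs_singleton pG.
have dG0 := posdef_det_gt0 py0.
have hv0 : volume h x1 != 0 by rewrite gt_eqF// sqrtr_gt0; exact: posdef_det_gt0.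
have volE : \forall y \near y0, volume (local_metric L') (row_mx x1 y) =
    volume h x1 * volume G y.
  apply: near_all => y; rewrite /volume det_local_metric row_mxKl row_mxKr.
  by rewrite sqrtrM// ltW//; exact: posdef_det_gt0.
have sX2s : smooth_at (fun y => X2 (row_mx x1 y)) y0 := smooth_comp sslice sX2.
rewrite (divg_vertical hv0 sG dG0 sX2s volE).
have sbs : smooth_at (fun y => b (row_mx x1 y)) y0 := smooth_comp sslice sb.
transitivity (divg G (fun y => b (row_mx x1 y) *m invmx (M y)) y0).
  by apply: divg_near; apply: near_all => y; rewrite /X2 row_mxKr.
rewrite (divg_moving_frame sG dG0 sI sbs div0).
pose be := L'' x1 - L' x1; pose cs := - (conj_horizontal_grad L' *m be).
have bez : be *m zeta^T = 0.
  by rewrite /be mulmxBl (nbhs_singleton EL) subrr.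
have Db w : 'D_w (fun y => b (row_mx x1 y)) y0 = (w *m M y0 *m zeta^T) 0 0 *: cs.
  have shs : smooth_at (fun y => horizontal_grad L' (row_mx x1 y)) y0 := smooth_comp sslice shg.
  transitivity ('D_w (fun y => - (horizontal_grad L' (row_mx x1 y) *m be)) y0).
    by apply: near_eq_derive; apply: near_all => y; rewrite /b row_mxKl.
  have sbe := smooth_cst be y0.
  apply: etrans (sderiveN w (smooth_mulmx shs sbe)) _.
  rewrite /cs scalerN; apply: (congr1 -%R).
  apply: etrans (sderive_mulmx w shs sbe) _.
  by rewrite derive_cst mulmx0 add0r derive_horizontal_grad -scalemxAl.
have uM0 := nbhs_singleton uM.
(* Along the [j]-th frame vector, the row [base j *m invmx (M y0)], the frame cancels and the
   multiplier of [cs] is [zeta 0 j]. *)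
transitivity (\sum_j (zeta 0 j * cs 0 j)).
  apply: eq_bigr => j _; rewrite Db mxE; congr (_ * _).
  by rewrite mulmxKV// -rowE !mxE.
transitivity ((cs *m zeta^T) 0 0).
  rewrite [RHS]mxE; apply: eq_bigr => j _.
  by rewrite [X in _ = _ * X]mxE mulrC.
by rewrite /cs mulNmx -mulmxA bez mulmx0 oppr0 mxE.
Qed.

End Comparison.

(** * The metrics g_lambda *)

Lemma sheared_metric_form (R : realType) n k (h : 'M[R]_n) (G0 M : 'M[R]_k)
    (L : 'M[R]_(n, k)) (v w : 'rV[R]_(n + k)) : M \in unitmx ->
  (v *m sheared_metric h (M *m G0 *m M^T) M L *m w^T) 0 0 =
  (lsubmx v *m h *m (lsubmx w)^T) 0 0 +
  ((lsubmx v *m L + rsubmx v *m M) *m G0 *m (lsubmx w *m L + rsubmx w *m M)^T) 0 0.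
Proof.
move=> uM.
suff -> : v *m sheared_metric h (M *m G0 *m M^T) M L *m w^T =
    lsubmx v *m h *m (lsubmx w)^T +
    (lsubmx v *m L + rsubmx v *m M) *m G0 *m (lsubmx w *m L + rsubmx w *m M)^T.
  by rewrite [LHS]mxE.
have vS (x : 'rV_(n + k)) : x *m shear L M =
    row_mx (lsubmx x) ((lsubmx x *m L + rsubmx x *m M) *m invmx M).
  rewrite -{1}(hsubmxK x) /shear mul_row_block !mulmx1 mulmx0 addr0.
  by rewrite mulmxDl mulmxK// mulmxA.
rewrite /sheared_metric !mulmxA vS -!mulmxA -trmx_mul vS tr_row_mx.
rewrite mul_block_col !mul0mx addr0 add0r mul_row_col; congr (_ + _).
by rewrite !trmx_mul trmx_inv !mulmxA mulmxKV// mulmxK ?unitmx_tr.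
Qed.

Section TotalSpace.
Context {R : realType} {N : topologicalType} {n : nat} (A : atlas R N n).
Context {H : topologicalZmodType} {k : nat} (B : atlas R H k).
Context (h : form2 R N n) (gH : form2 R H k).
Hypotheses (hA : smooth_atlas A) (hh : is_metric A h).
Hypothesis hB : smooth_atlas B.
Hypothesis sadd : smooth_map (prod_atlas B B) B (fun z : H * H => z.1 + z.2).
Hypothesis sopp : smooth_map B B (fun z : H => - z).
Hypotheses (hgH : is_metric B gH) (hinv : left_invariant B gH).

Let AB := prod_atlas A B.
Let hAB : smooth_atlas AB := prod_smooth_atlas hA hB.

Definition form_mx (lam : form1 R N n k) p (x : 'rV[R]_n) : 'M[R]_(n, k) :=
  \matrix_(i, j) lam (chart_inv (A p) x) (coord_vec A p x (base i)) 0 j.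

Definition lie_gram : 'M[R]_k := gram B gH 0 (chart_fun (B 0) 0).

Lemma lie_gramE v w : gH 0 v w = (v *m lie_gram *m w^T) 0 0.
Proof.
rewrite -(local_form_gram hB hgH)//; last exact: chart_img_self.
by rewrite /local_form2 !(coord_vec_self hB) (chart_inv_self hB).
Qed.

Lemma lie_gram_posdef : posdef lie_gram.
Proof. by apply: gram_posdef => //; exact: chart_img_self. Qed.

Lemma lie_frame_gram q y : chart_img (B q) y ->
  gram B gH q y = lie_frame B q y *m lie_gram *m (lie_frame B q y)^T.
Proof.
move=> yi; apply/matrixP => i j; rewrite [LHS]mxE /local_form2.
apply: etrans (left_invariant_to_lie hinv _ _ _) _; rewrite lie_gramE.
have ei := lie_frameE hB sadd (base i) yi.
have ej := lie_frameE hB sadd (base j) yi.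
rewrite ei ej.
move: (lie_frame _ _ _) => M; rewrite trmx_mul !mulmxA.
have -> : base i *m M *m lie_gram *m M^T *m (base j)^T =
    base i *m (M *m lie_gram *m M^T) *m delta_mx j 0 by rewrite trmx_delta !mulmxA.
by rewrite -rowE -colE [LHS]mxE [LHS]mxE.
Qed.

Lemma g_lambda_row_mx lam q a b c d :
  g_lambda h B gH lam q (row_mx a b) (row_mx c d) =
  h q.1 a c + gH 0 (lam q.1 a + to_lie B q.2 b) (lam q.1 c + to_lie B q.2 d).
Proof. by rewrite /g_lambda !row_mxKl !row_mxKr. Qed.

Section Form.
Variable lam : form1 R N n k.
Hypothesis hlam : is_form1 A lam.

Lemma form_mxE p x v : chart_img (A p) x ->
  lam (chart_inv (A p) x) (coord_vec A p x v) = v *m form_mx lam p x.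
Proof.
move=> xi; have [llin _] := hlam.
have l0 q : lam q 0 = 0.
  have := llin q 1 0 0; rewrite !scale1r addr0 => /eqP.
  by rewrite -subr_eq0 opprD addrA subrr sub0r oppr_eq0 => /eqP.
have E u : lam (chart_inv (A p) x) (coord_vec A p x u) =
    \sum_i u 0 i *: lam (chart_inv (A p) x) (coord_vec A p x (base i)).
  have c0 : coord_vec A p x 0 = 0.
    have := coord_vec_linear hA 1 0 0 xi; rewrite !scale1r addr0 => /eqP.
    by rewrite -subr_eq0 opprD addrA subrr sub0r oppr_eq0 => /eqP.
  rewrite {1}(row_sum_delta u).
  elim/big_rec2: _ => [|i b c _ IH]; first by rewrite c0 l0.
  by rewrite (coord_vec_linear hA _ _ _ xi) llin -IH.
rewrite E; apply/rowP => j; rewrite summxE !mxE; apply: eq_bigr => i _.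
by rewrite [LHS]mxE [X in _ = _ * X]mxE.
Qed.

Lemma smooth_form_mx p x : chart_img (A p) x -> smooth_at (form_mx lam p) x.
Proof.
move=> xi; have [_ slam] := hlam; apply/smooth_mx => i j.
have [_ oi _ _ _] := chart_is hA p.
have s := smooth_on_at oi xi (slam p (base i)).
apply: smooth_at_eq (smooth_entry 0 j s).
by apply: near_all => y; rewrite mxE.
Qed.

Lemma local_form_g_lambda p v w x : chart_img (AB p) x ->
  local_form2 AB (g_lambda h B gH lam) p v w x =
  (v *m local_metric (gram A h p.1) (lie_frame B p.2) lie_gram (form_mx lam p.1) x
     *m w^T) 0 0.
Proof.
move=> xi; have [x1 x2] := (prod_chart_img A B p x).1 xi.
rewrite sheared_metric_form ?(lie_frame_unit hB sadd hgH hinv)//.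
have cv := prod_coord_vec hA hB v xi; have cw := prod_coord_vec hA hB w xi.
pose ev u := lam (chart_inv (A p.1) (lsubmx x)) (coord_vec A p.1 (lsubmx x) (lsubmx u)) +
  to_lie B (chart_inv (B p.2) (rsubmx x)) (coord_vec B p.2 (rsubmx x) (rsubmx u)).
transitivity (local_form2 A h p.1 (lsubmx v) (lsubmx w) (lsubmx x) + gH 0 (ev v) (ev w)).
  exact: etrans (congr2 (g_lambda h B gH lam _) cv cw) (g_lambda_row_mx _ _ _ _ _ _).
have evE u : ev u = lsubmx u *m form_mx lam p.1 (lsubmx x) +
    rsubmx u *m lie_frame B p.2 (rsubmx x).
  exact: (congr2 +%R (form_mxE (lsubmx u) x1) (lie_frameE hB sadd (rsubmx u) x2)).
by rewrite !evE lie_gramE (local_form_gram hA hh _ _ x1).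
Qed.

Lemma gram_g_lambda p x : chart_img (AB p) x ->
  gram AB (g_lambda h B gH lam) p x =
  local_metric (gram A h p.1) (lie_frame B p.2) lie_gram (form_mx lam p.1) x.
Proof.
move=> xi; apply/matrixP => i j; rewrite mxE local_form_g_lambda//.
by rewrite trmx_delta -rowE -colE [LHS]mxE [LHS]mxE.
Qed.

Lemma smooth_g_lambda_metric p x : chart_img (AB p) x ->
  smooth_at (local_metric (gram A h p.1) (lie_frame B p.2) lie_gram (form_mx lam p.1)) x.
Proof.
move=> xi; have [x1 x2] := (prod_chart_img A B p x).1 xi.
rewrite -(hsubmxK x); apply: smooth_local_metric.
- exact: gram_smooth.
- exact: smooth_lie_frame.
- apply: near_impl (chart_img_near hB x2) => y yi.
  exact: (lie_frame_unit hB sadd hgH hinv yi).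
- exact: smooth_form_mx.
Qed.

Lemma g_lambda_is_metric : is_metric AB (g_lambda h B gH lam).
Proof.
have [hlin hsym hpos _] := hh; have [glin gsym gpos _] := hgH; have [llin _] := hlam.
have lieL := to_lie_linear hB sadd.
split.
- move=> p u a v w; rewrite /g_lambda !linearP /= llin lieL hlin.
  rewrite addrACA -scalerDr glin mulrDr -!addrA; congr (_ + _).
  by rewrite addrCA.
- by move=> p v w; exact: (congr2 +%R (hsym _ _ _) (gsym _ _ _)).
- move=> p v v0; rewrite /g_lambda.
  have gge w : 0 <= gH 0 w w.
    have [->|w0] := eqVneq w 0; last exact/ltW/gpos.
    by rewrite lie_gramE !mul0mx mxE.
  have [v1|v1] := eqVneq (lsubmx v) 0; last by rewrite ltr_pwDl// hpos.
  have l0 : lam p.1 0 = 0.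
    have := llin p.1 1 0 0; rewrite !scale1r addr0 => /eqP.
    by rewrite -subr_eq0 opprD addrA subrr sub0r oppr_eq0 => /eqP.
  rewrite v1 l0 add0r -(left_invariant_to_lie hinv).
  have -> : h p.1 0 0 = 0.
    have := hlin p.1 0 1 0 0; rewrite scale1r addr0 mul1r => /eqP.
    by rewrite -subr_eq0 opprD addrA subrr sub0r oppr_eq0 => /eqP.
  rewrite add0r; apply: gpos; apply: contra_neq v0 => v2.
  by rewrite -(hsubmxK v) v1 v2 row_mx0.
- move=> p v w; apply: smooth_at_on => x xi.
  have E : \near x, (v *m local_metric (gram A h p.1) (lie_frame B p.2) lie_gram
      (form_mx lam p.1) x *m w^T) 0 0 = local_form2 AB (g_lambda h B gH lam) p v w x.
    by apply: near_impl (chart_img_near hAB xi) => y yi; rewrite local_form_g_lambda.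
  apply: smooth_at_eq E _; apply: smooth_entry.
  apply: smooth_mulmx; last exact: smooth_cst.
  by apply: smooth_mulmx; [exact: smooth_cst|exact: smooth_g_lambda_metric].
Qed.

End Form.
End TotalSpace.

(** * Intertwining the Laplacians *)

Lemma smooth_fun_comp {R : realType} {S T : topologicalType} n m (A : atlas R S n)
    (B : atlas R T m) (F : S -> T) (u : T -> R) :
  smooth_atlas A -> smooth_atlas B -> smooth_map A B F ->
  smooth_fun B u -> smooth_fun A (u \o F).
Proof.
move=> hA hB sF su p; apply: smooth_at_on => x xi.
set q := F (chart_inv (A p) x).
have qd : chart_dom (B q) (F (chart_inv (A p) x)) by exact: chart_dom_self.
have s1 := smooth_map_rep hA hB sF xi qd.
have zi : chart_img (B q) (local_rep A B F p q x) by exists (F (chart_inv (A p) x)).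
apply: smooth_at_eq _ (smooth_comp_real s1 (smooth_fun_at hB su zi)).
apply: near_impl (smooth_map_chart_near hA hB sF xi qd) => y yd.
exact: (congr1 u (chart_funK hB yd)).
Qed.

Section Intertwining.
Context {R : realType} {N : topologicalType} {n : nat} (A : atlas R N n).
Context {H : topologicalZmodType} {k : nat} (B : atlas R H k).
Context (h : form2 R N n) (gH : form2 R H k).
Hypotheses (hA : smooth_atlas A) (hh : is_metric A h).
Hypothesis hB : smooth_atlas B.
Hypothesis sadd : smooth_map (prod_atlas B B) B (fun z : H * H => z.1 + z.2).
Hypothesis sopp : smooth_map B B (fun z : H => - z).
Hypotheses (hgH : is_metric B gH) (hinv : left_invariant B gH).

Let AB := prod_atlas A B.
Let hAB : smooth_atlas AB := prod_smooth_atlas hA hB.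

(** The isometry of the base and the translation of the fibre are treated together: [F = id] gives
    the action of [H], and [a = 0] gives the transfer map. *)
Definition prod_map (F : N -> N) (a : H) (z : N * H) : N * H := (F z.1, a + z.2).

Definition form1_pullback (F : N -> N) (lam : form1 R N n k) : form1 R N n k :=
  fun p v => lam (F p) (mdiff A A F p v).

Section Pull.
Variables (F : N -> N) (a : H) (lam : form1 R N n k).
Hypotheses (sF : smooth_map A A F) (hlam : is_form1 A lam).
Hypothesis iF : forall p v w, h (F p) (mdiff A A F p v) (mdiff A A F p w) = h p v w.

Let sF1 : smooth_map AB A (F \o fst).
Proof. exact: (smooth_map_comp hAB hA hA (smooth_map_fst hA hB) sF). Qed.

Let sT2 : smooth_map AB B ((fun y => a + y) \o snd).
Proof.
exact: (smooth_map_comp hAB hB hB (smooth_map_snd hA hB) (smooth_transl hB sadd a)).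
Qed.

Lemma smooth_prod_map : smooth_map AB AB (prod_map F a).
Proof. exact: (smooth_map_pair hAB hA hB sF1 sT2). Qed.

Lemma mdiff_prod_map p v : mdiff AB AB (prod_map F a) p v =
  row_mx (mdiff A A F p.1 (lsubmx v)) (mdiff B B (fun y => a + y) p.2 (rsubmx v)).
Proof.
have E := mdiff_pair hAB hA hB sF1 sT2 p v.
have E1 := mdiff_comp hAB hA hA (smooth_map_fst hA hB) sF p v.
have E2 := mdiff_comp hAB hB hB (smooth_map_snd hA hB) (smooth_transl hB sadd a) p v.
rewrite (mdiff_fst B hA) in E1; rewrite (mdiff_snd A hB) in E2.
by apply: etrans E _; rewrite E1 E2.
Qed.

Lemma prod_map_isometry p v w :
  g_lambda h B gH lam (prod_map F a p) (mdiff AB AB (prod_map F a) p v)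
    (mdiff AB AB (prod_map F a) p w) =
  g_lambda h B gH (form1_pullback F lam) p v w.
Proof.
rewrite !mdiff_prod_map; apply: etrans (g_lambda_row_mx _ _ _ _ _ _ _ _ _) _.
have t u := to_lie_transl hB sadd a p.2 u.
exact: (congr2 +%R (iF _ _ _)
  (congr2 (gH 0) (congr1 (+%R _) (t (rsubmx v))) (congr1 (+%R _) (t (rsubmx w))))).
Qed.

Lemma form1_pullback_is_form1 : is_form1 A (form1_pullback F lam).
Proof.
have [llin _] := hlam; split=> [p c v w|p v].
  by rewrite /form1_pullback (mdiff_linear hA hA _ _ _ _ sF) llin.
apply: smooth_at_on => x xi; set q := F (chart_inv (A p) x).
have qd : chart_dom (A q) (F (chart_inv (A p) x)) by exact: chart_dom_self.
have s1 := smooth_map_rep hA hA sF xi qd.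
have E : \forall y \near x, 'D_v (local_rep A A F p q) y *m
      form_mx A lam q (local_rep A A F p q y) =
    form1_pullback F lam (chart_inv (A p) y) (coord_vec A p y v).
  apply: near_impl (near_and (chart_img_near hA xi)
    (smooth_map_chart_near hA hA sF xi qd)) => y [yi yd].
  have zi : chart_img (A q) (local_rep A A F p q y) by exists (F (chart_inv (A p) y)).
  rewrite /form1_pullback -(coord_vec_push hA hA sF v yi yd).
  rewrite -(form_mxE hA hlam _ zi); congr (lam _ _).
  exact: (chart_funK hA).
apply: smooth_at_eq E _; apply: smooth_mulmx; first exact: smooth_derive.
apply: (smooth_comp s1); apply: smooth_form_mx => //.
by exists (F (chart_inv (A p) x)).
Qed.

Lemma laplacian_prod_map (u : N * H -> R) p : smooth_fun AB u ->
  laplacian AB (g_lambda h B gH (form1_pullback F lam)) (u \o prod_map F a) p =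
  laplacian AB (g_lambda h B gH lam) u (prod_map F a p).
Proof.
move=> su.
have m1 := g_lambda_is_metric hA hh hB sadd sopp hgH hinv form1_pullback_is_form1.
have m2 := g_lambda_is_metric hA hh hB sadd sopp hgH hinv hlam.
have pi := chart_img_self hAB p.
rewrite laplacian_lap.
have := lap_pullback hAB hAB m1 m2 smooth_prod_map prod_map_isometry su pi.
by rewrite (chart_inv_self hAB) => <-.
Qed.

End Pull.

(* u + i v is equivariant with respect to the character c + i s of H, whose
   differential at 0 is i <., Z>. *)
Definition character_pair (c s : H -> R) (u v : N * H -> R) :=
  (forall p z a, u (p, z + a) = c a * u (p, z) - s a * v (p, z)) /\
  (forall p z a, v (p, z + a) = c a * v (p, z) + s a * u (p, z)).

Definition character_at (c s : H -> R) (Z : 'rV[R]_k) :=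
  [/\ smooth_fun B c, smooth_fun B s,
      forall w, 'D_w (c \o chart_inv (B 0)) (chart_fun (B 0) 0) = 0 &
      forall w, 'D_w (s \o chart_inv (B 0)) (chart_fun (B 0) 0) = gH 0 w Z].

Lemma derive_translate (c : H -> R) q y w : smooth_fun B c -> chart_img (B q) y ->
  'D_w (fun z => c (- chart_inv (B q) y + chart_inv (B q) z)) y =
  'D_(w *m lie_frame B q y) (c \o chart_inv (B 0)) (chart_fun (B 0) 0).
Proof.
move=> sc yi; set t := chart_inv (B q) y.
have st := smooth_transl hB sadd (- t).
have yd : chart_dom (B 0) (- t + chart_inv (B q) y).
  by rewrite addNr; exact: chart_dom_self.
have s1 := smooth_map_rep hB hB st yi yd.
have e : local_rep B B (fun x => - t + x) q 0 y = chart_fun (B 0) 0.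
  by rewrite /local_rep /= addNr.
have s2 := smooth_fun_at hB sc (chart_img_self hB 0).
have s2' : smooth_at (c \o chart_inv (B 0)) (local_rep B B (fun x => - t + x) q 0 y).
  by rewrite e.
transitivity ('D_w ((c \o chart_inv (B 0)) \o local_rep B B (fun x => - t + x) q 0) y).
  apply: near_eq_derive.
  apply: near_impl (smooth_map_chart_near hB hB st yi yd) => z zd.
  by rewrite /local_rep /= (chart_funK hB zd).
apply: etrans (derive_comp_real w s1 s2') _; rewrite e; congr (derive _ _ _).
rewrite -(lie_frameE hB sadd w yi).
have cp := coord_vec_push hB hB st w yi yd.
by rewrite e (coord_vec_self hB) in cp; rewrite cp /to_lie.
Qed.

(** Equivariance writes the function on a fibre as u(q, t) c(z - t) - v(q, t) s(z - t), which is
    differentiated at z = t. The matrix [Z *m lie_gram B gH] turns the scalar product with [Z] into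
    a plain matrix product. *)
Lemma character_pair_derive c s Z u v p x w :
  character_at c s Z -> character_pair c s u v -> chart_img (AB p) x ->
  'D_(row_mx 0 w) (u \o chart_inv (AB p)) x =
  - ((w *m lie_frame B p.2 (rsubmx x) *m (Z *m lie_gram B gH)^T) 0 0 *
     v (chart_inv (AB p) x)).
Proof.
move=> [sc ss Dc Ds] [Hu _] xi.
have [x1 x2] := (prod_chart_img A B p x).1 xi.
rewrite -{1}(hsubmxK x) derive_slice.
set t := chart_inv (B p.2) (rsubmx x); set q := chart_inv (A p.1) (lsubmx x).
pose C y := c (- t + chart_inv (B p.2) y); pose S y := s (- t + chart_inv (B p.2) y).
have ext (f : H -> R) : smooth_fun B f ->
    smooth_at (fun y => f (- t + chart_inv (B p.2) y)) (rsubmx x).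
  move=> sf; have st := smooth_transl hB sadd (- t).
  have yd : chart_dom (B 0) (- t + chart_inv (B p.2) (rsubmx x)).
    by rewrite addNr; exact: chart_dom_self.
  have s1 := smooth_map_rep hB hB st x2 yd.
  have zi : chart_img (B 0) (local_rep B B (fun x => - t + x) p.2 0 (rsubmx x)).
    by exists (- t + chart_inv (B p.2) (rsubmx x)).
  apply: smooth_at_eq _ (smooth_comp_real s1 (smooth_fun_at hB sf zi)).
  apply: near_impl (smooth_map_chart_near hB hB st x2 yd) => z zd.
  by rewrite /local_rep /= (chart_funK hB zd).
have sC := ext c sc; have sS := ext s ss.
transitivity ('D_w (fun y => u (q, t) * C y - v (q, t) * S y) (rsubmx x)).
  apply: near_eq_derive; apply: near_all => y /=.
  by rewrite /C /S mulrC [v _ * _]mulrC -(Hu q t) addNKr row_mxKl row_mxKr.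
have cu := smoothM (smooth_cstR (u (q, t)) (rsubmx x)) sC.
have cv := smoothM (smooth_cstR (v (q, t)) (rsubmx x)) sS.
apply: etrans (sderiveB w cu cv) _.
rewrite (sderiveMc _ w sC) (sderiveMc _ w sS) (derive_translate w sc x2).
rewrite (derive_translate w ss x2) Dc Ds mulr0 sub0r; congr (- _).
rewrite mulrC; congr (_ * _); rewrite (lie_gramE hB hgH) trmx_mul.
have -> : (lie_gram B gH)^T = lie_gram B gH by exact: (gram_sym hgH).
by rewrite mulmxA.
Qed.

End Intertwining.

Lemma lap_near_metric {R : realType} n (G G' : 'rV[R]_n -> 'M[R]_n) f x :
  (\forall y \near x, G y = G' y) -> lap G f x = lap G' f x.
Proof.
move=> GG; rewrite /lap; apply: (congr1 -%R).
have v : \forall y \near x, volume G y = volume G' y.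
  by apply: near_impl GG => y E; rewrite /volume E.
rewrite (divg_near_metric _ v); apply: divg_near.
by apply: near_impl GG => y E; rewrite !gradmE E.
Qed.

(** * Laplacians of two forms with a common component *)

Section Comparison.
Context {R : realType} {N : topologicalType} {n : nat} (A : atlas R N n).
Context {H : topologicalZmodType} {k : nat} (B : atlas R H k).
Context (h : form2 R N n) (gH : form2 R H k).
Hypotheses (hA : smooth_atlas A) (hh : is_metric A h).
Hypothesis hB : smooth_atlas B.
Hypothesis sadd : smooth_map (prod_atlas B B) B (fun z : H * H => z.1 + z.2).
Hypothesis sopp : smooth_map B B (fun z : H => - z).
Hypotheses (hgH : is_metric B gH) (hinv : left_invariant B gH).

Let AB := prod_atlas A B.
Let hAB : smooth_atlas AB := prod_smooth_atlas hA hB.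

(** Multiplication of u + i v by - i. Statements about the first function of a pair thereby apply to
    the second. *)
Lemma character_pair_conj (c s : H -> R) (u v : N * H -> R) :
  character_pair c s u v -> character_pair c s v (fun x => - u x).
Proof. by case=> Hu Hv; split=> p z a; rewrite ?Hu ?Hv; ring. Qed.

(** In a product chart, equality of the [Z]-components is the condition L' zeta^T = L'' zeta^T of
    [lap_local_metric], with [zeta = Z *m lie_gram B gH]. *)
Lemma laplacian_same_component lam' lam'' c s Z u v p :
  is_form1 A lam' -> is_form1 A lam'' ->
  (forall q w, component gH lam' Z q w = component gH lam'' Z q w) ->
  smooth_fun AB u -> smooth_fun AB v ->
  character_at B gH c s Z -> character_pair c s u v ->
  laplacian AB (g_lambda h B gH lam') u p = laplacian AB (g_lambda h B gH lam'') u p.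
Proof.
move=> h' h'' EZ su sv hc hp; have hp' := character_pair_conj hp.
rewrite !laplacian_lap; set x0 := chart_fun (AB p) p.
have xi : chart_img (AB p) x0 := chart_img_self hAB p.
have [x1 x2] := (prod_chart_img A B p x0).1 xi.
have ni := chart_img_near hAB xi.
have E lam (hl : is_form1 A lam) : \forall y \near x0,
    gram AB (g_lambda h B gH lam) p y =
    local_metric (gram A h p.1) (lie_frame B p.2) (lie_gram B gH) (form_mx A lam p.1) y.
  apply: near_impl ni => y yi.
  exact: (gram_g_lambda hA hh hB sadd hgH hinv hl yi).
rewrite (lap_near_metric _ (E _ h')) (lap_near_metric _ (E _ h'')).
have ex : x0 = row_mx (lsubmx x0) (rsubmx x0) by rewrite hsubmxK.
have su0 := smooth_fun_at hAB su xi; have sv0 := smooth_fun_at hAB sv xi.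
have Du : \forall x \near x0, forall w, 'D_(row_mx 0 w) (u \o chart_inv (AB p)) x =
    - ((w *m lie_frame B p.2 (rsubmx x) *m (Z *m lie_gram B gH)^T) 0 0 *
      (v \o chart_inv (AB p)) x).
  apply: near_impl ni => x xj w.
  exact: (character_pair_derive hB sadd hgH w hc hp xj).
have Dv : \forall x \near x0, forall w, 'D_(row_mx 0 w) (v \o chart_inv (AB p)) x =
    (w *m lie_frame B p.2 (rsubmx x) *m (Z *m lie_gram B gH)^T) 0 0 *
      (u \o chart_inv (AB p)) x.
  apply: near_impl ni => x xj w.
  apply: etrans (character_pair_derive hB sadd hgH w hc hp' xj) _.
  by rewrite mulrN opprK.
have fr := lie_frame_gram hB sadd hgH hinv.
have ni1 := chart_img_near hA x1; have ni2 := chart_img_near hB x2.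
rewrite ex in su0 sv0 Du Dv *.
apply: (lap_local_metric _ _ _ _ _ _ su0 sv0 Du Dv).
- exact: (gram_smooth hA hh x1).
- by apply: near_impl ni1 => y; exact: gram_posdef.
- exact: (smooth_lie_frame hB sadd sopp x2).
- by apply: near_impl ni2 => y yi; exact: (lie_frame_unit hB sadd hgH hinv yi).
- apply: near_impl ni2 => y yi; rewrite -(fr _ _ yi).
  exact: (gram_posdef hB hgH yi).
- move=> w; have ey : rsubmx x0 = chart_fun (B p.2) p.2 by exact: row_mxKr.
  have := left_invariant_divergence_free hB sadd sopp hgH hinv p.2 w.
  rewrite -ey => <-; apply: divg_near_metric.
  by apply: near_impl ni2 => y yi; rewrite /volume (fr _ _ yi).
- exact: smooth_form_mx.
- exact: smooth_form_mx.
- apply: near_impl ni1 => y yi; apply/row_matrixP => i; rewrite !row_mul.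
  have rE lam : row i (form_mx A lam p.1 y) *m (Z *m lie_gram B gH)^T =
      (component gH lam Z (chart_inv (A p.1) y) (coord_vec A p.1 y (base i)))%:M.
    have -> : row i (form_mx A lam p.1 y) =
        lam (chart_inv (A p.1) y) (coord_vec A p.1 y (base i)).
      by apply/rowP => j; rewrite [LHS]mxE [LHS]mxE.
    rewrite /component (lie_gramE hB hgH) trmx_mul.
    have -> : (lie_gram B gH)^T = lie_gram B gH by exact: (gram_sym hgH).
    by rewrite mulmxA [LHS]mx11_scalar.
  by rewrite !rE EZ.
Qed.

End Comparison.

(** * Transfer of a single eigenfunction *)

Section Transfer.
Context {R : realType} {N : topologicalType} {n : nat} (A : atlas R N n).
Context {H : topologicalZmodType} {k : nat} (B : atlas R H k).
Context (h : form2 R N n) (gH : form2 R H k).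
Hypotheses (hA : smooth_atlas A) (hh : is_metric A h).
Hypothesis hB : smooth_atlas B.
Hypothesis sadd : smooth_map (prod_atlas B B) B (fun z : H * H => z.1 + z.2).
Hypothesis sopp : smooth_map B B (fun z : H => - z).
Hypotheses (hgH : is_metric B gH) (hinv : left_invariant B gH).
Variable mu : R.

Let AB := prod_atlas A B.
Let hAB : smooth_atlas AB := prod_smooth_atlas hA hB.

Lemma eigenfunction_prod_map F a lam u : is_isometry A h F -> is_form1 A lam ->
  eigenfunction AB (g_lambda h B gH lam) mu u ->
  eigenfunction AB (g_lambda h B gH (form1_pullback A F lam)) mu (u \o prod_map F a).
Proof.
move=> [[sF _] iF] hlam [su hu]; split.
  exact: (smooth_fun_comp hAB hAB (smooth_prod_map hA hB sadd a sF) su).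
move=> p; apply: etrans _ (hu (prod_map F a p)).
exact: (laplacian_prod_map hA hh hB sadd sopp hgH hinv a sF hlam iF p su).
Qed.

Lemma eigenfunction_translate a lam u : is_form1 A lam ->
  eigenfunction AB (g_lambda h B gH lam) mu u ->
  eigenfunction AB (g_lambda h B gH lam) mu (fun p => u (p.1, p.2 + a)).
Proof.
move=> hlam hu; have e q v : mdiff A A id q v = v := mdiff_id hA q v.
have iid : is_isometry A h id.
  split=> [|p v w]; last by rewrite !e.
  by split; [exact: smooth_map_id|exists id; split=> //; exact: smooth_map_id].
have := eigenfunction_prod_map a iid hlam hu.
have -> : form1_pullback A id lam = lam.
  by apply/funext => p; apply/funext => v; rewrite /form1_pullback e.
congr (eigenfunction _ _ _ _); apply/funext => p.
by rewrite /= /prod_map addrC.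
Qed.

(** Composition with F x id gives an eigenfunction for the pulled back form. That form and [lam']
    have the same [Z]-component, and the composed functions still form a pair for the same
    character. *)
Lemma eigenfunction_transfer F lam lam' c s Z u v :
  is_isometry A h F -> is_form1 A lam -> is_form1 A lam' ->
  (forall q w, component gH lam' Z q w = pullback A F (component gH lam Z) q w) ->
  eigenfunction AB (g_lambda h B gH lam) mu u ->
  eigenfunction AB (g_lambda h B gH lam) mu v ->
  character_at B gH c s Z -> character_pair c s u v ->
  eigenfunction AB (g_lambda h B gH lam') mu (fun p => u (F p.1, p.2)).
Proof.
move=> iF hlam hlam' EZ hu hv hc hp.
have [[sF _] isF] := iF.
have [su' hu'] := eigenfunction_prod_map 0 iF hlam hu.
have [sv' _] := eigenfunction_prod_map 0 iF hlam hv.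
have E (f : N * H -> R) : f \o prod_map F 0 = (fun p => f (F p.1, p.2)).
  by apply/funext => p; rewrite /= /prod_map add0r.
rewrite !E in su' hu' sv'; split=> // p.
apply: etrans _ (hu' p).
have hpl := form1_pullback_is_form1 hA sF hlam.
apply: (laplacian_same_component hA hh hB sadd sopp hgH hinv p hlam' hpl _ su' sv' hc).
  exact: EZ.
by have [Hu Hv] := hp; split=> q z a; [exact: Hu|exact: Hv].
Qed.

End Transfer.

(** * Simultaneous diagonalization of bounded actions *)

Section BoundedRepresentation.
Context {R : realType}.
Local Notation C := (complex R).
Local Notation normc := (@ComplexField.Normc.normc R).

Lemma normc_ge0 (z : C) : 0 <= normc z.
Proof. by case: z => a b; exact: sqrtr_ge0. Qed.

Lemma normc_gt0 (z : C) : z != 0 -> 0 < normc z.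
Proof.
move=> z0; rewrite lt_neqAle normc_ge0 andbT eq_sym.
by apply: contra_neq z0; exact: ComplexField.Normc.eq0_normc.
Qed.

Lemma normcX (z : C) j : normc (z ^+ j) = normc z ^+ j.
Proof.
elim: j => [|j IH]; first exact: ComplexField.Normc.normc1.
by rewrite !exprS ComplexField.Normc.normcM IH.
Qed.

Lemma normc_natr j : normc j%:R = j%:R.
Proof.
rewrite -(rmorph_nat (real_complex R)) /= expr0n addr0 sqrtr_sqr ger0_norm//.
Qed.

Lemma natr_bounded (q K : R) : 0 <= q -> (forall j : nat, j%:R * q <= K) -> q = 0.
Proof.
move=> q0 bK; apply/eqP; apply: contraT => qn.
have qp : 0 < q by rewrite lt_neqAle eq_sym qn.
have := bK (Num.bound (K / q)).
have K0 : 0 <= K by have := bK 0%N; rewrite mul0r.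
have := archi_boundP (divr_ge0 K0 q0).
by rewrite ltr_pdivrMr// => h1 h2; have := lt_le_trans h1 h2; rewrite ltxx.
Qed.

(** Bernoulli's inequality: for r > 1 the powers would dominate 1 + j (r - 1). *)
Lemma power_bounded (r K : R) : (forall j, r ^+ j <= K) -> r <= 1.
Proof.
move=> bK; rewrite leNgt; apply/negP => r1.
have t0 : 0 <= r - 1 by rewrite subr_ge0 ltW.
suff : r - 1 = 0 by move=> /eqP; rewrite subr_eq0 => /eqP e; rewrite e ltxx in r1.
apply: (natr_bounded t0 (K := K)) => j; apply: le_trans (bK j).
suff : 1 + j%:R * (r - 1) <= r ^+ j by apply: le_trans; rewrite lerDr.
elim: j => [|j IH]; first by rewrite mul0r addr0 expr0.
rewrite exprS; have := ler_wpM2l (ltW (lt_trans ltr01 r1)) IH.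
apply: le_trans; rewrite -natr1.
have : 0 <= j%:R * (r - 1) * (r - 1) by rewrite !mulr_ge0.
by move: (j%:R : R) => y; nra.
Qed.

(** The pair (g, u) is a Jordan block of size 2. If [u] is not zero, its boundedness along forward
    and backward iterates forces |lam| = 1; then [g] grows like j |u| and cannot be bounded. *)
Lemma unipotent_bounded (X : Type) (tau tau' : X -> X) (g u : X -> C) lam K :
  cancel tau' tau -> (forall x, normc (g x) <= K) -> (forall x, normc (u x) <= K) ->
  (forall x, g (tau x) = lam * g x + u x) -> (forall x, u (tau x) = lam * u x) ->
  forall x, u x = 0.
Proof.
move=> tK bg bu hg hu x; apply/eqP; apply: contraT => ux0.
have U j y : u (iter j tau y) = lam ^+ j * u y.
  by elim: j => [|j IH]; rewrite ?expr0 ?mul1r//= hu IH exprS mulrA.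
(* The additional factor [lam] avoids the exponent j - 1. *)
have G j y : lam * g (iter j tau y) = lam ^+ j * (lam * g y + j%:R * u y).
  elim: j => [|j IH]; first by rewrite expr0 mul1r mul0r addr0.
  by rewrite /= hg mulrDr IH U exprS -natr1; ring.
have itK j y : iter j tau (iter j tau' y) = y.
  by elim: j y => [|j IH] y //; rewrite iterSr /= tK IH.
set q := normc (u x); have q0 : 0 < q := normc_gt0 ux0.
set r := normc lam; have r0 : 0 <= r := normc_ge0 lam.
have r1 : r <= 1.
  apply: (power_bounded (K := K / q)) => j; rewrite ler_pdivlMr//.
  by rewrite -normcX -ComplexField.Normc.normcM -U.
have qr j : q <= r ^+ j * K.
  rewrite /q -(itK j x) U ComplexField.Normc.normcM normcX.
  by apply: ler_wpM2l => //; rewrite exprn_ge0.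
have K0 : 0 < K := lt_le_trans q0 (bu x).
have rp : 0 < r.
  rewrite lt_neqAle r0 andbT eq_sym; apply/eqP => e; have := qr 1%N.
  by rewrite expr1 e mul0r leNgt q0.
have r2 : r^-1 <= 1.
  apply: (power_bounded (K := K / q)) => j; rewrite exprVn ler_pdivlMr//.
  by rewrite ler_pdivrMl ?exprn_gt0.
have e1 : r = 1.
  by apply/eqP; rewrite eq_le r1 -(invr_le1 _ rp) ?unitfE ?gt_eqF.
suff : q = 0 by move=> e; rewrite e ltxx in q0.
apply: (natr_bounded (ltW q0) (K := K + K)) => j.
have -> : j%:R * q = normc (lam * g (iter j tau x) + - (lam ^+ j * lam * g x)).
  rewrite G (_ : _ + _ = lam ^+ j * (j%:R * u x)); last by ring.
  by rewrite !ComplexField.Normc.normcM normcX -/r e1 expr1n mul1r normc_natr.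
apply: le_trans (le_normcD _ _) _; rewrite normcN !ComplexField.Normc.normcM.
by rewrite normcX -/r e1 expr1n !mul1r lerD.
Qed.

(** Boundedness excludes Jordan blocks of size 2: a row killed by (M - r)^2 is already killed by M -
    r. Repeated factors of the minimal polynomial can therefore be dropped, and over the complex
    numbers it splits into distinct linear factors. *)
Lemma bounded_rep_diagonalizable (X : Type) (tau tau' : X -> X) m
    (e : X -> 'cV[C]_m) (M : 'M[C]_m) K :
  cancel tau' tau -> (forall i x, normc (e x i 0) <= K) ->
  (forall w : 'rV_m, (forall x, w *m e x = 0) -> w = 0) ->
  (forall x, e (tau x) = M *m e x) -> diagonalizable M.
Proof.
move=> tK be ie hM; case: m => [|m] in e M be ie hM *.
  by exists 1%:M; [exact: unitmx1|apply/diagonalizable_forPp => -[]].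
have bw (w : 'rV_m.+1) : exists K', forall x, normc ((w *m e x) 0 0) <= K'.
  exists (\sum_i normc (w 0 i) * K) => x; rewrite mxE.
  elim/big_ind2 : _ => [|a b c d h1 h2|i _].
  - by rewrite ComplexField.Normc.normc0.
  - exact: le_trans (le_normcD _ _) (lerD h1 h2).
  - by rewrite ComplexField.Normc.normcM ler_wpM2l ?normc_ge0.
have key (w : 'rV_m.+1) r : w *m (M - r%:M) *m (M - r%:M) = 0 -> w *m (M - r%:M) = 0.
  move=> w2; apply: ie => x; rewrite [LHS]mx11_scalar.
  have [K1 b1] := bw w; have [K2 b2] := bw (w *m (M - r%:M)).
  rewrite (unipotent_bounded (g := fun x => (w *m e x) 0 0)
    (u := fun x => (w *m (M - r%:M) *m e x) 0 0) (lam := r) (K := Num.max K1 K2) tK).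
  - by rewrite raddf0.
  - by move=> y; rewrite le_max b1.
  - by move=> y; rewrite le_max b2 orbT.
  - move=> y; rewrite hM mulmxA.
    have -> : w *m M = r *: w + w *m (M - r%:M).
      by rewrite mulmxBr mul_mx_scalar addrC subrK.
    by rewrite mulmxDl -scalemxAl [LHS]mxE [X in X + _]mxE.
  - move=> y; rewrite hM mulmxA; move: w2; set v := w *m (M - _).
    rewrite mulmxBr mul_mx_scalar => /eqP; rewrite subr_eq0 => /eqP ->.
    by rewrite -scalemxAl mxE.
have sq q r : horner_mx M (q * ('X - r%:P) * ('X - r%:P)) = 0 ->
    horner_mx M (q * ('X - r%:P)) = 0.
  rewrite !rmorphM /= rmorphB /= horner_mx_X horner_mx_C -!mulmxE => h2.
  apply/row_matrixP => i; rewrite row0 row_mul.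
  by apply: key; rewrite -!row_mul h2 row0.
(* [q] carries the factors already visited, so that the induction on the list of roots can refer to
   all others. *)
have red rs q : horner_mx M (q * \prod_(r <- rs) ('X - r%:P)) = 0 ->
    horner_mx M (q * \prod_(r <- undup rs) ('X - r%:P)) = 0.
  elim: rs q => [//|r s IH] q; rewrite big_cons mulrA => /IH /=.
  case: ifP => rs; last by rewrite big_cons mulrA.
  have rs' : r \in undup s by rewrite mem_undup.
  rewrite !(big_rem r rs') /=; set Q := \prod_(_ <- _) _; set c := 'X - _ => h2.
  have -> : q * (c * Q) = q * Q * c by ring.
  by apply: sq; rewrite -[RHS]h2 -/c; congr (horner_mx M _); ring.
apply/diagonalizableP; have [rs E] := closed_field_poly_normal (mxminpoly M).
exists (undup rs); first exact: undup_uniq.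
apply: mxminpoly_min; rewrite -[X in horner_mx _ X]mul1r; apply: red.
have /monicP E1 := mxminpoly_monic M; rewrite E1 scale1r in E.
by rewrite mul1r -E mx_root_minpoly.
Qed.

End BoundedRepresentation.

Lemma Re_sum {R : realType} (I : finType) (F : I -> complex R) :
  complex.Re (\sum_i F i) = \sum_i complex.Re (F i).
Proof. by apply: (big_morph _ _ (erefl _)) => -[a b] [c d]. Qed.

Lemma Im_sum {R : realType} (I : finType) (F : I -> complex R) :
  complex.Im (\sum_i F i) = \sum_i complex.Im (F i).
Proof. by apply: (big_morph _ _ (erefl _)) => -[a b] [c d]. Qed.

(** Reduces an infinite family to finitely many members: the matrices of all translations to a list
    that can be diagonalized simultaneously, and the values of functions at all points to finitely
    many sample points. *)
Lemma finite_span (K : fieldType) (V : vectType K) (T : Type) (f : T -> V) :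
  exists s : seq T, forall a, f a \in <<map f s>>%VS.
Proof.
pose D d := `[< exists s : seq T, \dim <<map f s>> = d >].
have exD : exists d, D d by exists (\dim <<map f [::]>>); apply/asboolP; exists [::].
have bD d : D d -> (d <= \dim {: V})%N.
  by move=> /asboolP[s <-]; apply: dimvS; exact: subvf.
case: (ex_maxnP exD bD) => d /asboolP[s ds] dmax; exists s => a.
have sub : (<<map f s>> <= <<map f (a :: s)>>)%VS.
  by apply: sub_span => x xs; rewrite inE xs orbT.
have E : \dim <<map f (a :: s)>> = \dim <<map f s>>.
  apply/eqP; rewrite eqn_leq (dimvS sub) andbT ds dmax//.
  by apply/asboolP; exists (a :: s).
have /eqP -> : <<map f s>>%VS == <<map f (a :: s)>>%VS by rewrite eqEdim sub E leqnn.
by apply: memv_span; rewrite inE eqxx.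
Qed.

Section SimultaneousDiagonalization.
Context {R : realType}.
Local Notation C := (complex R).
Local Notation toC := (real_complex R).
Context {X : Type} {H : zmodType} (act : X -> H -> X).
Hypothesis act0 : forall x, act x 0 = x.
Hypothesis actD : forall x a b, act (act x a) b = act x (a + b).
Context {m : nat} (e : 'I_m -> X -> R) (K : R).
Hypothesis be : forall i x, `|e i x| <= K.
Hypothesis ie : lin_indep e.
Hypothesis se : forall a i, exists c : 'I_m -> R,
  forall x, e i (act x a) = \sum_j c j * e j x.

Definition complex_col (x : X) : 'cV[C]_m := \col_j toC (e j x).

Lemma complex_col_indep (w : 'rV[C]_m) : (forall x, w *m complex_col x = 0) -> w = 0.
Proof.
move=> w0.
have E x : \sum_j w 0 j * toC (e j x) = 0.
  have /matrixP/(_ 0 0) := w0 x; rewrite [LHS]mxE [RHS]mxE; apply: etrans.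
  by apply: eq_bigr => j _; rewrite mxE.
have re j : complex.Re (w 0 j) = 0.
  apply: (ie (c := fun j => complex.Re (w 0 j))) => x.
  apply: etrans _ (congr1 (@complex.Re R) (E x)); rewrite Re_sum.
  by apply: eq_bigr => i _; case: (w 0 i) => a b /=; rewrite mulr0 subr0.
have im j : complex.Im (w 0 j) = 0.
  apply: (ie (c := fun j => complex.Im (w 0 j))) => x.
  apply: etrans _ (congr1 (@complex.Im R) (E x)); rewrite Im_sum.
  by apply: eq_bigr => i _; case: (w 0 i) => a b /=; rewrite mulr0 add0r.
apply/rowP => j; rewrite [RHS]mxE; have := re j; have := im j.
by case: (w 0 j) => a b /= -> ->.
Qed.

Lemma complex_col_eq (M M' : 'M[C]_m) :
  (forall x, M *m complex_col x = M' *m complex_col x) -> M = M'.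
Proof.
move=> E; apply/eqP; rewrite -subr_eq0; apply/eqP/row_matrixP => i; rewrite row0.
by apply: complex_col_indep => x; rewrite -row_mul mulmxBl E subrr row0.
Qed.

(** Linear independence makes the matrix of each translation unique, so these matrices commute like
    the translations. A finite spanning list is diagonalized simultaneously, and being diagonal in a
    given basis passes to linear combinations. [chi i a] is the [i]-th diagonal entry. *)
Lemma bounded_action_diagonalizable : exists (P : 'M[C]_m) (chi : 'I_m -> H -> C),
  P \in unitmx /\ forall i x a,
    (P *m complex_col (act x a)) i 0 = chi i a * (P *m complex_col x) i 0.
Proof.
have [rho hr] : exists rho : H -> 'M[R]_m, forall a i x,
    e i (act x a) = \sum_j rho a i j * e j x.
  have [f hf] := choice (fun ai : H * 'I_m => se ai.1 ai.2).
  exists (fun a => \matrix_(i, j) f (a, i) j) => a i x; rewrite (hf (a, i)).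
  by apply: eq_bigr => j _; rewrite mxE.
pose M a : 'M[C]_m := map_mx toC (rho a).
have hM a x : complex_col (act x a) = M a *m complex_col x.
  apply/colP => i; rewrite !mxE hr rmorph_sum; apply: eq_bigr => j _.
  by rewrite rmorphM !mxE.
have Mc a b : comm_mx (M a) (M b).
  by apply: complex_col_eq => x; rewrite -!mulmxA -!hM !actD addrC.
have Md a : diagonalizable (M a).
  apply: (bounded_rep_diagonalizable (tau := act^~ a) (tau' := act^~ (- a)) (K := K)
    _ _ complex_col_indep (hM a)).
    by move=> x /=; rewrite actD addNr act0.
  by move=> i x; rewrite mxE /= expr0n addr0 sqrtr_sqr.
have [s hs] := finite_span M.
have [|P uP /allP diagP] := (codiagonalizableP (map M s)).1.
  by split=> [_ _ /mapP[a _ ->] /mapP[b _ ->]|_ /mapP[a _ ->]].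
have diag a i j : i != j -> (P *m M a *m invmx P) i j = 0.
  move=> ij; have /coord_span -> : M a \in <<in_tuple (map M s)>>%VS by exact: hs.
  rewrite mulmx_sumr mulmx_suml summxE big1// => l _.
  have /diagP/(diagonalizable_forP _ uP) z : (in_tuple (map M s))`_l \in map M s.
    exact: mem_nth.
  by rewrite -scalemxAr -scalemxAl mxE (z i j ij) mulr0.
exists P, (fun i a => (P *m M a *m invmx P) i i); split=> // i x a.
have -> : P *m complex_col (act x a) = P *m M a *m invmx P *m (P *m complex_col x).
  by rewrite hM !mulmxA mulmxKV.
rewrite [LHS]mxE (bigD1 i)//= big1 ?addr0// => j ij.
by rewrite diag ?mul0r// eq_sym.
Qed.

End SimultaneousDiagonalization.

(** Complex independence of the [m] combinations W G is visible on finitely many sample points, so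
    the real sample matrix of [G] has rank at least [m]. A maximal set of independent rows selects
    the functions. *)
Lemma lin_indep_real_parts {R : realType} (X : Type) m r (G : 'I_r -> X -> R)
    (W : 'M[complex R]_(m, r)) :
  (forall w : 'rV_m,
     (forall x, w *m (W *m \col_l real_complex R (G l x)) = 0) -> w = 0) ->
  exists m' (f : 'I_m' -> 'I_r), (m <= m')%N /\ lin_indep (fun i => G (f i)).
Proof.
move=> hW; pose F x := W *m \col_l real_complex R (G l x).
have [s hs] := finite_span F.
pose A := \matrix_(l < r, j < size s) G l (tnth (in_tuple s) j).
have rf : row_free (W *m map_mx (real_complex R) A).
  rewrite -kermx_eq0; apply/rowV0P => w /sub_kermxP w0; apply: hW => x; rewrite -/(F x).
  have /coord_span -> : F x \in <<in_tuple (map F s)>>%VS by exact: hs.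
  rewrite mulmx_sumr big1// => j _; rewrite -scalemxAr.
  have js : (j < size s)%N by rewrite -(size_map F).
  have -> : (in_tuple (map F s))`_j = W *m col (Ordinal js) (map_mx (real_complex R) A).
    rewrite /= (nth_map x)//; congr (_ *m _).
    by apply/colP => l; rewrite !mxE (tnth_nth x).
  by rewrite colE !mulmxA -(mulmxA w) w0 mul0mx scaler0.
exists (\rank A), (maxrankfun A); split.
  rewrite -(mxrank_map (real_complex R)); move: rf => /eqP {1}<-.
  exact: mxrankM_maxr.
move=> c hc i.
have /row_free_inj inj := maxrowsub_free A.
have /rowP/(_ i) : \row_i c i = 0 :> 'rV_(\rank A); last by rewrite !mxE.
apply: inj; rewrite mul0mx; apply/rowP => j; rewrite [LHS]mxE [RHS]mxE.
rewrite -[RHS](hc (tnth (in_tuple s) j)); apply: eq_bigr => l _.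
by rewrite !mxE.
Qed.

(** * Independence after composition with maps that depend on the character *)

Section EquivariantIndependence.
Context {K : fieldType} {X : Type} {H : zmodType} (act : X -> H -> X).
Context {m : nat} (F : 'I_m -> X -> K) (chi : 'I_m -> H -> K) (Phi : 'I_m -> X -> X).
Hypothesis eF : forall i x a, F i (act x a) = chi i a * F i x.
Hypothesis iF : forall c : 'I_m -> K,
  (forall x, \sum_i c i * F i x = 0) -> forall i, c i = 0.
Hypothesis ePhi : forall i x a, Phi i (act x a) = act (Phi i x) a.
Hypothesis cPhi : forall i j, chi i = chi j -> Phi i = Phi j.
Hypothesis sPhi : forall i y, exists x, Phi i x = y.

(* Applying the operators T_b - chi_j(b), where T_b is the translation by b,
   kills the components whose character is not chi_i; on the others Phi is constant. *)
Lemma equivariant_indep (c : 'I_m -> K) :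
  (forall x, \sum_i c i * F i (Phi i x) = 0) -> forall i, c i = 0.
Proof.
move=> hc i.
have op (s : seq (H * K)) x :
    \sum_j (\prod_(p <- s) (chi j p.1 - p.2)) * (c j * F j (Phi j x)) = 0.
  elim: s x => [|[b t] s IH] x.
    by rewrite -[RHS](hc x); apply: eq_bigr => j _; rewrite big_nil mul1r.
  transitivity (\sum_j (\prod_(p <- s) (chi j p.1 - p.2)) * (c j * F j (Phi j (act x b))) -
      t * \sum_j (\prod_(p <- s) (chi j p.1 - p.2)) * (c j * F j (Phi j x))).
    rewrite mulr_sumr -sumrB; apply: eq_bigr => j _.
    by rewrite big_cons /= ePhi eF; ring.
  by rewrite (IH (act x b)) (IH x) mulr0 subr0.
(* If the characters agree, the witness is a dummy: the list [s] below omits such [j]. *)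
have sep j : exists a, chi j <> chi i -> chi j a != chi i a.
  have [e|ne] := pselect (chi j = chi i); first by exists 0.
  apply: contrapT => h; apply: ne; apply/funext => a.
  by apply/eqP; apply: contra_notT h => h; exists a.
have [b hb] := choice sep.
pose s := [seq (b j, chi j (b j)) | j <- enum 'I_m & ~~ `[< chi j = chi i >]].
pose kappa j := \prod_(p <- s) (chi j p.1 - p.2).
have k0 j : chi j <> chi i -> kappa j = 0.
  move=> ne; apply/eqP; rewrite /kappa prodf_seq_eq0; apply/hasP.
  exists (b j, chi j (b j)); last by rewrite /= subrr.
  by apply: map_f; rewrite mem_filter mem_enum andbT; apply/asboolPn.
have ki : kappa i != 0.
  rewrite /kappa big_map big_filter prodf_seq_neq0; apply/allP => j _.
  by apply/implyP => /asboolPn ne; rewrite /= subr_eq0 eq_sym hb.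
suff /(_ i)/eqP : forall j, kappa j * c j = 0 by rewrite mulf_eq0 (negbTE ki) => /eqP.
apply: iF => y; have [x <-] := sPhi i y; rewrite -[RHS](op s x).
apply: eq_bigr => j _; rewrite -/(kappa j).
have [e|ne] := pselect (chi j = chi i); first by rewrite (cPhi e) mulrA.
by rewrite (k0 _ ne) !mul0r.
Qed.

End EquivariantIndependence.

(** * Transfer of eigenspaces *)

Section EigenBasis.
Context {R : realType} {T : topologicalType} {n : nat} (A : atlas R T n).
Context (g : form2 R T n) (mu : R).
Hypotheses (hA : smooth_atlas A) (hg : is_metric A g) (cT : compact [set: T]).

Lemma eigenfunctionN f :
  eigenfunction A g mu f -> eigenfunction A g mu (fun x => - f x).
Proof.
move=> ef; have := eigenfunction_sum hA hg (I := 'I_1) (fun _ => -1) (fun _ => ef).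
by congr (eigenfunction _ _ _ _); apply/funext => x; rewrite big_ord1 mulN1r.
Qed.

Lemma smooth_fun_bounded (J : finType) (e : J -> T -> R) :
  (forall i, smooth_fun A (e i)) -> exists K, forall i x, `|e i x| <= K.
Proof.
move=> se.
have b1 i : exists K, forall x, `|e i x| <= K.
  have cn : {within [set: T], continuous (fun y => `|e i y|)}.
    apply: continuous_subspaceT => y; apply: (@continuous_comp _ _ _ (e i) Num.norm).
      exact: (smooth_fun_continuous hA (se i)).
    exact: norm_continuous.
  have [[q _]|h] := pselect (exists q : T, True); last first.
    by exists 0 => x; case: h; exists x.
  have [c _ cmax] := compact_EVT_max (ex_intro _ q I) cT cn.
  by exists `|e i c| => y; apply: cmax; rewrite inE.
have [K hK] := choice b1.
exists (\sum_i `|K i|) => i x; rewrite (bigD1 i)//=.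
apply: le_trans (hK i x) _; apply: le_trans (ler_norm _) _.
by rewrite lerDl sumr_ge0.
Qed.

(** Sizes of independent families are bounded, so a largest one exists. Any further eigenfunction
    satisfies a relation with it, in which its own coefficient is nonzero because the family is
    independent. *)
Lemma exists_eigenbasis : exists m (e : 'I_m -> T -> R),
  [/\ forall i, eigenfunction A g mu (e i), lin_indep e,
      forall m' (e' : 'I_m' -> T -> R),
        (forall i, eigenfunction A g mu (e' i)) -> lin_indep e' -> (m' <= m)%N &
      forall f, eigenfunction A g mu f ->
        exists c : 'I_m -> R, forall x, f x = \sum_j c j * e j x].
Proof.
have [M hM] := lin_indep_eigen_bound hA hg mu cT.
pose D m := `[< exists e : 'I_m -> T -> R,
  (forall i, eigenfunction A g mu (e i)) /\ lin_indep e >].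
have exD : exists m, D m.
  by exists 0%N; apply/asboolP; exists (fun _ _ => 0); split=> [[]|c _ []].
have bD m : D m -> (m <= M)%N by move=> /asboolP[e [he ie]]; exact: hM he ie.
case: (ex_maxnP exD bD) => m /asboolP[e [he ie]] mmax; exists m, e; split=> //.
  by move=> m' e' he' ie'; apply: mmax; apply/asboolP; exists e'.
move=> f ef.
pose e' (i : 'I_m.+1) := if unlift ord0 i is Some j then e j else f.
have he' i : eigenfunction A g mu (e' i) by rewrite /e'; case: unliftP.
have sumE (c : 'I_m.+1 -> R) x : \sum_i c i * e' i x =
    c ord0 * f x + \sum_j c (lift ord0 j) * e j x.
  rewrite big_ord_recl /e' unlift_none; congr (_ + _).
  by apply: eq_bigr => j _; rewrite liftK.
have nie : ~ lin_indep e'.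
  move=> ie'; suff : (m.+1 <= m)%N by rewrite ltnn.
  by apply: mmax; apply/asboolP; exists e'.
have [c [hc c0]] : exists c : 'I_m.+1 -> R,
    (forall x, \sum_i c i * e' i x = 0) /\ exists i, c i != 0.
  apply: contrapT => h; apply: nie => c hc i; apply/eqP; apply: contrapT => /negP ci.
  by apply: h; exists c; split=> //; exists i.
have cz : c ord0 != 0.
  case: c0 => i ci; apply/eqP => z; move/eqP: ci; apply.
  have z' j : c (lift ord0 j) = 0.
    by apply: (ie (fun j => c (lift ord0 j))) => x; rewrite -[RHS](hc x) sumE z mul0r add0r.
  by have [j ->|->] := unliftP ord0 i; rewrite ?z' ?z.
exists (fun j => - (c ord0)^-1 * c (lift ord0 j)) => x.
have /eqP := hc x; rewrite sumE addr_eq0 => /eqP E.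
under eq_bigr do rewrite -mulrA; rewrite -mulr_sumr mulNr -mulrN -E mulKf//.
Qed.

End EigenBasis.

Section CharacterOfPair.
Context {R : realType} {N : topologicalType} {n : nat} (A : atlas R N n).
Context {H : topologicalZmodType} {k : nat} (B : atlas R H k) (gH : form2 R H k).
Hypotheses (hA : smooth_atlas A) (hB : smooth_atlas B).
Hypothesis sadd : smooth_map (prod_atlas B B) B (fun z : H * H => z.1 + z.2).
Hypothesis hgH : is_metric B gH.

Let AB := prod_atlas A B.
Let hAB : smooth_atlas AB := prod_smooth_atlas hA hB.

(** The vector that represents the differential of [s] at 0 through the scalar product of the Lie
    algebra. *)
Definition character_dual (s : H -> R) : 'rV[R]_k :=
  (\row_j 'D_(base j) (s \o chart_inv (B 0)) (chart_fun (B 0) 0)) *m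
  invmx (lie_gram B gH).

Lemma smooth_fun_orbit (f : N * H -> R) p z : smooth_fun AB f ->
  smooth_fun B (fun a => f (p, z + a)).
Proof.
move=> sf; apply: (smooth_fun_comp (F := fun a => (p, z + a)) hB hAB) sf.
apply: (smooth_map_pair hB hA hB); first exact: smooth_map_cst.
exact: smooth_transl.
Qed.

Lemma smooth_funZD (f f' : H -> R) (a b : R) : smooth_fun B f -> smooth_fun B f' ->
  smooth_fun B (fun x => a * f x + b * f' x).
Proof.
move=> sf sf' p; apply: smooth_at_on => x xi.
exact: (smoothD (smoothM (smooth_cstR a x) (smooth_fun_at hB sf xi))
  (smoothM (smooth_cstR b x) (smooth_fun_at hB sf' xi))).
Qed.

Variables (c s : H -> R) (u v : N * H -> R) (K : R) (x0 : N * H).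
Hypotheses (su : smooth_fun AB u) (sv : smooth_fun AB v).
Hypotheses (bu : forall x, `|u x| <= K) (bv : forall x, `|v x| <= K).
Hypothesis hp : character_pair c s u v.
Hypothesis nz : u x0 ^+ 2 + v x0 ^+ 2 != 0.

Let U x := u x ^+ 2 + v x ^+ 2.

(** Translation by [a] multiplies u^2 + v^2 by c(a)^2 + s(a)^2. Since u^2 + v^2 is bounded and
    nonzero at [x0], iterating shows that this factor is at most 1; the factors of [a] and [- a]
    have product 1. *)
Lemma character_pair_modulus a : c a ^+ 2 + s a ^+ 2 = 1.
Proof.
have [Hu Hv] := hp.
have U0 x : 0 <= U x by rewrite addr_ge0 ?sqr_ge0.
have Up : 0 < U x0 by rewrite lt_neqAle eq_sym nz U0.
have UE p z b : U (p, z + b) = (c b ^+ 2 + s b ^+ 2) * U (p, z).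
  by rewrite /U Hu Hv; ring.
have bU x : U x <= K ^+ 2 + K ^+ 2.
  have K0 : 0 <= K by apply: le_trans (bu x).
  rewrite /U -(real_normK (num_real (u x))) -(real_normK (num_real (v x))).
  apply: lerD; rewrite ler_sqr ?nnegrE//.
have le1 b : c b ^+ 2 + s b ^+ 2 <= 1.
  apply: (power_bounded (K := (K ^+ 2 + K ^+ 2) / U x0)) => j.
  rewrite ler_pdivlMr//; apply: le_trans (bU (x0.1, x0.2 + b *+ j)).
  suff -> : U (x0.1, x0.2 + b *+ j) = (c b ^+ 2 + s b ^+ 2) ^+ j * U x0 by [].
  elim: j => [|j IH]; first by rewrite mulr0n addr0 expr0 mul1r -surjective_pairing.
  by rewrite mulrSr addrA UE IH mulrA -exprS.
have inv : (c a ^+ 2 + s a ^+ 2) * (c (- a) ^+ 2 + s (- a) ^+ 2) = 1.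
  apply: (mulIf nz); rewrite mul1r -/(U x0) -mulrA.
  by rewrite {1}(surjective_pairing x0) -!UE addrNK -surjective_pairing.
apply/eqP; rewrite eq_le le1 /= -inv.
by rewrite ler_piMr ?addr_ge0 ?sqr_ge0 ?le1.
Qed.

Lemma character_pair_at0 : c 0 = 1 /\ s 0 = 0.
Proof.
have [Hu Hv] := hp.
have := Hu x0.1 x0.2 0; have := Hv x0.1 x0.2 0.
rewrite addr0 -surjective_pairing; move: nz; set x := u x0; set y := v x0 => xy e1 e2.
have e3 : (c 0 - 1) * (x ^+ 2 + y ^+ 2) = 0.
  transitivity (x * (c 0 * x - s 0 * y - x) + y * (c 0 * y + s 0 * x - y)); first by ring.
  by rewrite -e1 -e2 !subrr; ring.
have e4 : s 0 * (x ^+ 2 + y ^+ 2) = 0.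
  transitivity (x * (c 0 * y + s 0 * x - y) - y * (c 0 * x - s 0 * y - x)); first by ring.
  by rewrite -e1 -e2 !subrr; ring.
move/eqP: e3; move/eqP: e4; rewrite !mulf_eq0 (negbTE xy) !orbF subr_eq0.
by move=> /eqP-> /eqP->.
Qed.

(** Solving the equivariance relations at [x0] expresses [c] and [s] as combinations of [u] and [v]
    along the orbit, hence they are smooth. Differentiating c^2 + s^2 = 1 at 0, where c = 1 and s =
    0, shows that the differential of [c] vanishes. *)
Lemma pair_character_at : character_at B gH c s (character_dual s).
Proof.
have [Hu Hv] := hp; set p := x0.1; set z := x0.2.
have ou := smooth_fun_orbit p z su; have ov := smooth_fun_orbit p z sv.
have px : (p, z) = x0 by rewrite -surjective_pairing.
have sc : smooth_fun B c.
  have := smooth_funZD (u x0 / U x0) (v x0 / U x0) ou ov.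
  congr (smooth_fun _ _); apply/funext => a; rewrite Hu Hv px /U.
  by field.
have ss : smooth_fun B s.
  have := smooth_funZD (- v x0 / U x0) (u x0 / U x0) ou ov.
  congr (smooth_fun _ _); apply/funext => a; rewrite Hu Hv px /U.
  by field.
have i0 := chart_img_self hB 0.
have sc0 := smooth_fun_at hB sc i0; have ss0 := smooth_fun_at hB ss i0.
have [c0 s0] := character_pair_at0.
split=> // w.
  have E : (fun y => (c \o chart_inv (B 0)) y * (c \o chart_inv (B 0)) y +
      (s \o chart_inv (B 0)) y * (s \o chart_inv (B 0)) y) = cst 1.
    by apply/funext => y; rewrite /= -!expr2 character_pair_modulus.
  have := congr1 (fun f => 'D_w f (chart_fun (B 0) 0)) E.
  rewrite derive_cst (sderiveD w (smoothM sc0 sc0) (smoothM ss0 ss0)).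
  rewrite (sderiveM w sc0 sc0) (sderiveM w ss0 ss0) /= (chart_inv_self hB) c0 s0.
  by move: ('D_w _ _) ('D_w _ _) => a b; lra.
rewrite (derive_coord w (smooth_differentiable ss0)) (lie_gramE hB hgH) /character_dual.
have [gs _] := lie_gram_posdef hB hgH.
rewrite trmx_mul trmx_inv gs mulmxA mulmxK; last exact: posdef_unit (lie_gram_posdef hB hgH).
by rewrite mxE; apply: eq_bigr => j _; rewrite !mxE.
Qed.

End CharacterOfPair.

(** * Transfer of a whole eigenspace *)

Section MultiplicityTransfer.
Context {R : realType} {N : topologicalType} {n : nat} (A : atlas R N n).
Context {H : topologicalZmodType} {k : nat} (B : atlas R H k).
Context (h : form2 R N n) (gH : form2 R H k).
Hypotheses (hA : smooth_atlas A) (hh : is_metric A h).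
Hypothesis hB : smooth_atlas B.
Hypothesis sadd : smooth_map (prod_atlas B B) B (fun z : H * H => z.1 + z.2).
Hypothesis sopp : smooth_map B B (fun z : H => - z).
Hypotheses (hgH : is_metric B gH) (hinv : left_invariant B gH).
Hypothesis cNH : compact [set: N * H].
Variable mu : R.

Let AB := prod_atlas A B.
Let hAB : smooth_atlas AB := prod_smooth_atlas hA hB.

(** The span of the given family need not be invariant under translations, so a full eigenbasis, at
    least as large by maximality, takes its place. *)
Lemma transferred_family (lam lam' : form1 R N n k) :
  is_form1 A lam -> is_form1 A lam' ->
  (forall Z, exists f, is_isometry A h f /\
    forall p v, component gH lam' Z p v = pullback A f (component gH lam Z) p v) ->
  forall m (e : 'I_m -> N * H -> R),
    (forall i, eigenfunction AB (g_lambda h B gH lam) mu (e i)) -> lin_indep e ->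
    exists m' (e' : 'I_m' -> N * H -> R),
      [/\ (m <= m')%N, forall i, eigenfunction AB (g_lambda h B gH lam') mu (e' i) &
          lin_indep e'].
Proof.
move=> hlam hlam' hiso m0 e0 he0 ie0.
have hg := g_lambda_is_metric hA hh hB sadd sopp hgH hinv hlam.
have [m [e [he ie emax espan]]] := exists_eigenbasis mu hAB hg cNH.
have [K be] := smooth_fun_bounded hAB cNH (fun i => (he i).1).
pose act (x : N * H) a := (x.1, x.2 + a).
have act0 x : act x 0 = x by rewrite /act addr0 -surjective_pairing.
have actD x a b : act (act x a) b = act x (a + b) by rewrite /act addrA.
have se a i : exists c : 'I_m -> R, forall x, e i (act x a) = \sum_j c j * e j x.
  apply: (espan (fun x => e i (act x a))).
  exact: (eigenfunction_translate hA hh hB sadd sopp hgH hinv a hlam (he i)).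
have [P [chi [uP hchi]]] := bounded_action_diagonalizable act0 actD be ie se.
pose F i x := (P *m complex_col e x) i 0.
pose u i x := complex.Re (F i x); pose v i x := complex.Im (F i x).
pose c i a := complex.Re (chi i a); pose s i a := complex.Im (chi i a).
have hu i : eigenfunction AB (g_lambda h B gH lam) mu (u i).
  have := eigenfunction_sum hAB hg (fun j => complex.Re (P i j)) he.
  congr (eigenfunction _ _ _ _); apply/funext => x; rewrite /u /F mxE Re_sum.
  apply: eq_bigr => j _; rewrite mxE.
  by case: (P i j) => a b /=; rewrite mulr0 subr0.
have hv i : eigenfunction AB (g_lambda h B gH lam) mu (v i).
  have := eigenfunction_sum hAB hg (fun j => complex.Im (P i j)) he.
  congr (eigenfunction _ _ _ _); apply/funext => x; rewrite /v /F mxE Im_sum.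
  apply: eq_bigr => j _; rewrite mxE.
  by case: (P i j) => a b /=; rewrite mulr0 add0r.
have Find (w : 'I_m -> complex R) : (forall x, \sum_i w i * F i x = 0) -> forall i, w i = 0.
  move=> w0 i; have : (\row_i w i) *m P = 0.
    apply: (complex_col_indep ie) => x; rewrite -mulmxA [LHS]mx11_scalar.
    rewrite [X in X%:M](_ : _ = 0) ?raddf0// -[RHS](w0 x) [LHS]mxE.
    by apply: eq_bigr => j _; rewrite mxE.
  move/(congr1 (mulmx^~ (invmx P))); rewrite mulmxK// mul0mx => /rowP/(_ i).
  by rewrite !mxE.
have hp i : character_pair (c i) (s i) (u i) (v i).
  split=> p z a; have := hchi i (p, z) a; rewrite -/(F i _) -/(F i _);
    rewrite /u /v /c /s -[act _ _]/(p, z + a) => ->;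
    by case: (chi i a) => x y; case: (F i (p, z)) => x' y' /=; rewrite addrC // mulrC addrC.
(* Otherwise [F i] would vanish identically, against the independence of the [F i]. *)
have nz i : exists x, u i x ^+ 2 + v i x ^+ 2 != 0.
  apply: contrapT => hz.
  have /Find/(_ i)/eqP : forall x, \sum_j (j == i)%:R * F j x = 0; last first.
    by rewrite eqxx oner_eq0.
  move=> x; rewrite (bigD1 i)//= eqxx mul1r big1 ?addr0 => [|j /negbTE ->]; last first.
    by rewrite mul0r.
  have /negP/negPn : ~ (u i x ^+ 2 + v i x ^+ 2 != 0) by move=> y; apply: hz; exists x.
  rewrite paddr_eq0 ?sqr_ge0// !sqrf_eq0 /u /v.
  by case: (F i x) => a b /= /andP[/eqP -> /eqP ->].
(* [Z i] is computed from [s i] alone, and one isometry is fixed for each vector [Z]. Functions with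
   the same character are therefore composed with the same map [Phi i], as [equivariant_indep]
   demands. *)
pose Z i := character_dual B gH (s i).
have hc i : character_at B gH (c i) (s i) (Z i).
  have [x xnz] := nz i.
  have [K' bK] := smooth_fun_bounded hAB cNH
    (e := fun b : bool => if b then u i else v i)
    (fun b => if b return smooth_fun AB (if b then u i else v i)
              then (hu i).1 else (hv i).1).
  exact: (pair_character_at hA hB sadd hgH (hu i).1 (hv i).1 (bK true) (bK false) (hp i) xnz).
have [f hf] := choice hiso.
pose Phi i (x : N * H) := (f (Z i) x.1, x.2).
have FPhi w : (forall x, \sum_i w i * F i (Phi i x) = 0) -> forall i, w i = 0.
  apply: (equivariant_indep (act := act) hchi Find) => //.
    by move=> i j E; rewrite /Phi /Z /s E.
  move=> i y; have [[[_ [g [_ _ gK]]] _] _] := hf (Z i).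
  by exists (g y.1, y.2); rewrite /Phi /= gK -surjective_pairing.
(* Real and imaginary parts give twice as many real functions as the basis has elements. The matrix
   (1, i) below recombines them into the independent functions F_i composed with Phi_i, so at least
   [m] of them are independent. *)
pose G (l : 'I_(m + m)) x :=
  match fintype.split l with inl i => u i (Phi i x) | inr i => v i (Phi i x) end.
have [m' [q [mm' iG]]] : exists m' (q : 'I_m' -> 'I_(m + m)),
    (m <= m')%N /\ lin_indep (fun i => G (q i)).
  apply: (lin_indep_real_parts (W := row_mx 1%:M ('i)%C%:M)) => w w0.
  apply/rowP => i; rewrite [RHS]mxE; apply: (FPhi (fun i => w 0 i)) => x.
  have := congr1 (fun M : 'M_1 => M 0 0) (w0 x); rewrite /= [LHS]mxE [RHS]mxE.
  apply: etrans; apply: eq_bigr => j _; congr (_ * _).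
  rewrite (_ : (\col_l _) = col_mx (\col_l real_complex R (u l (Phi l x)))
    (\col_l real_complex R (v l (Phi l x)))).
    rewrite mul_row_col mul1mx mul_scalar_mx !mxE [LHS]complexE -/(u _ _) -/(v _ _) //.
  apply/colP => l; rewrite !mxE /G; case: fintype.split => l'; by rewrite mxE.
exists m', (fun i => G (q i)); split=> //.
  by apply: leq_trans mm'; exact: emax he0 ie0.
have E i u' v' : eigenfunction AB (g_lambda h B gH lam) mu u' ->
    eigenfunction AB (g_lambda h B gH lam) mu v' -> character_pair (c i) (s i) u' v' ->
    eigenfunction AB (g_lambda h B gH lam') mu (u' \o Phi i).
  move=> hu' hv' hp'; have [iF EZ] := hf (Z i).
  exact: (eigenfunction_transfer hA hh hB sadd sopp hgH hinv iF hlam hlam' EZ hu' hv' (hc i)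
    hp').
move=> i; rewrite /G; case: (fintype.split (q i)) => j; first exact: (E j _ _ (hu j) (hv j)).
(* The imaginary part [v j] is the real part of - i (u + i v), a pair for the same character. *)
exact: (E j _ _ (hv j) (eigenfunctionN hAB hg (hu j)) (character_pair_conj (hp j))).
Qed.

End MultiplicityTransfer.

(** Lets the relation between [lam] and [lam'] be read backwards: pulling back by the inverse
    isometry exchanges the two forms, so the inequality of multiplicities holds in both
    directions. *)
Lemma isometry_inverse {R : realType} {N : topologicalType} {n : nat} (A : atlas R N n)
    (h : form2 R N n) (f : N -> N) : smooth_atlas A -> is_isometry A h f ->
  exists g : N -> N, [/\ is_isometry A h g, cancel g f &
    forall p v, mdiff A A f (g p) (mdiff A A g p v) = v].
Proof.
move=> hA [[sf [g [sg fK gK]]] isf]; exists g.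
have fg p v : mdiff A A f (g p) (mdiff A A g p v) = v.
  rewrite -(mdiff_comp hA hA hA sg sf).
  have -> : f \o g = id by apply/funext => x; exact: gK.
  exact: (mdiff_id hA).
split=> //; split; first by split=> //; exists f.
by move=> p v w; rewrite -isf !fg gK.
Qed.

Theorem proposition1p8 (R : realType)
    (N : topologicalType) (n : nat) (A : atlas R N n) (h : form2 R N n)
    (H : topologicalZmodType) (k : nat) (B : atlas R H k) (gH : form2 R H k)
    (lam lam' : form1 R N n k)
    (hN : is_closed_manifold A) (hh : is_metric A h)
    (hH : is_torus B) (hgH : is_metric B gH) (hinv : left_invariant B gH)
    (hlam : is_form1 A lam) (hlam' : is_form1 A lam')
    (hiso : forall Z : 'rV[R]_k, exists f : N -> N,
      is_isometry A h f /\
      forall (p : N) (v : 'rV[R]_n),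
        component gH lam' Z p v = pullback A f (component gH lam Z) p v) :
  isospectral (prod_atlas A B) (g_lambda h B gH lam)
              (prod_atlas A B) (g_lambda h B gH lam').
Proof.
have [mN cN] := hN; have [mH sadd sopp cH _] := hH.
have hA := manifold_smooth_atlas mN; have hB := manifold_smooth_atlas mH.
have cNH : compact [set: N * H] by rewrite -setXTT; exact: compact_setX.
have hiso' Z : exists f : N -> N, is_isometry A h f /\
    forall p v, component gH lam Z p v = pullback A f (component gH lam' Z) p v.
  have [f [iF EZ]] := hiso Z; have [g [iG gK fg]] := isometry_inverse hA iF.
  by exists g; split=> // p v; rewrite /pullback EZ /pullback fg gK.
have le mu (l l' : form1 R N n k) : is_form1 A l -> is_form1 A l' ->
    (forall Z, exists f, is_isometry A h f /\
      forall p v, component gH l' Z p v = pullback A f (component gH l Z) p v) ->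
    (multiplicity (prod_atlas A B) (g_lambda h B gH l) mu <=
     multiplicity (prod_atlas A B) (g_lambda h B gH l') mu)%E.
  move=> hl hl' E; apply: ge_ereal_sup => _ [m [e [he ie]] <-].
  have [m' [e' [mm' he' ie']]] :=
    transferred_family hA hh hB sadd sopp hgH hinv cNH hl hl' E he ie.
  apply: (@le_trans _ _ (m'%:R)%:E); first by rewrite lee_fin ler_nat.
  by apply: ereal_sup_ubound; exists m' => //; exists e'.
move=> mu; apply: le_anti; apply/andP; split; first exact: (le _ _ _ hlam hlam' hiso).
exact: (le _ _ _ hlam' hlam hiso').
Qed.
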